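(* Let $\mathcal{D}$ be a graded set, $\mathcal{D}=\bigsqcup_{n\in\mathbb{N}}\mathcal{D}(n)$, such that $\mathcal{D}(n)$ is finite for all $n\in\mathbb{N}$ and $\mathcal{D}(0)$ is empty. Then $(\mathcal{H}_{PR}^{\mathcal{D}})_{ab}$ is a cofree coalgebra. Moreover, $\mathcal{B}r(\mathcal{D})$ is free as a Lie algebra.
   Context: $K$ is a field of characteristic zero; all vector spaces and algebras are over $K$. A graded set is a set $\mathcal{D}$ with a partition $\mathcal{D}=\bigsqcup_{n\in\mathbb{N}}\mathcal{D}(n)$. $\mathcal{T}_P^{\mathcal{D}}$ is the set of planar rooted trees (finite, nonempty) whose vertices are decorated by elements of $\mathcal{D}$. For $d\in\mathcal{D}$, $B_d(t_1\ldots t_n)$ is the planar tree obtained by grafting $t_1,\ldots,t_n$ ($n\ge0$), in this order from left to right, on a common root decorated by $d$; $B_d(1)$ is the one-vertex tree decorated by $d$; $B_d$ is extended linearly to planar forests. $\mathcal{H}_{PR}^{\mathcal{D}}$ is the Hopf algebra of planar rooted trees decorated by $\mathcal{D}$: as an algebra it is the free associative algebra $K\langle\mathcal{T}_P^{\mathcal{D}}\rangle$; its coproduct is the unique algebra morphism $\Delta$ with $\Delta(B_d(x))=B_d(x)\otimes 1+(\mathrm{Id}\otimes B_d)\circ\Delta(x)$ for all $d\in\mathcal{D}$, $x\in K\langle\mathcal{T}_P^{\mathcal{D}}\rangle$; its counit sends every tree to $0$. $(\mathcal{H}_{PR}^{\mathcal{D}})_{ab}$ is its abelianisation, i.e. its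 quotient by the two-sided ideal generated by commutators, with the induced Hopf algebra structure. A coalgebra is called cofree here if it is cofree among connected (conilpotent) coalgebras, i.e. isomorphic to the tensor coalgebra $T(V)=\bigoplus_{n\ge0}V^{\otimes n}$ with the deconcatenation coproduct, for some vector space $V$. $\mathcal{B}r(\mathcal{D})=K\mathcal{T}_P^{\mathcal{D}}$ is the free brace algebra generated by $\mathcal{D}$. Its binary brace operation is the (left) pre-Lie product determined bilinearly and inductively by $\langle t;B_d(1)\rangle=B_d(t)$ and $$\langle t;B_d(t_1\ldots t_n)\rangle=\sum_{i=0}^n B_d(t_1\ldots t_i\,t\,t_{i+1}\ldots t_n)+\sum_{i=1}^n B_d(t_1\ldots t_{i-1}\langle t;t_i\rangle t_{i+1}\ldots t_n).$$ The Lie algebra structure on $\mathcal{B}r(\mathcal{D})$ is given by $[x,y]=\langle x;y\rangle-\langle y;x\rangle$. *)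

(* Defs.v *)
From HB Require Import structures.
From mathcomp Require Import all_boot all_algebra ring_quotient generic_quotient.
From mathcomp Require Import finmap boolp.
From mathcomp Require Import monalg.

Set Implicit Arguments.
Unset Strict Implicit.
Unset Printing Implicit Defensive.

Import GRing.Theory.
Import Quotient.Exports.
Local Open Scope ring_scope.
Local Open Scope quotient_scope.

HB.lock Definition lext (K : fieldType) (X : choiceType) (W : lmodType K)
    (f : X -> W) (x : {malg K[X]}) : W := \sum_(k <- msupp x) x@_k *: f k.

Section LinearExtension.
Variables (K : fieldType) (X : choiceType) (W : lmodType K).

Lemma lextEw (f : X -> W) (x : {malg K[X]}) (d : {fset X}) :
  fsubset (msupp x) d -> lext f x = \sum_(k <- d) x@_k *: f k :> W.
Proof.
move=> sub; rewrite lext.unlock; apply: big_fset_incl => // k _ /mcoeff_outdom ->.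
by rewrite scale0r.
Qed.

Lemma lext_is_linear (f : X -> W) : linear (lext f).
Proof.
move=> a x y; pose d := fsetU (msupp x) (msupp y).
have sx : fsubset (msupp x) d by apply: fsubsetUl.
have sy : fsubset (msupp y) d by apply: fsubsetUr.
have sxy : fsubset (msupp (a *: x + y)) d.
  apply: fsubset_trans (msuppD_le _ _) _; rewrite fsubUset sy andbT.
  exact: fsubset_trans (msuppZ_le _ _) sx.
rewrite !(@lextEw f _ d) // scaler_sumr -big_split; apply: eq_bigr => k _ /=.
by rewrite mcoeffD mcoeffZ scalerDl scalerA.
Qed.

HB.instance Definition _ (f : X -> W) :=
  GRing.isLinear.Build K {malg K[X]} W *:%R (lext f) (lext_is_linear f).

Lemma lextU (f : X -> W) k : lext f << k >> = f k.
Proof.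
by rewrite (@lextEw f _ (fset1 k)) ?msuppU_le // big_seq_fset1 mcoeffUU scale1r.
Qed.

Lemma malg_linear_eq (f g : {linear {malg K[X]} -> W}) :
  (forall k, f << k >> = g << k >>) -> f =1 g.
Proof.
move=> fg x; rewrite [x]monalgE !raddf_sum; apply: eq_bigr => k _ /=.
suff -> : << x@_k *g k >> = x@_k *: << k >> by rewrite !linearZ /= fg.
by apply/malgP => j; rewrite mcoeffZ !mcoeffU mulr_natr.
Qed.

End LinearExtension.

Section QuotientSpace.
Variables (K : fieldType) (V : lmodType K) (P : V -> Prop).

Inductive spans : V -> Prop :=
| spans0 : spans 0
| spansZD a x y : P x -> spans y -> spans (a *: x + y).

Lemma spans_sub x : P x -> spans x.
Proof. by move=> /(spansZD 1) /(_ spans0); rewrite scale1r addr0. Qed.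

Lemma spansD x y : spans x -> spans y -> spans (x + y).
Proof.
by elim=> [|a u v Pu _ IH] /=; rewrite ?add0r // -addrA => /IH; apply: spansZD.
Qed.

Lemma spansZ a x : spans x -> spans (a *: x).
Proof.
elim=> [|b u v Pu _ IH]; first by rewrite scaler0; apply: spans0.
by rewrite scalerDr scalerA; apply: spansZD.
Qed.

Definition span_pred : {pred V} := fun x => `[< spans x >].

Lemma span_predP x : reflect (spans x) (x \in span_pred).
Proof. exact: asboolP. Qed.

Lemma span_submod : submod_closed span_pred.
Proof.
split=> [|a x y /span_predP Sx /span_predP Sy]; apply/span_predP.
  exact: spans0.
by apply: spansD => //; apply: spansZ.
Qed.

HB.instance Definition _ := GRing.isSubmodClosed.Build K V span_pred span_submod.

Definition quotsp : Type := Quotient.quot span_pred.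
HB.instance Definition _ := GRing.Zmodule.on quotsp.
HB.instance Definition _ := ZmodQuotient.on quotsp.

End QuotientSpace.

HB.lock Definition qpi (K : fieldType) (V : lmodType K) (P : V -> Prop) (x : V) :
  quotsp P := \pi_(quotsp P) x.

Section QuotientSpaceTheory.
Variables (K : fieldType) (V : lmodType K) (P : V -> Prop).
Local Notation quotsp := (quotsp P).
Local Notation qpi := (@qpi K V P).
Local Notation spans := (spans P).
Local Notation span_pred := (span_pred P).

Lemma repr_qpi (x : quotsp) : qpi (repr x) = x.
Proof. by rewrite qpi.unlock reprK. Qed.

Lemma qpi_eq x y : qpi x = qpi y <-> spans (x - y).
Proof.
have E : (qpi x == qpi y) = (x - y \in span_pred) by rewrite qpi.unlock Quotient.idealrBE.
split=> [/eqP|S]; first by rewrite E => /span_predP.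
by apply/eqP; rewrite E; apply/span_predP.
Qed.

Lemma qpiD : {morph qpi : x y / x + y}. Proof. by move=> x y; rewrite qpi.unlock raddfD. Qed.

Definition qscale (a : K) (x : quotsp) : quotsp := qpi (a *: repr x).

Lemma qpiZ a x : qscale a (qpi x) = qpi (a *: x).
Proof.
apply/qpi_eq; rewrite -scalerBr; apply/spansZ/qpi_eq; exact: repr_qpi.
Qed.

Lemma qpi_ex (x : quotsp) : exists y, x = qpi y.
Proof. by exists (repr x); rewrite repr_qpi. Qed.

Fact qscaleA a b x : qscale a (qscale b x) = qscale (a * b) x.
Proof. by have [y ->] := qpi_ex x; rewrite !qpiZ scalerA. Qed.
Fact qscale1 : left_id 1 qscale.
Proof. by move=> x; have [y ->] := qpi_ex x; rewrite qpiZ scale1r. Qed.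
Fact qscaleDr : right_distributive qscale +%R.
Proof.
move=> a x y; have [x' ->] := qpi_ex x; have [y' ->] := qpi_ex y.
by rewrite -qpiD !qpiZ scalerDr qpiD.
Qed.
Fact qscaleDl x : {morph qscale^~ x : a b / a + b}.
Proof. by move=> a b; have [y ->] := qpi_ex x; rewrite !qpiZ scalerDl qpiD. Qed.

HB.instance Definition _ :=
  GRing.Zmodule_isLmodule.Build K quotsp qscaleA qscale1 qscaleDr qscaleDl.

Lemma qpi_is_linear : linear qpi.
Proof. by move=> a x y; rewrite qpiD -qpiZ. Qed.
HB.instance Definition _ := GRing.isLinear.Build K V quotsp *:%R qpi qpi_is_linear.

Lemma qpi_rel x : P x -> qpi x = 0.
Proof. by move=> Px; rewrite -(raddf0 qpi); apply/qpi_eq; rewrite subr0; apply: spans_sub. Qed.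

End QuotientSpaceTheory.

(* The hypothesis on [f] makes the value independent of the representative. *)
HB.lock Definition qlift (K : fieldType) (V W : lmodType K) (P : V -> Prop)
    (f : {linear V -> W}) of (forall x, P x -> f x = 0) : quotsp P -> W :=
  fun x => f (repr x).

Section Lift.
Variables (K : fieldType) (V W : lmodType K) (P : V -> Prop).
Variables (f : {linear V -> W}) (Pf : forall x, P x -> f x = 0).
Local Notation quotsp := (quotsp P).
Local Notation qpi := (@qpi K V P).

Lemma qliftE x : qlift Pf (qpi x) = f x.
Proof.
have : spans P (repr (qpi x) - x) by apply/qpi_eq; exact: repr_qpi.
move=> S; apply/eqP; rewrite qlift.unlock -subr_eq0 -linearB; apply/eqP.
by elim: S => [|a u v /Pf fu _ IH]; rewrite ?linear0 // linearP fu scaler0 IH addr0.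
Qed.

Lemma qlift_is_linear : linear (qlift Pf).
Proof.
move=> a x y; have [x' ->] := qpi_ex x; have [y' ->] := qpi_ex y.
by rewrite -linearP !qliftE linearP.
Qed.
HB.instance Definition _ :=
  GRing.isLinear.Build K quotsp W *:%R (qlift Pf) qlift_is_linear.
End Lift.

Section Tensor.
Variables (K : fieldType) (U V : lmodType K).

Inductive bilin_rel : {malg K[(U * V)%type]} -> Prop :=
| BilinL a u u' v :
    bilin_rel (<< (a *: u + u', v) >> - (a *: << (u, v) >> + << (u', v) >>))
| BilinR a u v v' :
    bilin_rel (<< (u, a *: v + v') >> - (a *: << (u, v) >> + << (u, v') >>)).

Definition tensor := quotsp bilin_rel.
HB.instance Definition _ := GRing.Lmodule.on tensor.

End Tensor.

HB.lock Definition tens (K : fieldType) (U V : lmodType K) (u : U) (v : V) :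
  tensor U V := qpi (@bilin_rel K U V) << (u, v) >>.

Section TensorTheory.
Variables (K : fieldType) (U V : lmodType K).
Local Notation tensor := (tensor U V).
Local Notation tens := (@tens K U V).

Lemma tens_linl v : linear (tens^~ v).
Proof.
move=> a u u'; rewrite tens.unlock -linearP; apply/eqP; rewrite -subr_eq0 -linearB /=.
by apply/eqP/qpi_rel/BilinL.
Qed.

Lemma tens_linr u : linear (tens u).
Proof.
move=> a v v'; rewrite tens.unlock -linearP; apply/eqP; rewrite -subr_eq0 -linearB /=.
by apply/eqP/qpi_rel/BilinR.
Qed.

Lemma tensDl v u u' : tens (u + u') v = tens u v + tens u' v.
Proof. by rewrite -[u in LHS]scale1r tens_linl scale1r. Qed.
Lemma tens0l v : tens 0 v = 0.
Proof. by apply: (addrI (tens 0 v)); rewrite -tensDl !addr0. Qed.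
Lemma tensZl v a u : tens (a *: u) v = a *: tens u v.
Proof. by rewrite -[a *: u]addr0 tens_linl tens0l addr0. Qed.

HB.instance Definition _ u := GRing.isLinear.Build K V tensor *:%R (tens u) (tens_linr u).

Lemma tensor_ind (Q : tensor -> Prop) :
  Q 0 -> (forall x y, Q x -> Q y -> Q (x + y)) -> (forall u v, Q (tens u v)) ->
  forall x, Q x.
Proof.
move=> Q0 QD Qt x; have [y ->] := qpi_ex x.
rewrite [y]monalgE raddf_sum; elim/big_ind: _ => // -[u v] _ /=.
suff -> : << y@_(u, v) *g (u, v) >> = y@_(u, v) *: << (u, v) >> :> {malg K[(U * V)%type]}.
  rewrite linearZ /=.
  have -> : qpi (@bilin_rel K U V) << (u, v) >> = tens u v by rewrite tens.unlock.
  by have -> : y@_(u, v) *: tens u v = tens u (y@_(u, v) *: v) by rewrite linearZ.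
by apply/malgP => j; rewrite mcoeffZ !mcoeffU mulr_natr.
Qed.

Section Lift.
Variables (W : lmodType K) (b : U -> V -> W).
Variables (bl : forall v, linear (b^~ v)) (br : forall u, linear (b u)).

Fact tlift_rel x : bilin_rel x -> lext (fun p : U * V => b p.1 p.2) x = 0.
Proof.
case=> [a u u' v|a u v v']; rewrite linearB linearP /= !lextU /= ?bl ?br subrr //.
Qed.

End Lift.
End TensorTheory.

HB.lock Definition tlift (K : fieldType) (U V W : lmodType K) (b : U -> V -> W)
    (bl : forall v, linear (b^~ v)) (br : forall u, linear (b u)) :
  {linear tensor U V -> W} := qlift (tlift_rel bl br).

Lemma tliftE (K : fieldType) (U V W : lmodType K) (b : U -> V -> W)
    (bl : forall v, linear (b^~ v)) (br : forall u, linear (b u)) u v :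
  tlift bl br (tens u v) = b u v.
Proof. by rewrite tlift.unlock tens.unlock /= qliftE /= lextU. Qed.

Section TensorMap.
Variables (K : fieldType) (U V U' V' : lmodType K).
Variables (f : {linear U -> U'}) (g : {linear V -> V'}).

Fact tmap_linl v : linear (fun u => tens (f u) (g v)).
Proof. by move=> a u u'; rewrite linearP tens_linl. Qed.
Fact tmap_linr u : linear (fun v => tens (f u) (g v)).
Proof. by move=> a v v'; rewrite !linearP. Qed.

Definition tmap : tensor U V -> tensor U' V' := tlift tmap_linl tmap_linr.
HB.instance Definition _ := GRing.Linear.on tmap.

Lemma tmapE u v : tmap (tens u v) = tens (f u) (g v).
Proof. exact: tliftE. Qed.
End TensorMap.

Section TensorMul.
Variables (K : fieldType) (A : algType K).

Fact tmulr_linl (a a' d : A) : linear (fun c => tens (a * c) (a' * d)).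
Proof. by move=> k c c'; rewrite mulrDr -scalerAr tens_linl. Qed.
Fact tmulr_linr (a a' c : A) : linear (fun d => tens (a * c) (a' * d)).
Proof. by move=> k d d'; rewrite mulrDr -scalerAr linearP. Qed.

Definition tmul1 (a a' : A) : tensor A A -> tensor A A :=
  tlift (tmulr_linl a a') (tmulr_linr a a').
HB.instance Definition _ a a' := GRing.Linear.on (tmul1 a a').

Fact tmul_linl y a' : linear (fun a => tmul1 a a' y).
Proof.
move=> k a b; elim/tensor_ind: y => [|x y IHx IHy|u v].
- by rewrite !raddf0 addr0.
- by rewrite !raddfD /= IHx IHy addrACA.
- by rewrite /tmul1 !tliftE mulrDl -scalerAl tens_linl.
Qed.
Fact tmul_linr y a : linear (fun a' => tmul1 a a' y).
Proof.
move=> k a' b; elim/tensor_ind: y => [|x y IHx IHy|u v].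
- by rewrite !raddf0 addr0.
- by rewrite !raddfD /= IHx IHy addrACA.
- by rewrite /tmul1 !tliftE mulrDl -scalerAl linearP.
Qed.

(* The product of the algebra A (x) A: (a (x) a') (c (x) d) = ac (x) a'd. *)
Definition tmul (x y : tensor A A) : tensor A A :=
  tlift (tmul_linl y) (tmul_linr y) x.

Lemma tmul_tens a a' y : tmul (tens a a') y = tmul1 a a' y.
Proof. exact: tliftE. Qed.

Lemma tmulE a a' c d : tmul (tens a a') (tens c d) = tens (a * c) (a' * d).
Proof. rewrite tmul_tens; exact: tliftE. Qed.

Lemma tmul_linear_l y : linear (tmul^~ y).
Proof. by move=> k x x'; rewrite /tmul linearP. Qed.

Lemma tmul0l y : tmul 0 y = 0. Proof. exact: raddf0. Qed.
Lemma tmulDl x x' y : tmul (x + x') y = tmul x y + tmul x' y.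
Proof. exact: raddfD. Qed.
Lemma tmul_linear_r x : linear (tmul x).
Proof.
move=> k y y'; elim/tensor_ind: x => [|x x' IHx IHx'|a a'].
- by rewrite !tmul0l scaler0 addr0.
- by rewrite !tmulDl IHx IHx' scalerDr addrACA.
- by rewrite !tmul_tens; exact: linearP.
Qed.

Lemma tmulDr x y y' : tmul x (y + y') = tmul x y + tmul x y'.
Proof. by rewrite -[y in LHS]scale1r tmul_linear_r scale1r. Qed.
Lemma tmul0r x : tmul x 0 = 0.
Proof. by apply: (addrI (tmul x 0)); rewrite -tmulDr !addr0. Qed.

Lemma tmulZl a x y : tmul (a *: x) y = a *: tmul x y.
Proof. by rewrite -[a *: x]addr0 tmul_linear_l tmul0l addr0. Qed.
Lemma tmulZr a x y : tmul x (a *: y) = a *: tmul x y.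
Proof. by rewrite -[a *: y]addr0 tmul_linear_r tmul0r addr0. Qed.

Lemma tmulA : associative tmul.
Proof.
move=> x y z; elim/tensor_ind: x => [|x x' IHx IHx'|a a'].
- by rewrite !tmul0l.
- by rewrite !tmulDl IHx IHx'.
elim/tensor_ind: y => [|y y' IHy IHy'|b b'].
- by rewrite tmul0l tmul0r tmul0l.
- by rewrite tmulDl !tmulDr tmulDl IHy IHy'.
elim/tensor_ind: z => [|z z' IHz IHz'|c c'].
- by rewrite !tmul0r.
- by rewrite !tmulDr IHz IHz'.
by rewrite !tmulE !mulrA.
Qed.

Lemma tmul1l x : tmul (tens 1 1) x = x.
Proof.
elim/tensor_ind: x => [|x y IHx IHy|u v]; first exact: tmul0r.
  by rewrite tmulDr IHx IHy.
by rewrite tmulE !mul1r.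
Qed.

Lemma tmul1r x : tmul x (tens 1 1) = x.
Proof.
elim/tensor_ind: x => [|x y IHx IHy|u v]; first exact: tmul0l.
  by rewrite tmulDl IHx IHy.
by rewrite tmulE !mulr1.
Qed.
End TensorMul.

Section TensorCoalgebra.
Variables (K : fieldType) (V : lmodType K).

Inductive multilin_rel : {malg K[seq V]} -> Prop :=
| MultiLin s t a u v :
    multilin_rel (<< s ++ (a *: u + v) :: t >>
                  - (a *: << s ++ u :: t >> + << s ++ v :: t >>)).

(* The relations preserve the length of words, and the words of length n *)
(* modulo the relations form the n-th tensor power of V; the class of *)
(* v_1 ... v_n is the tensor v_1 (x) ... (x) v_n. *)
Definition tensorT := quotsp multilin_rel.
HB.instance Definition _ := GRing.Lmodule.on tensorT.

Definition wordT (w : seq V) : tensorT := qpi multilin_rel << w >>.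

Lemma wordT_linear s t a u v :
  wordT (s ++ (a *: u + v) :: t) = a *: wordT (s ++ u :: t) + wordT (s ++ v :: t).
Proof.
rewrite /wordT -linearP; apply/eqP; rewrite -subr_eq0 -linearB /=.
exact/eqP/qpi_rel/MultiLin.
Qed.

Definition deconc_word (w : seq V) : tensor tensorT tensorT :=
  \sum_(i < (size w).+1) tens (wordT (take i w)) (wordT (drop i w)).

Fact deconc_rel x : multilin_rel x -> lext deconc_word x = 0.
Proof.
case=> s t a u v; rewrite linearB linearP /= !lextU; apply/eqP; rewrite subr_eq0.
apply/eqP; rewrite /deconc_word !size_cat /= scaler_sumr -big_split /=.
apply: eq_bigr => i _; rewrite !take_cat !drop_cat.
case: ltnP => [lti|lei].
  by rewrite wordT_linear linearP.
case: (i - size s)%N => [|j] /=; first by rewrite (wordT_linear [::]) linearP.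
by rewrite wordT_linear tens_linl.
Qed.

(* Deconcatenation: *)
(* v_1 ... v_n |-> \sum_(0 <= i <= n) v_1 ... v_i (x) v_(i+1) ... v_n. *)
Definition deconc : tensorT -> tensor tensorT tensorT := qlift deconc_rel.
HB.instance Definition _ := GRing.Linear.on deconc.

Lemma deconcE w : deconc (wordT w) = deconc_word w.
Proof. by rewrite /deconc /wordT qliftE /= lextU. Qed.

Fact counitT_rel x : multilin_rel x ->
  lext (fun w : seq V => (nilp w)%:R : K^o) x = 0.
Proof.
case=> s t a u v; rewrite linearB linearP /= !lextU /nilp !size_cat /= !addnS /=.
by rewrite scaler0 addr0 subrr.
Qed.

Definition counitT : tensorT -> K^o := qlift counitT_rel.
HB.instance Definition _ := GRing.Linear.on counitT.

Lemma counitTE w : counitT (wordT w) = (nilp w)%:R.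
Proof. by rewrite /counitT /wordT qliftE /= lextU. Qed.

End TensorCoalgebra.

(* [C] with coproduct [Delta] and counit [eps] is isomorphic, as a coalgebra, *)
(* to T(V) with the deconcatenation coproduct for some V. *)
Definition cofree_coalgebra (K : fieldType) (C : lmodType K)
    (Delta : C -> tensor C C) (eps : C -> K^o) : Prop :=
  exists (V : lmodType K) (f : {linear C -> tensorT V}),
    [/\ bijective f,
        forall x, deconc (f x) = tmap f f (Delta x) &
        forall x, counitT (f x) = eps x].

(* [Node d [:: t_1; ...; t_n]] is B_d(t_1 ... t_n). *)
Inductive ptree (D : Type) : Type := Node of D & seq (ptree D).

Section TreeChoice.
Variable D : choiceType.

Fixpoint tree_encode (t : ptree D) : GenTree.tree D :=
  let: Node d ts := t in
  GenTree.Node 0 (GenTree.Leaf d :: map tree_encode ts).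

Fixpoint tree_decode (g : GenTree.tree D) : option (ptree D) :=
  if g is GenTree.Node _ (GenTree.Leaf d :: gs)
  then Some (Node d (pmap tree_decode gs)) else None.

Lemma tree_encodeK : pcancel tree_encode tree_decode.
Proof.
rewrite /pcancel; fix IH 1 => -[d ts] /=; congr (Some (Node d _)).
by elim: ts => //= t ts ->; rewrite IH.
Qed.

HB.instance Definition _ := Choice.copy (ptree D) (pcan_type tree_encodeK).
End TreeChoice.

Section MalgAlgebra.
Variables (K : fieldType) (M : monomType).

Fact malg_scaleAr (a : K) (x y : {malg K[M]}) : a *: (x * y) = x * (a *: y).
Proof.
rewrite -!mul_malgC mulrA [RHS]mulrA; congr (_ * y).
rewrite mul_malgC; apply/malgP => k; rewrite mcoeffZ.
rewrite [x]monalgE mulr_suml !raddf_sum mulr_sumr; apply: eq_bigr => j _ /=.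
by rewrite malgM_def fgmulUU mulm1 !mcoeffU mulrnAr mulrC.
Qed.
End MalgAlgebra.

Section HPR.
Variables (K : fieldType) (D : choiceType).

(* Planar forests, the free monoid on trees: the monoid algebra HPR is the *)
(* free associative algebra on trees. *)
Definition forest : Type := seq (ptree D).
HB.instance Definition _ := Choice.on forest.
Fact forest_eq1 (v w : forest) : v ++ w = [::] -> v = [::] /\ w = [::].
Proof. by case: v; case: w. Qed.
HB.instance Definition _ :=
  Choice_isMonomialDef.Build forest (@catA _) (@cat0s _) (@cats0 _) forest_eq1.

Definition HPR : Type := {malg K[forest]}.
HB.instance Definition _ := GRing.Lalgebra.on HPR.
HB.instance Definition _ :=
  GRing.Lalgebra_isAlgebra.Build K HPR (@malg_scaleAr K forest).

Definition tree_gen (t : ptree D) : HPR := << ([:: t] : forest) >>.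
Definition Bplus (d : D) : HPR -> HPR :=
  lext (fun w : forest => tree_gen (Node d w)).
HB.instance Definition _ d := GRing.Linear.on (Bplus d).

Fixpoint comul_tree (t : ptree D) : tensor HPR HPR :=
  let: Node d ts := t in
  tens (tree_gen t) 1
  + tmap idfun (Bplus d) (foldr (fun s => tmul (comul_tree s)) (tens 1 1) ts).

Definition comul_forest (w : seq (ptree D)) : tensor HPR HPR :=
  foldr (fun s => tmul (comul_tree s)) (tens 1 1) w.

Definition comulPR : HPR -> tensor HPR HPR :=
  lext (fun w : forest => comul_forest w).
HB.instance Definition _ := GRing.Linear.on comulPR.

Definition counitPR : HPR -> K^o := lext (fun w : forest => (nilp w)%:R).
HB.instance Definition _ := GRing.Linear.on counitPR.

Lemma comulPR_forest (w : forest) : comulPR << w >> = comul_forest w.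
Proof. exact: lextU. Qed.

Lemma comul_forest_cat v w :
  comul_forest (v ++ w) = tmul (comul_forest v) (comul_forest w).
Proof. by elim: v => /= [|t v ->]; rewrite ?tmul1l // tmulA. Qed.

Lemma HPR_ind (Q : HPR -> Prop) :
  Q 0 -> (forall x y, Q x -> Q y -> Q (x + y)) ->
  (forall a x, Q x -> Q (a *: x)) -> (forall w : forest, Q << w >>) ->
  forall x, Q x.
Proof.
move=> Q0 QD QZ QU x; rewrite [x]monalgE; elim/big_ind: _ => // w _.
suff -> : << x@_w *g w >> = x@_w *: << w >> :> HPR by apply: QZ.
by apply/malgP => j; rewrite mcoeffZ !mcoeffU mulr_natr.
Qed.

Lemma HPR_mulU (v w : forest) : (<< v >> : HPR) * << w >> = << mmul v w >>.
Proof. by rewrite malgM_def fgmulUU mulr1. Qed.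

(* [comulPR] is the algebra morphism such that *)
(* Delta(B_d(x)) = B_d(x) (x) 1 + (Id (x) B_d)(Delta(x)). *)
Lemma comulPR1 : comulPR 1 = tens 1 1.
Proof. by rewrite comulPR_forest. Qed.

Lemma comulPRM x y : comulPR (x * y) = tmul (comulPR x) (comulPR y).
Proof.
elim/HPR_ind: x => [|x x' IHx IHx'|a x IHx|v].
- by rewrite mul0r !linear0 tmul0l.
- by rewrite mulrDl !linearD /= IHx IHx' tmulDl.
- by rewrite -scalerAl !linearZ /= IHx tmulZl.
elim/HPR_ind: y => [|y y' IHy IHy'|a y IHy|w].
- by rewrite mulr0 !linear0 tmul0r.
- by rewrite mulrDr !linearD /= IHy IHy' tmulDr.
- by rewrite -scalerAr !linearZ /= IHy tmulZr.
by rewrite HPR_mulU !comulPR_forest comul_forest_cat.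
Qed.

Lemma comulPR_Bplus d x :
  comulPR (Bplus d x) = tens (Bplus d x) 1 + tmap idfun (Bplus d) (comulPR x).
Proof.
elim/HPR_ind: x => [|x x' IHx IHx'|a x IHx|w].
- by rewrite (linear0 (Bplus d)) (linear0 comulPR) tens0l add0r; exact/esym/linear0.
- rewrite (linearD (Bplus d)) 2!(linearD comulPR) /= IHx IHx' tensDl addrACA.
  by congr (_ + _); exact/esym/linearD.
- rewrite (linearZ_LR (Bplus d)) 2!(linearZ_LR comulPR) /= IHx tensZl scalerDr.
  by congr (_ + _); exact/esym/linearZ_LR.
rewrite /Bplus lextU -/(Bplus d) !comulPR_forest /=.
by rewrite tmul1r.
Qed.

Lemma counitPRM x y : counitPR (x * y) = counitPR x * counitPR y.
Proof.
have eD u v : counitPR (u + v) = counitPR u + counitPR v by exact: linearD.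
have eZ a u : counitPR (a *: u) = a * counitPR u by exact: linearZ.
have e0 : counitPR 0 = 0 by exact: linear0.
have eU (w : forest) : counitPR << w >> = (nilp w)%:R by exact: lextU.
elim/HPR_ind: x => [|x x' IHx IHx'|a x IHx|v].
- by rewrite mul0r e0 mul0r.
- by rewrite (mulrDl x) !eD IHx IHx' [RHS]mulrDl.
- by rewrite -scalerAl !eZ IHx mulrA.
elim/HPR_ind: y => [|y y' IHy IHy'|a y IHy|w].
- by rewrite mulr0 e0 mulr0.
- by rewrite (mulrDr _ y) !eD IHy IHy' [RHS]mulrDr.
- by rewrite -scalerAr !eZ IHy mulrCA.
rewrite HPR_mulU !eU.
by case: v => [|t s]; rewrite ?mul1r ?mul0r.
Qed.

End HPR.

Section Abelianisation.
Variables (K : fieldType) (A : algType K).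

(* The two-sided ideal generated by the commutators is the linear span of *)
(* these elements. *)
Inductive comm_rel : A -> Prop :=
| CommRel a x y b : comm_rel (a * (x * y - y * x) * b).

Definition abelianisation := quotsp comm_rel.
HB.instance Definition _ := GRing.Lmodule.on abelianisation.

Definition abpi : A -> abelianisation := qpi comm_rel.
HB.instance Definition _ := GRing.Linear.on abpi.

Lemma abpi_comm a x y b : abpi (a * x * y * b) = abpi (a * y * x * b).
Proof.
apply/eqP; rewrite -subr_eq0 -linearB -mulrBl -2!(mulrA a) -mulrBr /=.
exact/eqP/qpi_rel/CommRel.
Qed.

Lemma tmap_abpi_comm (a x y b : tensor A A) :
  tmap abpi abpi (tmul (tmul (tmul a x) y) b)
  = tmap abpi abpi (tmul (tmul (tmul a y) x) b).
Proof.
have: forall u v, tmap abpi abpi (tens u v) = tens (abpi u) (abpi v) by exact: tmapE.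
have: forall u v, tmap abpi abpi (u + v) = tmap abpi abpi u + tmap abpi abpi v.
  exact: linearD.
move: (tmap abpi abpi) => F FD FE.
elim/tensor_ind: a => [|u v IHu IHv|a a']; first by rewrite !tmul0l.
  by rewrite !tmulDl !FD IHu IHv.
elim/tensor_ind: x => [|u v IHu IHv|x x']; first by rewrite tmul0r !tmul0l tmul0r tmul0l.
  by rewrite !(tmulDl, tmulDr) !FD IHu IHv.
elim/tensor_ind: y => [|u v IHu IHv|y y']; first by rewrite !(tmul0r, tmul0l).
  by rewrite !(tmulDl, tmulDr) !FD IHu IHv.
elim/tensor_ind: b => [|u v IHu IHv|b b']; first by rewrite !tmul0r.
  by rewrite !tmulDr !FD IHu IHv.
by rewrite !tmulE !FE; congr (tens _ _); apply: abpi_comm.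
Qed.
End Abelianisation.

Section HPRab.
Variables (K : fieldType) (D : choiceType).
Local Notation HPR := (HPR K D).

Definition HPRab := abelianisation HPR.
HB.instance Definition _ := GRing.Lmodule.on HPRab.

Definition comul_ab_pre : {linear HPR -> tensor HPRab HPRab} :=
  tmap (@abpi K HPR) (@abpi K HPR) \o @comulPR K D.

Fact comul_ab_rel x : comm_rel x -> comul_ab_pre x = 0.
Proof.
have M a u v b : comul_ab_pre (a * u * v * b) = tmap (@abpi K HPR) (@abpi K HPR)
    (tmul (tmul (tmul (comulPR a) (comulPR u)) (comulPR v)) (comulPR b)).
  by rewrite -!comulPRM.
case=> a u v b; rewrite mulrBr mulrBl !mulrA (linearB comul_ab_pre).
apply/eqP; rewrite subr_eq0; apply/eqP.
by apply: etrans (M a u v b) _; apply: etrans (esym (M a v u b)); apply: tmap_abpi_comm.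
Qed.

Definition comulPRab : HPRab -> tensor HPRab HPRab := qlift comul_ab_rel.
HB.instance Definition _ := GRing.Linear.on comulPRab.

Lemma comulPRabE x :
  comulPRab (abpi x) = tmap (@abpi K HPR) (@abpi K HPR) (comulPR x).
Proof. exact: qliftE. Qed.

Fact counit_ab_rel (x : HPR) : comm_rel x -> counitPR x = 0.
Proof.
case=> a u v b; rewrite !counitPRM.
have -> : counitPR (u * v - v * u) = counitPR (u * v) - counitPR (v * u).
  exact: linearB.
by rewrite !counitPRM [X in _ - X]mulrC subrr mulr0 mul0r.
Qed.

Definition counitPRab : HPRab -> K^o := qlift counit_ab_rel.
HB.instance Definition _ := GRing.Linear.on counitPRab.

Lemma counitPRabE (x : HPR) : counitPRab (abpi x) = counitPR x.
Proof. exact: qliftE. Qed.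

End HPRab.

Section Brace.
Variables (K : fieldType) (D : choiceType).

Definition Br : Type := {malg K[ptree D]}.
HB.instance Definition _ := GRing.Lmodule.on Br.

Definition tree_elt (t : ptree D) : Br := << t >>.

(* u |-> B_d(ts with its i-th tree, counting from 0, replaced by u). *)
Definition replace_at d (ts : seq (ptree D)) i : Br -> Br :=
  lext (fun u => tree_elt (Node d (take i ts ++ u :: drop i.+1 ts))).
HB.instance Definition _ d ts i := GRing.Linear.on (replace_at d ts i).

Fixpoint brace_tree (t s : ptree D) : Br :=
  let: Node d ts := s in
  \sum_(i < (size ts).+1) tree_elt (Node d (take i ts ++ t :: drop i ts))
  + \sum_(i < size ts) replace_at d ts i (nth 0 (map (brace_tree t) ts) i).

(* The binary brace <x; y>. *)
Definition brace (x y : Br) : Br :=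
  lext (fun t => lext (fun s => brace_tree t s) y) x.

Definition lie_Br (x y : Br) : Br := brace x y - brace y x.

Lemma brace_leaf (t : ptree D) d :
  brace (tree_elt t) (tree_elt (Node d [::])) = tree_elt (Node d [:: t]).
Proof.
by rewrite /brace !lextU /= big_ord_recl !big_ord0 !addr0.
Qed.

Lemma brace_node (t : ptree D) d ts t0 :
  brace (tree_elt t) (tree_elt (Node d ts)) =
  \sum_(i < (size ts).+1) tree_elt (Node d (take i ts ++ t :: drop i ts))
  + \sum_(i < size ts)
      replace_at d ts i (brace (tree_elt t) (tree_elt (nth t0 ts i))).
Proof.
rewrite /brace !lextU /=; congr (_ + _); apply: eq_bigr => i _.
by rewrite !lextU (nth_map t0).
Qed.

End Brace.

Section Lie.
Variable K : fieldType.

Record is_lie (L : lmodType K) (br : L -> L -> L) : Prop := IsLie {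
  lie_linearl : forall y, linear (br^~ y);
  lie_linearr : forall x, linear (br x);
  lie_alternating : forall x, br x x = 0;
  lie_jacobi : forall x y z, br x (br y z) + br y (br z x) + br z (br x y) = 0
}.

Definition lie_morphism (L L' : lmodType K) (br : L -> L -> L)
    (br' : L' -> L' -> L') (phi : {linear L -> L'}) : Prop :=
  {morph phi : x y / br x y >-> br' x y}.

(* (L, br) is a Lie algebra which, for some set X and map i : X -> L, has the *)
(* universal property of the free Lie algebra generated by X. *)
Definition free_lie (L : lmodType K) (br : L -> L -> L) : Prop :=
  is_lie br /\
  exists (X : Type) (i : X -> L),
    forall (L' : lmodType K) (br' : L' -> L' -> L'), is_lie br' ->
    forall f : X -> L',
    exists phi : {linear L -> L'},
      [/\ lie_morphism br br' phi, phi \o i =1 f &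
          forall psi : {linear L -> L'},
            lie_morphism br br' psi -> psi \o i =1 f -> psi =1 phi].

End Lie.

(* Main.v *)
From HB Require Import structures.
Require Import Defs.
From mathcomp Require Import all_boot all_algebra.
From mathcomp Require Import classical_sets cardinality.
From mathcomp Require Import finmap boolp monalg zify.

(* Let C be the abelianised Hopf algebra.

   In C, every cocycle z in C+ (x) C+ of the reduced cobar complex is a
   coboundary.  The reason is that symmetrization s : C -> H_PR is a morphism
   of left C-comodules, the right factors in the coproduct of a tree being
   trees or 1.  Hence, if x = t_1 ... t_n with t_i = B_d(h_i), the average over
   i of t_1 ... B_d(s(c) h_i) ... t_n has a coproduct whose leading term is
   c (x) x as soon as x is coinvariant, and the leading term of z, for the
   number of trees on the right and then the weight on the left, can be
   removed by a coboundary.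

   In characteristic zero, the operation Psi^2 = mult o Delta shows that a
   primitive element of C is determined by its coefficients on trees.  A
   minimal set I of trees whose coefficients separate the primitive elements
   has a dual family of primitive elements c_i, and the vanishing above extends
   it to a basis (c_u) of C indexed by the words u in I such that
   Delta(c_u) = sum_(u = vw) c_v (x) c_w.  So C is the tensor coalgebra on I.

   Dually, trees are functionals on C, the bracket of Br(D) is the commutator
   of the convolution product, and the products of elements of I span the
   functionals.  Comparing eigenvalues of Psi^2, a tree lies in the Lie algebra
   generated by I.  Finally t |-> sum_u <t, c_u> u embeds Br(D) in the free
   associative algebra on I, and a map f on I extends to a Lie morphism sending
   t to 1/|t| sum_u <t, c_u> D_f(u), where D_f is Dynkin's right-normed
   bracketing. *)

(** The operator B_d does not descend to C, since the children of a vertex stay ordered while the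
    trees of a forest do not; symmetrization is the substitute, and averaging over the trees of x
    removes the choice of a supporting tree. Vanishing cohomology gives cofreeness for the following
    reason. Once the family is built on shorter words, the sum of c_v (x) c_w over the proper splits
    u = vw is a cocycle, by coassociativity of deconcatenation; any element with this reduced
    coproduct can serve as c_u, up to a primitive correction. Positive degrees and finiteness make
    each weight component of C finite-dimensional: a minimal separating set then exists, and
    expansions in (c_u) are finite sums. Dynkin's factor is usually the length of a word. A tree is
    not homogeneous for the length of words in I, only for the weight; hence the innermost letter of
    the bracketing is scaled by its weight, and one divides by |t|. *)

Set Implicit Arguments.
Unset Strict Implicit.
Unset Printing Implicit Defensive.

Import GRing.Theory.
Local Open Scope classical_set_scope.
Local Open Scope ring_scope.

(** * Admissible cuts of planar forests *)

Section Cuts.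
Variable D : choiceType.
Local Notation T := (ptree D).
Local Notation F := (forest D).

(** The principle generated for the nested type [ptree] has no hypothesis on subtrees; this one
    gives it for the children [h] as well as for the remaining trees. *)
Lemma forest_ind (P : F -> Prop) :
  P [::] -> (forall d h w, P h -> P w -> P (Node d h :: w)) -> forall w, P w.
Proof.
move=> P0 Pc.
pose fix IH (t : T) : forall w, P w -> P (t :: w) :=
  let: Node d h := t return forall w, P w -> P (t :: w) in fun w Pw =>
  Pc d h w ((fix IHs (s : seq T) : P s :=
    if s is u :: s' then IH u s' (IHs s') else P0) h) Pw.
by elim=> [|t w Pw] //; apply: IH.
Qed.

(* The list, with multiplicities, of the pairs (P^c(t), R^c(t)) over the *)
(* admissible cuts c of t, including the empty and the total cut. *)
Fixpoint cutT (t : T) : seq (F * F) :=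
  let: Node d h := t in
  ([:: t], [::]) ::
  [seq (q.1, [:: Node d q.2]) | q <-
    foldr (fun s acc => [seq (a.1 ++ b.1, a.2 ++ b.2) | a <- cutT s, b <- acc])
      [:: ([::], [::])] h].

(** The fold is the one inlined in [cutT], where it keeps the recursion structural. By
    [comulPR_cuts] the list enumerates the terms of the coproduct of a forest. *)
Definition cuts (w : F) : seq (F * F) :=
  foldr (fun s acc => [seq (a.1 ++ b.1, a.2 ++ b.2) | a <- cutT s, b <- acc])
    [:: ([::], [::])] w.

Section Sums.
Variable V : nmodType.
Implicit Types phi : F -> F -> V.

Lemma sum_cuts0 phi : \sum_(q <- cuts [::]) phi q.1 q.2 = phi [::] [::].
Proof. by rewrite big_seq1. Qed.

Lemma sum_cutT d h phi : \sum_(q <- cutT (Node d h)) phi q.1 q.2 =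
  phi [:: Node d h] [::] + \sum_(q <- cuts h) phi q.1 [:: Node d q.2].
Proof. by rewrite big_cons big_map. Qed.

Lemma sum_cuts_cons t w phi : \sum_(q <- cuts (t :: w)) phi q.1 q.2 =
  \sum_(a <- cutT t) \sum_(b <- cuts w) phi (a.1 ++ b.1) (a.2 ++ b.2).
Proof. by rewrite /= big_allpairs_dep. Qed.

Lemma sum_cuts1 t phi :
  \sum_(q <- cuts [:: t]) phi q.1 q.2 = \sum_(q <- cutT t) phi q.1 q.2.
Proof.
by rewrite sum_cuts_cons; apply: eq_bigr => a _; rewrite big_seq1 !cats0.
Qed.

Lemma sum_cuts_cat v w phi : \sum_(q <- cuts (v ++ w)) phi q.1 q.2 =
  \sum_(a <- cuts v) \sum_(b <- cuts w) phi (a.1 ++ b.1) (a.2 ++ b.2).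
Proof.
elim: v phi => [|t v IH] phi; first by rewrite big_seq1.
rewrite cat_cons sum_cuts_cons [RHS](sum_cuts_cons t v
  (fun p r => \sum_(b <- cuts w) phi (p ++ b.1) (r ++ b.2))).
apply: eq_bigr => a _; rewrite (IH (fun p r => phi (a.1 ++ p) (a.2 ++ r))).
by apply: eq_bigr => b _; apply: eq_bigr => c _; rewrite !catA.
Qed.

(** Both sides are multiplicative in the forest, so one tree B_d(h) remains; there the claim follows
    from the formula for Delta on B_d and from coassociativity on [h]. *)
Lemma cuts_coassoc w (phi : F -> F -> F -> V) :
  \sum_(q <- cuts w) \sum_(r <- cuts q.1) phi r.1 r.2 q.2 =
  \sum_(q <- cuts w) \sum_(r <- cuts q.2) phi q.1 r.1 r.2.
Proof.
elim/forest_ind: w phi => [|d h w IHh IHw] phi; first by rewrite !big_seq1.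
rewrite (sum_cuts_cons _ _ (fun p r => \sum_(r' <- cuts p) phi r'.1 r'.2 r)).
rewrite (sum_cuts_cons _ _ (fun p r => \sum_(r' <- cuts r) phi p r'.1 r'.2)).
transitivity (\sum_(a <- cutT (Node d h)) \sum_(c <- cuts a.1)
    \sum_(b <- cuts w) \sum_(e <- cuts b.1)
      phi (c.1 ++ e.1) (c.2 ++ e.2) (a.2 ++ b.2)).
  apply: eq_bigr => a _; rewrite [RHS]exchange_big /=; apply: eq_bigr => b _.
  by rewrite (sum_cuts_cat _ _ (fun p r => phi p r (a.2 ++ b.2))).
transitivity (\sum_(a <- cutT (Node d h)) \sum_(c <- cuts a.2)
    \sum_(b <- cuts w) \sum_(e <- cuts b.2)
      phi (a.1 ++ b.1) (c.1 ++ e.1) (c.2 ++ e.2)); last first.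
  apply: eq_bigr => a _; rewrite [LHS]exchange_big /=; apply: eq_bigr => b _.
  by rewrite (sum_cuts_cat _ _ (fun p r => phi (a.1 ++ b.1) p r)).
transitivity (\sum_(a <- cutT (Node d h)) \sum_(c <- cuts a.1)
    \sum_(b <- cuts w) \sum_(e <- cuts b.2)
      phi (c.1 ++ b.1) (c.2 ++ e.1) (a.2 ++ e.2)).
  apply: eq_bigr => a _; apply: eq_bigr => c _.
  exact: (IHw (fun x y z => phi (c.1 ++ x) (c.2 ++ y) (a.2 ++ z))).
(* [psi] absorbs the sum over the cuts of [w]; what is left is coassociativity for the single
   tree. *)
pose psi x y z := \sum_(b <- cuts w) \sum_(e <- cuts b.2)
  phi (x ++ b.1) (y ++ e.1) (z ++ e.2).
rewrite -/(psi _ _ _) (sum_cutT d h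
  (fun p r => \sum_(c <- cuts p) psi c.1 c.2 r)).
rewrite (sum_cutT d h (fun p r => \sum_(c <- cuts r) psi p c.1 c.2)).
rewrite sum_cuts0 (sum_cuts1 _ (fun p r => psi p r [::])).
rewrite (sum_cutT d h (fun p r => psi p r [::])) -addrA; congr (_ + _).
rewrite (IHh (fun x y z => psi x y [:: Node d z])) -big_split /=.
apply: eq_bigr => q _; symmetry.
apply: etrans (sum_cuts1 (Node d q.2) (psi q.1)) _.
exact: (sum_cutT d q.2 (psi q.1)).
Qed.

End Sums.
End Cuts.

(** * Linear extensions and symmetric test functions *)

Section Lext.
Variables (K : fieldType) (X : choiceType) (W : lmodType K).
Implicit Types (f g : X -> W) (x : {malg K[X]}).

Lemma eq_lext_supp f g x : (forall k, k \in msupp x -> f k = g k) -> lext f x = lext g x.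
Proof. by move=> fg; rewrite !lext.unlock; apply: eq_big_seq => k /fg ->. Qed.

Lemma eq_lext f g x : f =1 g -> lext f x = lext g x.
Proof. by move=> fg; apply: eq_lext_supp. Qed.

Lemma lext_add f g x : lext (fun k => f k + g k) x = lext f x + lext g x.
Proof.
by rewrite !lext.unlock -big_split; apply: eq_bigr => k _; rewrite scalerDr.
Qed.

Lemma lext_scale a f x : lext (fun k => a *: f k) x = a *: lext f x.
Proof.
by rewrite !lext.unlock scaler_sumr; apply: eq_bigr => k _; rewrite !scalerA mulrC.
Qed.

Lemma lext_sub f g x : lext (fun k => f k - g k) x = lext f x - lext g x.
Proof.
rewrite -scaleN1r -lext_scale -lext_add.
by apply: eq_lext => k; rewrite scaleN1r.
Qed.

Lemma lext_zero f x : (forall k, k \in msupp x -> f k = 0) -> lext f x = 0.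
Proof.
move=> f0; rewrite lext.unlock big_seq big1 // => k /f0 ->; exact: scaler0.
Qed.

Lemma lext_sum I (r : seq I) (P : pred I) (f : I -> X -> W) x :
  lext (fun k => \sum_(i <- r | P i) f i k) x = \sum_(i <- r | P i) lext (f i) x.
Proof.
elim: r => [|i r IH]; first by rewrite big_nil; apply: lext_zero => k _; rewrite big_nil.
rewrite big_cons -IH; case: ifP => Pi; first rewrite -lext_add.
  by apply: eq_lext => k; rewrite big_cons Pi.
by apply: eq_lext => k; rewrite big_cons Pi.
Qed.

Lemma lext_comp (W' : lmodType K) (h : {linear W -> W'}) f x :
  h (lext f x) = lext (fun k => h (f k)) x.
Proof.
by rewrite !lext.unlock raddf_sum; apply: eq_bigr => k _; exact: linearZ_LR.
Qed.

Lemma lextMn f x n : lext (fun k => f k *+ n) x = lext f x *+ n.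
Proof. by rewrite -scaler_nat -lext_scale; apply: eq_lext => k; rewrite scaler_nat. Qed.

End Lext.

Lemma lext_lext (K : fieldType) (X Y : choiceType) (W : lmodType K)
  (f : X -> {malg K[Y]}) (g : Y -> W) x :
  lext g (lext f x) = lext (fun k => lext g (f k)) x.
Proof. exact: (lext_comp (lext g)). Qed.

Lemma lext_exch (K : fieldType) (X Y : choiceType) (W : lmodType K)
  (f : X -> Y -> W) x y :
  lext (fun k => lext (f k) y) x = lext (fun l => lext (fun k => f k l) x) y.
Proof.
have E (U : lmodType K) (Z : choiceType) (h : Z -> U) z :
    lext h z = \sum_(k <- msupp z) z@_k *: h k by rewrite lext.unlock.
rewrite !E; transitivity (\sum_(k <- msupp x) \sum_(l <- msupp y) x@_k *: (y@_l *: f k l)).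
  by apply: eq_bigr => k _; rewrite E scaler_sumr.
rewrite exchange_big; apply: eq_bigr => l _ /=; rewrite E scaler_sumr.
by apply: eq_bigr => k _; rewrite !scalerA mulrC.
Qed.

Lemma lext_coef (K : fieldType) (X : choiceType) (j : X) (x : {malg K[X]}) :
  lext (fun k => (k == j)%:R : K^o) x = x@_j.
Proof.
rewrite (@lextEw _ _ _ _ _ (fsetU (msupp x) [fset j]%fset)) ?fsubsetUl //.
rewrite (big_fsetD1 j) /=; last by rewrite !inE eqxx orbT.
rewrite eqxx big_seq big1 => [|w]; first by rewrite addr0; apply: mulr1.
by rewrite !inE => /andP[/negPf -> _]; rewrite scaler0.
Qed.


Section Symmetric.
Variable D : choiceType.
Local Notation T := (ptree D).
Local Notation F := (forest D).

(* Elements of the abelianised Hopf algebra and of its tensor powers are *)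
(* represented by combinations of (tuples of) planar forests, considered only *)
(* through the values of the functions of forests that are invariant under *)
(* reordering; functions vanishing on the empty forest see the augmentation *)
(* ideal and the reduced coproduct. *)
Definition sym (V : Type) (phi : F -> V) :=
  forall v w : F, perm_eq v w -> phi v = phi w.
Definition sym2 (V : Type) (phi : F -> F -> V) :=
  (forall r, sym (phi^~ r)) /\ (forall p, sym (phi p)).
Definition sym3 (V : Type) (phi : F -> F -> F -> V) :=
  [/\ forall q r, sym (fun p => phi p q r), forall p r, sym (fun q => phi p q r)
    & forall p q, sym (phi p q)].

Definition pos2 (V : nmodType) (phi : F -> F -> V) :=
  forall p r, p = [::] \/ r = [::] -> phi p r = 0.
Definition pos3 (V : nmodType) (phi : F -> F -> F -> V) :=
  forall p q r, [\/ p = [::], q = [::] | r = [::]] -> phi p q r = 0.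

Lemma symP (V : Type) (phi : F -> V) :
  (forall s1 s2 s3 : F, phi (s1 ++ s2 ++ s3) = phi (s2 ++ s1 ++ s3)) -> sym phi.
Proof.
move=> H v w vw.
apply: (catCA_perm_ind (P := fun s => phi v = phi s) _ vw) => // s1 s2 s3 ->.
exact: H.
Qed.

(** The coproduct descends to C: exchanging two blocks of the forest exchanges the corresponding
    blocks in both factors of every cut. *)
Lemma sym_cuts (V : nmodType) (phi : F -> F -> V) :
  sym2 phi -> sym (fun w => \sum_(q <- cuts w) phi q.1 q.2).
Proof.
move=> [s1 s2]; apply: symP => x y z.
pose H u v := sum_cuts_cat u (v ++ z) phi.
rewrite !H exchange_big /=; rewrite exchange_big /=.
under eq_bigr => a _ do rewrite (sum_cuts_cat _ _ (fun p r => phi (a.1 ++ p) (a.2 ++ r))).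
under [in RHS]eq_bigr => a _ do rewrite (sum_cuts_cat _ _ (fun p r => phi (a.1 ++ p) (a.2 ++ r))).
rewrite exchange_big /=; apply: eq_bigr => a _; apply: eq_bigr => b _.
apply: eq_bigr => c _.
have P (u v w : F) : perm_eq (u ++ v ++ w) (v ++ u ++ w) by exact/permPl/perm_catCA.
by rewrite (s1 _ _ _ (P _ _ _)) (s2 _ _ _ (P _ _ _)).
Qed.

Fixpoint picks (s : F) : seq (T * F) :=
  if s is x :: s' then (x, s') :: [seq (k.1, x :: k.2) | k <- picks s'] else [::].

Lemma perm_picks s (k : T * F) : k \in picks s -> perm_eq s (k.1 :: k.2).
Proof.
elim: s k => //= x s IH k; rewrite inE => /predU1P[->|/mapP[k' /IH]] //.
move=> P -> /=; rewrite -(perm_cons x) in P; apply: (perm_trans P).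
exact/permPl/(perm_catCA [:: x] [:: k'.1] k'.2).
Qed.

Lemma size_picks s (k : T * F) : k \in picks s -> size s = (size k.2).+1.
Proof. by move=> /perm_picks/perm_size. Qed.

Section PickSums.
Variable V : nmodType.
Implicit Types f : T -> F -> V.

Lemma sum_picks_cons x s f : \sum_(k <- picks (x :: s)) f k.1 k.2 =
  f x s + \sum_(k <- picks s) f k.1 (x :: k.2).
Proof. by rewrite big_cons big_map. Qed.

Lemma sum_picks_cat s s' f : \sum_(k <- picks (s ++ s')) f k.1 k.2 =
  \sum_(k <- picks s) f k.1 (k.2 ++ s') + \sum_(k <- picks s') f k.1 (s ++ k.2).
Proof.
elim: s f => [|x s IH] f; first by rewrite big_nil add0r.
rewrite cat_cons sum_picks_cons (IH (fun t r => f t (x :: r))).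
by rewrite (sum_picks_cons _ _ (fun t r => f t (r ++ s'))) addrA.
Qed.

Lemma sum_picks_rem s f : (forall t, sym (f t)) ->
  \sum_(k <- picks s) f k.1 k.2 = \sum_(t <- s) f t (rem t s).
Proof.
elim: s f => [|x s IH] f sf; first by rewrite !big_nil.
rewrite sum_picks_cons big_cons /= eqxx; congr (_ + _).
rewrite (IH (fun t r => f t (x :: r))) => [|t v w vw]; last first.
  by apply: sf; rewrite perm_cons.
apply: eq_big_seq => t; case: (eqVneq x t) => // <- xs.
by apply: sf; rewrite perm_sym; apply: perm_to_rem.
Qed.

Lemma sum_picks_sym f : (forall t, sym (f t)) ->
  sym (fun s => \sum_(k <- picks s) f k.1 k.2).
Proof.
move=> sf v w vw; rewrite !sum_picks_rem //.
rewrite (perm_big _ vw) /=; apply: eq_big_seq => t tw; apply: sf.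
have tv : t \in v by rewrite (perm_mem vw).
rewrite -(perm_cons t) -(permPl (perm_to_rem tv)) -(permPr (perm_to_rem tw)).
exact: vw.
Qed.

Lemma sum_picks_const s (g : F -> V) : sym g ->
  \sum_(k <- picks s) g (k.1 :: k.2) = g s *+ size s.
Proof.
move=> sg; have -> : size s = size (picks s) by elim: s => //= x s ->; rewrite size_map.
rewrite (eq_big_seq (fun=> g s)) => [|k /perm_picks P]; last by rewrite (sg _ _ P).
by rewrite big_const_seq count_predT iter_addr_0.
Qed.

Lemma cutT_trunk t (a : F * F) :
  a \in cutT t -> a.2 = [::] \/ exists s, a.2 = [:: s].
Proof.
by case: t => d h /=; rewrite inE => /predU1P[->|/mapP[q _ ->]]; [left|right; exists (Node d q.2)].
Qed.

(** Every tree of a trunk comes from exactly one tree of [x], since a tree leaves at most one trunk.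
    Invariance in the pruned part is used to move the part cut from the picked tree to the front. *)
Lemma picks_cuts (Psi : F -> T -> F -> V) x :
  (forall t r, sym (fun p => Psi p t r)) ->
  \sum_(q <- cuts x) \sum_(k <- picks q.2) Psi q.1 k.1 k.2 =
  \sum_(k <- picks x) \sum_(a <- cutT k.1) \sum_(s <- a.2)
    \sum_(b <- cuts k.2) Psi (a.1 ++ b.1) s b.2.
Proof.
elim: x Psi => [|t x IH] Psi sP; first by rewrite big_seq1 !big_nil.
rewrite (sum_cuts_cons t x (fun p r => \sum_(k <- picks r) Psi p k.1 k.2)).
rewrite (sum_picks_cons _ _ (fun y r => \sum_(a <- cutT y) \sum_(s <- a.2)
  \sum_(b <- cuts r) Psi (a.1 ++ b.1) s b.2)).
transitivity (\sum_(a <- cutT t) (\sum_(s <- a.2) \sum_(b <- cuts x)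
   Psi (a.1 ++ b.1) s b.2 + \sum_(b <- cuts x) \sum_(k <- picks b.2)
   Psi (a.1 ++ b.1) k.1 (a.2 ++ k.2))).
  apply: eq_big_seq => a /cutT_trunk aP; rewrite [X in X + _]exchange_big -big_split /=.
  apply: eq_bigr => b _; rewrite (sum_picks_cat _ _ (Psi _)); congr (_ + _).
  by case: aP => [|[s]] ->; rewrite ?big_nil //= !big_seq1.
rewrite big_split /=; congr (_ + _).
transitivity (\sum_(a <- cutT t) \sum_(k <- picks x) \sum_(a' <- cutT k.1)
  \sum_(s <- a'.2) \sum_(b <- cuts k.2) Psi (a'.1 ++ a.1 ++ b.1) s (a.2 ++ b.2)).
  apply: eq_bigr => a _.
  rewrite (IH (fun p s r => Psi (a.1 ++ p) s (a.2 ++ r))) => [|s r v w vw]; last first.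
    by apply: sP; rewrite perm_cat2l.
  do 4!apply: eq_bigr => ? _.
  exact/sP/permPl/perm_catCA.
rewrite exchange_big /=; apply: eq_bigr => k _.
rewrite exchange_big /=; apply: eq_bigr => a _.
rewrite exchange_big /=; apply: eq_bigr => s _.
by rewrite (sum_cuts_cons _ _ (fun p r => Psi (a.1 ++ p) s r)).
Qed.

End PickSums.
End Symmetric.

(** * Symmetrization and grafting *)

Section Weight.
Variables (D : choiceType) (deg : D -> nat).
Local Notation T := (ptree D).
Local Notation F := (forest D).

Lemma mem_cuts_cons t (w : F) (q : F * F) : q \in cuts (t :: w) ->
  exists a b : F * F, [/\ a \in cutT t, b \in cuts w & q = (a.1 ++ b.1, a.2 ++ b.2)].
Proof. by move=> /allpairsP[[a b] [/= at_ bw ->]]; exists a, b. Qed.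

Lemma size_cuts (w : F) (q : F * F) : q \in cuts w -> (size q.2 <= size w)%N.
Proof.
elim: w q => [|t w IH] q; first by rewrite inE => /eqP ->.
move=> /mem_cuts_cons[a [b [/cutT_trunk at_ /IH bw ->]]] /=.
by rewrite size_cat; case: at_ => [->|[s ->]] /=; lia.
Qed.

Fixpoint wtT (t : T) : nat :=
  let: Node d h := t in (deg d + sumn (map wtT h))%N.
Definition wt (w : F) : nat := sumn (map wtT w).

Lemma wt_cons t w : wt (t :: w) = (wtT t + wt w)%N. Proof. by []. Qed.
Lemma wt_node d h : wtT (Node d h) = (deg d + wt h)%N. Proof. by []. Qed.
Lemma wt_cat v w : wt (v ++ w) = (wt v + wt w)%N.
Proof. by rewrite /wt map_cat sumn_cat. Qed.
Lemma wt1 t : wt [:: t] = wtT t. Proof. by rewrite wt_cons addn0. Qed.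

Lemma wt_perm v w : perm_eq v w -> wt v = wt w.
Proof. by move=> vw; apply/perm_sumn/perm_map. Qed.

Lemma wt_cuts (w : F) (q : F * F) : q \in cuts w -> (wt q.1 + wt q.2)%N = wt w.
Proof.
elim/forest_ind: w q => [|d h w IHh IHw] q; first by rewrite inE => /eqP ->.
move=> /mem_cuts_cons[a [b [at_ /IHw E ->]]] /=; rewrite !wt_cat wt_cons -E.
have -> : wtT (Node d h) = (wt a.1 + wt a.2)%N; last by lia.
rewrite wt_node; case/predU1P: at_ => [->|/mapP[r rh ->]].
  by rewrite wt1 addn0.
have E' := IHh r rh; rewrite [X in (_ = _ + X)%N]wt1 wt_node -E'.
by rewrite [LHS]addnCA.
Qed.

Hypothesis deg_gt0 : forall d, (0 < deg d)%N.

Lemma wtT_gt0 t : (0 < wtT t)%N.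
Proof. by case: t => d h; rewrite wt_node; have := deg_gt0 d; lia. Qed.

Lemma wt_eq0 w : (wt w == 0)%N = (w == [::]).
Proof. by case: w => //= t w; rewrite wt_cons; have := wtT_gt0 t; case: (wtT t). Qed.

Lemma leq_size_wt w : (size w <= wt w)%N.
Proof. by elim: w => //= t w; rewrite wt_cons; have := wtT_gt0 t; lia. Qed.
End Weight.

Section Symmetrization.
Variables (K : fieldType) (charK : [pchar K] =i pred0) (D : choiceType).
Local Notation T := (ptree D).
Local Notation F := (forest D).

Lemma natK_neq0 n : n.+1%:R != 0 :> K.
Proof. by rewrite ((pcharf0P _).1 charK). Qed.

(** The fuel [n] stands for the size of [c]; each stage averages over the tree that comes first. *)
Fixpoint symz n (c : F) : {malg K[F]} :=
  if n is m.+1 then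
    n%:R^-1 *: \sum_(k <- picks c) lext (fun w : F => << (k.1 :: w : F) >>) (symz m k.2)
  else << [::] >>.

(* The average of the (size c)! reorderings of c. *)
Definition sc (c : F) : {malg K[F]} := symz (size c) c.

Section Values.
Variable V : lmodType K.

Lemma lext_symz n c (psi : F -> V) : lext psi (symz n.+1 c) =
  n.+1%:R^-1 *: \sum_(k <- picks c) lext (fun w => psi (k.1 :: w)) (symz n k.2).
Proof.
rewrite linearZ_LR raddf_sum /=; congr (_ *: _); apply: eq_bigr => k _.
by rewrite lext_lext; apply: eq_lext => w; rewrite lextU.
Qed.

Lemma lext_sc0 (psi : F -> V) : lext psi (sc [::]) = psi [::].
Proof. exact: lextU. Qed.

Lemma lext_sc c (psi : F -> V) : (size c)%:R *: lext psi (sc c) =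
  \sum_(k <- picks c) lext (fun w => psi (k.1 :: w)) (sc k.2).
Proof.
rewrite /sc; case: c => [|t c]; first by rewrite scale0r big_nil.
rewrite lext_symz scalerA divff ?natK_neq0 // scale1r.
by apply: eq_big_seq => k /size_picks [<-].
Qed.

Lemma lext_sc_sym (psi : F -> V) : sym (fun c => lext psi (sc c)).
Proof.
move=> v w vw; rewrite /sc (perm_size vw).
move: (size w) => n; elim: n v w vw psi => [|n IH] v w vw psi //.
rewrite !lext_symz; congr (_ *: _).
apply: (sum_picks_sym (f := fun t r => lext (fun w => psi (t :: w)) (symz n r))) => //.
by move=> t p r pr; apply: IH.
Qed.

(* In Sweedler notation, Delta (sc c) = c_(1) (x) sc c_(2) up to reordering *)
(* the first factor. *)
Lemma lext_sc_cuts (phi : F -> F -> V) c : (forall r, sym (phi^~ r)) ->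
  lext (fun w => \sum_(q <- cuts w) phi q.1 q.2) (sc c) =
  \sum_(q <- cuts c) lext (phi q.1) (sc q.2).
Proof.
have [n] := ubnP (size c); elim: n c phi => // n IH [|t0 c0] phi le_n sp.
  by rewrite lext_sc0 !big_seq1 lext_sc0.
apply: (scalerI (natK_neq0 (size c0))).
rewrite -/(size (t0 :: c0)); set c := t0 :: c0; rewrite lext_sc.
pose Psi p r := lext (phi p) (sc r).
(* [Om] is the defect between putting [s] first and averaging over all orders. [picks_cuts] regroups
   the defects by trunk, and over the picks of one trunk they sum to zero by [lext_sc]. *)
pose Om p s r := lext (fun w => phi p (s :: w)) (sc r) - Psi p (s :: r).
have sPsi : sym2 Psi.
  split=> [r v w vw|p]; last exact: lext_sc_sym.
  by apply: eq_lext => x; apply: sp.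
transitivity (\sum_(k <- picks c) \sum_(a <- cutT k.1) \sum_(b <- cuts k.2)
   (Psi (a.1 ++ b.1) (a.2 ++ b.2) + \sum_(s <- a.2) Om (a.1 ++ b.1) s b.2)).
  apply: eq_big_seq => k kp.
  under eq_lext => w do rewrite sum_cuts_cons.
  rewrite lext_sum; apply: eq_big_seq => a /cutT_trunk aP.
  rewrite (IH _ (fun p r => phi (a.1 ++ p) (a.2 ++ r))) => [||r v w vw].
  - apply: eq_bigr => b _; rewrite /Om /Psi.
    by case: aP => [|[s]] ->; rewrite ?big_nil ?addr0 //= big_seq1 addrC subrK.
  - by have := size_picks kp; rewrite /= in le_n *; lia.
  - by apply: sp; rewrite perm_cat2l.
under eq_bigr => k _ do under eq_bigr => a _ do rewrite big_split /=.
under eq_bigr => k _ do rewrite big_split /=.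
rewrite big_split /= [X in _ + X](_ : _ = 0).
  rewrite addr0; under eq_bigr => k _ do rewrite -sum_cuts_cons.
  rewrite (sum_picks_const c (g := fun w => \sum_(q <- cuts w) Psi q.1 q.2)).
    by rewrite scaler_nat.
  exact: sym_cuts.
transitivity (\sum_(q <- cuts c) \sum_(k <- picks q.2) Om q.1 k.1 k.2).
  rewrite (picks_cuts (Psi := Om)) => [|s r v w vw].
    by apply: eq_bigr => k _; apply: eq_bigr => a _; rewrite exchange_big.
  rewrite /Om (sPsi.1 _ _ _ vw); congr (_ - _).
  by apply: eq_lext => x; apply: sp.
rewrite big1 // => q _; rewrite sumrB -lext_sc.
by rewrite (sum_picks_const q.2 (sPsi.2 q.1)) scaler_nat subrr.
Qed.

End Values.

Definition graft (w : F) (t : T) : T := let: Node d h := t in Node d (w ++ h).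

(* Delta (ins c x) = c_(1) x_(1) (x) ins c_(2) x_(2), modulo terms with fewer *)
(* trees than x in the right factor, and ins 1 x = x: see lext_ins_cuts and *)
(* lext_ins0. *)
Definition ins (c x : F) : {malg K[F]} :=
  (size x)%:R^-1 *: \sum_(k <- picks x)
    lext (fun w : F => << (graft w k.1 :: k.2 : F) >>) (sc c).

Section InsValues.
Variable V : lmodType K.

Lemma lext_ins c x (psi : F -> V) : lext psi (ins c x) =
  (size x)%:R^-1 *: \sum_(k <- picks x) lext (fun w => psi (graft w k.1 :: k.2)) (sc c).
Proof.
rewrite linearZ_LR raddf_sum /=; congr (_ *: _); apply: eq_bigr => k _.
by rewrite lext_lext; apply: eq_lext => w; rewrite lextU.
Qed.

Lemma lext_ins_sym (psi : F -> V) :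
  sym psi -> sym2 (fun c x => lext psi (ins c x)).
Proof.
move=> sp; split=> [x v w vw|c v w vw]; rewrite !lext_ins.
  by congr (_ *: _); apply: eq_bigr => k _; apply: lext_sc_sym.
rewrite (perm_size vw); congr (_ *: _).
apply: (sum_picks_sym (f := fun t r => lext (fun w => psi (graft w t :: r)) (sc c))) => //.
by move=> t p r pr; apply: eq_lext => y; apply: sp; rewrite perm_cons.
Qed.

Lemma lext_ins0 (psi : F -> V) x :
  sym psi -> x != [::] -> lext psi (ins [::] x) = psi x.
Proof.
move=> sp x0; rewrite lext_ins.
under eq_bigr => k _ do rewrite lext_sc0.
have -> : \sum_(k <- picks x) psi (graft [::] k.1 :: k.2) =
          \sum_(k <- picks x) psi (k.1 :: k.2).
  by apply: eq_bigr => -[[d h] r].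
rewrite sum_picks_const // -scaler_nat scalerA mulVf ?scale1r //.
by case: x x0 => // t x _; apply: natK_neq0.
Qed.

(** Grafting onto the root of an existing tree leaves the number of trees unchanged. *)
Lemma lext_ins_size (psi : F -> V) c x :
  (forall w, size w = size x -> psi w = 0) -> lext psi (ins c x) = 0.
Proof.
move=> p0; rewrite lext_ins big_seq big1 ?scaler0 // => k /size_picks sx.
by apply: lext_zero => w _; apply: p0.
Qed.

(** The total cut of [graft w t] leaves a trunk made of trees of [y] only, too small for [phi].
    Every other cut keeps the root, hence is a pair of cuts of [w] and of [t]. *)
Lemma sum_cuts_graft (phi : F -> F -> V) n w t y :
  (forall p r, (size r < n)%N -> phi p r = 0) -> (size y < n)%N ->
  \sum_(q <- cuts (graft w t :: y)) phi q.1 q.2 =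
  \sum_(u <- cuts w) \sum_(a <- cutT t) \sum_(s <- a.2) \sum_(b <- cuts y)
    phi (u.1 ++ a.1 ++ b.1) (graft u.2 s :: b.2).
Proof.
case: t => d h p0 yn; rewrite sum_cuts_cons.
rewrite (sum_cutT d (w ++ h) (fun p r => \sum_(b <- cuts y) phi (p ++ b.1) (r ++ b.2))).
rewrite [X in X + _]big_seq [X in X + _]big1 => [|b /size_cuts sb]; last first.
  by apply: p0 => /=; lia.
rewrite add0r (sum_cuts_cat w h (fun p r =>
  \sum_(b <- cuts y) phi (p ++ b.1) ([:: Node d r] ++ b.2))).
apply: eq_bigr => u _.
rewrite (sum_cutT d h (fun p r => \sum_(s <- r) \sum_(b <- cuts y)
  phi (u.1 ++ p ++ b.1) (graft u.2 s :: b.2))) big_nil add0r.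
apply: eq_bigr => v _; rewrite big_seq1; apply: eq_bigr => b _.
by rewrite catA.
Qed.

(** [sum_cuts_graft] separates the cuts of the grafted part from those of [x], [lext_sc_cuts] turns
    a cut of [sc c] into [sc] of the trunk, and [picks_cuts] selects the supporting tree in the
    trunk of [x]. *)
Lemma lext_ins_cuts (phi : F -> F -> V) c x : sym2 phi ->
  (forall p r, (size r < size x)%N -> phi p r = 0) ->
  lext (fun w => \sum_(q <- cuts w) phi q.1 q.2) (ins c x) =
  \sum_(u <- cuts c) \sum_(q <- cuts x) lext (phi (u.1 ++ q.1)) (ins u.2 q.2).
Proof.
move=> [s1 s2] p0; rewrite lext_ins.
pose G t y p r := \sum_(a <- cutT t) \sum_(s <- a.2) \sum_(b <- cuts y)
  phi (p ++ a.1 ++ b.1) (graft r s :: b.2).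
transitivity ((size x)%:R^-1 *: \sum_(k <- picks x) \sum_(u <- cuts c)
   lext (G k.1 k.2 u.1) (sc u.2)).
  congr (_ *: _); apply: eq_big_seq => k kp.
  rewrite -lext_sc_cuts => [|r v w vw]; last first.
    by do 3!apply: eq_bigr => ? _; apply: s1; rewrite perm_cat2r.
  apply: eq_lext => w; rewrite (sum_cuts_graft _ _ p0) //.
  by have := size_picks kp; lia.
rewrite exchange_big /= scaler_sumr; apply: eq_bigr => u _.
transitivity ((size x)%:R^-1 *: \sum_(q <- cuts x) \sum_(k <- picks q.2)
   lext (fun w => phi (u.1 ++ q.1) (graft w k.1 :: k.2)) (sc u.2)).
  congr (_ *: _); rewrite (picks_cuts (Psi := fun p t r =>
     lext (fun w => phi (u.1 ++ p) (graft w t :: r)) (sc u.2))).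
    apply: eq_bigr => k _; rewrite lext_sum; apply: eq_bigr => a _.
    rewrite lext_sum; apply: eq_bigr => s _.
    by rewrite lext_sum.
  by move=> t r v w vw; apply: eq_lext => z; apply: s1; rewrite perm_cat2l.
(* The averaging factors on the two sides agree only when the trunk [q.2] has as many trees as [x];
   for smaller trunks both sides vanish. *)
rewrite scaler_sumr; apply: eq_big_seq => q /size_cuts; rewrite leq_eqVlt.
move=> /predU1P[<-|lt_q]; first by rewrite lext_ins.
rewrite lext_ins_size => [|w sw]; last by apply: p0; rewrite sw.
rewrite big_seq big1 ?scaler0 // => k /size_picks sk.
by apply: lext_zero => w _; apply: p0; rewrite /=; lia.
Qed.

End InsValues.
End Symmetrization.

(** * Vanishing of the second cohomology of the cobar complex *)

Section ExtremeCuts.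
Variables (D : choiceType) (V : nmodType).
Local Notation F := (forest D).

(** Counit property: exactly one admissible cut prunes nothing. *)
Lemma sum_cuts_left0 (psi : F -> V) x :
  \sum_(q <- cuts x) (if q.1 == [::] then psi q.2 else 0) = psi x.
Proof.
elim/forest_ind: x psi => [|d h w IHh IHw] psi; first by rewrite big_seq1.
rewrite (sum_cuts_cons _ _ (fun p r => if p == [::] then psi r else 0)).
transitivity (\sum_(a <- cutT (Node d h)) if a.1 == [::] then psi (a.2 ++ w) else 0).
  apply: eq_bigr => -[[|t p] r] _ /=; last by rewrite big1.
  by rewrite (IHw (fun v => psi (r ++ v))).
rewrite (sum_cutT d h (fun p r => if p == [::] then psi (r ++ w) else 0)) add0r.
exact: (IHh (fun v => psi (Node d v :: w))).
Qed.

Lemma sum_cuts_right0 (psi : F -> V) x :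
  \sum_(q <- cuts x) (if q.2 == [::] then psi q.1 else 0) = psi x.
Proof.
elim: x psi => [|[d h] w IHw] psi; first by rewrite big_seq1.
rewrite (sum_cuts_cons _ _ (fun p r => if r == [::] then psi p else 0)).
rewrite (sum_cutT d h (fun p r => \sum_(b <- cuts w)
  if r ++ b.2 == [::] then psi (p ++ b.1) else 0)).
rewrite [X in _ + X]big1 => [|q _]; last by rewrite big1.
by rewrite addr0 (IHw (fun v => psi (Node d h :: v))).
Qed.

Lemma sum_cuts_left (phi : F -> F -> V) x : \sum_(q <- cuts x) phi q.1 q.2 =
  phi [::] x + \sum_(q <- cuts x) (if q.1 == [::] then 0 else phi q.1 q.2).
Proof.
rewrite -(sum_cuts_left0 (phi [::]) x) -big_split; apply: eq_bigr => -[p r] _ /=.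
by case: eqP => [->|_]; rewrite ?addr0 ?add0r.
Qed.

Lemma sum_cuts_ends (phi : F -> F -> V) x : x != [::] ->
  \sum_(q <- cuts x) phi q.1 q.2 = phi [::] x + phi x [::] +
  \sum_(q <- cuts x) (if (q.1 == [::]) || (q.2 == [::]) then 0 else phi q.1 q.2).
Proof.
move=> x0; rewrite sum_cuts_left -addrA; congr (_ + _).
rewrite -(sum_cuts_right0 (phi^~ [::]) x) -big_split.
rewrite big_seq [RHS]big_seq; apply: eq_bigr => -[p r] /= qx.
have [p0|p0] /= := eqVneq p [::]; last by case: eqP => [->|_]; rewrite ?addr0 ?add0r.
case: eqP => [r0|_]; last by rewrite addr0.
have := wt_cuts (fun=> 1%N) qx; rewrite p0 r0 /= => /esym/eqP.
by rewrite wt_eq0 // (negPf x0).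
Qed.

End ExtremeCuts.

Section Cobar.
Variables (K : fieldType) (charK : [pchar K] =i pred0) (D : choiceType).
Variables (deg : D -> nat) (deg_gt0 : forall d, (0 < deg d)%N).
Local Notation T := (ptree D).
Local Notation F := (forest D).
Local Notation wt := (wt deg).
Implicit Type z : {malg K[(F * F)%type]}.

(** Equality, in the third tensor power of the augmentation ideal of C, of the reduced coproduct
    applied to the left and to the right factor of [z]. *)
Definition cocycle z := forall (V : lmodType K) (phi : F -> F -> F -> V),
  sym3 phi -> pos3 phi ->
  lext (fun k => \sum_(q <- cuts k.1) phi q.1 q.2 k.2) z =
  lext (fun k => \sum_(q <- cuts k.2) phi k.1 q.1 q.2) z.

(** In the lexicographic order on (trees on the right, weight on the left), the class of [z] has no
    component beyond (n, M). The support of [z] itself may go further. *)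
Definition bounded n M z := forall (V : lmodType K) (phi : F -> F -> V),
  sym2 phi -> pos2 phi ->
  (forall p r, ~~ ((n < size r)%N || (size r == n) && (M < wt p)%N) -> phi p r = 0) ->
  lext (fun k => phi k.1 k.2) z = 0.

Definition cobounds (y : {malg K[F]}) z := forall (V : lmodType K) (phi : F -> F -> V),
  sym2 phi -> pos2 phi ->
  lext (fun w => \sum_(q <- cuts w) phi q.1 q.2) y = lext (fun k => phi k.1 k.2) z.

Definition comul_elt (y : {malg K[F]}) : {malg K[(F * F)%type]} :=
  lext (fun w => \sum_(q <- cuts w) << (q.1, q.2) >>) y.

Lemma lext_comul_elt (V : lmodType K) (phi : F -> F -> V) y :
  lext (fun k => phi k.1 k.2) (comul_elt y) =
  lext (fun w => \sum_(q <- cuts w) phi q.1 q.2) y.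
Proof.
rewrite lext_lext; apply: eq_lext => w; rewrite raddf_sum; apply: eq_bigr => q _.
exact: lextU.
Qed.

Lemma cocycle_comul y : cocycle (comul_elt y).
Proof.
move=> V phi _ _.
rewrite (lext_comul_elt (fun p r => \sum_(q <- cuts p) phi q.1 q.2 r)).
rewrite (lext_comul_elt (fun p r => \sum_(q <- cuts r) phi p q.1 q.2)).
by apply: eq_lext => w; apply: cuts_coassoc.
Qed.

Lemma cocycleB z z' : cocycle z -> cocycle z' -> cocycle (z - z').
Proof.
by move=> cz cz' V phi sp pp; rewrite !linearB /= cz // cz'.
Qed.

Section Step.
Variables (n M : nat) (z : {malg K[(F * F)%type]}).
Hypotheses (n_gt0 : (0 < n)%N) (cz : cocycle z) (bz : bounded n M.+1 z).

(* The leading term of z consists of elements c (x) x with x coinvariant for *)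
(* the associated graded coaction, so that the coboundary of ins c x is *)
(* c (x) x plus lower terms. *)
Let top (k : F * F) := (size k.2 == n) && (wt k.1 == M.+1).
Let y : {malg K[F]} := lext (fun k => if top k then ins K k.1 k.2 else 0) z.

Section Phi.
Variables (V : lmodType K) (phi : F -> F -> V).
Hypotheses (sp : sym2 phi) (pp : pos2 phi).
Hypothesis (p0 : forall p r, (size r < n)%N -> phi p r = 0).

Let G p c x := lext (phi p) (ins K c x).

Let G_symp c x : sym (fun p => G p c x).
Proof. by move=> p p' pp'; apply: eq_lext => w; apply: sp.1. Qed.
Let G_sym p : sym2 (G p).
Proof. exact/lext_ins_sym/sp.2. Qed.
Let G0 p c x : (size x < n)%N -> G p c x = 0.
Proof. by move=> xn; apply: lext_ins_size => w sw; apply: p0; rewrite sw. Qed.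

(** The test function for the cocycle condition: it collects the terms in the coproduct of [ins c x]
    where [x] is really cut, into a pruned part [a] and a trunk [b] that still has n trees. *)
Let Phi c a b :=
  if [&& wt c == M.+1, size b == n & a != [::]]
  then \sum_(u <- cuts c) G (u.1 ++ a) u.2 b else 0.

Let Phi_sym : sym3 Phi.
Proof.
split=> [a b c c' cc'|c b a a' aa'|c a b b' bb']; rewrite /Phi.
- rewrite (wt_perm _ cc'); case: ifP => // _.
  apply: (sym_cuts (phi := fun p r => G (p ++ a) r b)) cc'.
  split=> [r v w vw|p]; first by apply: G_symp; rewrite perm_cat2r.
  exact: (G_sym _).1.
- rewrite (_ : (a' != [::]) = (a != [::])); last by rewrite -!size_eq0 (perm_size aa').
  by case: ifP => // _; apply: eq_bigr => u _; apply: G_symp; rewrite perm_cat2l.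
- rewrite (perm_size bb'); case: ifP => // _; apply: eq_bigr => u _.
  exact: (G_sym _).2.
Qed.

Let Phi_pos : pos3 Phi.
Proof.
move=> c a b; rewrite /Phi => -[->|->|->] //=; rewrite ?andbF //.
by rewrite (ltn_eqF n_gt0) andbF.
Qed.

(** A cut of [c] with pruned part of weight M + 1 and nonempty trunk forces [c] to weigh more than M
    + 1, which is beyond the bound on [z]. *)
Let Phi_left : lext (fun k => \sum_(q <- cuts k.1) Phi q.1 q.2 k.2) z = 0.
Proof.
apply: (bz (phi := fun c x => \sum_(q <- cuts c) Phi q.1 q.2 x)).
- have [S1 S2 S3] := Phi_sym.
  split=> [x|c v w vw]; last by apply: eq_bigr => q _; apply: S3.
  exact: (sym_cuts (phi := fun p r => Phi p r x)).
- move=> p r [->|->]; first by rewrite big_seq1 Phi_pos //; constructor.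
  by rewrite big1 // => q _; rewrite Phi_pos //; constructor.
move=> c x nb; rewrite big_seq big1 // => q /(wt_cuts deg) wq.
rewrite /Phi; case: ifP => // /and3P[/eqP w1 /eqP sx q20].
move: nb; rewrite sx eqxx ltnn /= -wq w1 -[X in (X < _)%N]addn0 ltn_add2l.
by rewrite lt0n wt_eq0 // q20.
Qed.

Lemma comul_top : lext (fun w => \sum_(q <- cuts w) phi q.1 q.2) y =
  lext (fun k => if top k then \sum_(u <- cuts k.1) G u.1 u.2 k.2 else 0) z.
Proof.
pose f k := \sum_(q <- cuts k.2) Phi k.1 q.1 q.2.
(* Only right factors with exactly n trees matter: those with more are beyond the bound on [z], and
   those with fewer have no trunk with n trees. *)
have f0 : lext (fun k => if size k.2 == n then f k else 0) z = 0.
  have E : lext f z = 0 by rewrite -(cz Phi_sym Phi_pos) Phi_left.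
  rewrite -[RHS]E; apply/eqP; rewrite eq_sym -subr_eq0 -lext_sub; apply/eqP.
  rewrite -[RHS](bz (phi := fun c x => if size x == n then 0 else f (c, x))).
  - by apply: eq_lext => -[c x] /=; case: ifP; rewrite ?subrr ?subr0.
  - have [S1 S2 S3] := Phi_sym.
    split=> [x c c' cc'|c x x' xx']; rewrite /f /=.
      by case: ifP => // _; apply: eq_bigr => q _; apply: S1.
    rewrite (perm_size xx'); case: ifP => // _.
    exact: (sym_cuts (phi := Phi c)) xx'.
  - move=> c x [->|->]; case: ifP => // _; rewrite /f /=.
      by rewrite big1 // => q _; rewrite Phi_pos //; constructor.
    by rewrite big_seq1 Phi_pos //; constructor.
  - move=> c x; case: eqP => //= ne_n; rewrite orbF -leqNgt => le_n.
    rewrite /f big_seq big1 // => q /size_cuts /= sq; rewrite /Phi.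
    by case: eqP => //= _; case: eqP => //= E'; move: ne_n; rewrite -E'; lia.
rewrite lext_lext -[RHS]addr0 -[X in _ = _ + X]f0 -lext_add; apply: eq_lext => -[c x] /=.
rewrite /top /=; case: eqP => [sx|_] /=; last by rewrite addr0 linear0.
case: (eqVneq (wt c) M.+1) => [wc|wc]; last first.
  by rewrite linear0 /f big1 ?addr0 // => q _; rewrite /Phi /= (negPf wc).
rewrite (lext_ins_cuts charK c (x := x) sp) ?sx // exchange_big /=.
rewrite (sum_cuts_left (fun p r => \sum_(u <- cuts c) lext (phi (u.1 ++ p)) (ins K u.2 r))).
congr (_ + _); first by apply: eq_bigr => u _; rewrite cats0.
rewrite /f /= big_seq [RHS]big_seq; apply: eq_bigr => q qx; rewrite /Phi wc eqxx.
case: eqP => [_|_] /=; first by rewrite andbF.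
case: eqP => //= sq; rewrite big1 // => u _; apply: G0.
by have := size_cuts qx; rewrite sx; lia.
Qed.
End Phi.

(** Modulo right factors with fewer than n trees, the coproduct of [y] is the sum of u_1 (x) ins u_2
    x over the cuts of [c], by [comul_top]. The total cut gives the leading term c (x) x; all others
    have a left factor lighter than M + 1. *)
Lemma cobar_step : exists y', cocycle (z - comul_elt y') /\ bounded n M (z - comul_elt y').
Proof.
exists y; split; first by apply: cocycleB => //; apply: cocycle_comul.
move=> V phi sp pp bp.
have p0 p r : (size r < n)%N -> phi p r = 0.
  by move=> lt_n; apply: bp; rewrite negb_or -leqNgt (ltnW lt_n) /= ltn_eqF.
rewrite linearB /= lext_comul_elt comul_top //; apply/eqP; rewrite -lext_sub.
apply/eqP; rewrite -[RHS](bz (phi := fun c x => if top (c, x) then 0 else phi c x)).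
- apply: eq_lext => -[c x]; case: ifP => tk /=; last by rewrite subr0.
  move: tk => /andP[/eqP /= sx /eqP /= wc]; apply/eqP; rewrite subr_eq0; apply/eqP.
  rewrite -[LHS](lext_ins0 charK (sp.2 c)); last by rewrite -size_eq0 sx -lt0n.
  rewrite -[LHS](sum_cuts_right0 (fun p => lext (phi p) (ins K [::] x)) c).
  rewrite big_seq [RHS]big_seq; apply: eq_bigr => u /(wt_cuts deg) wu.
  case: eqP => [->|/eqP u2] //; rewrite lext_ins_size // => w sw; apply: bp.
  rewrite sw sx ltnn eqxx /= -leqNgt -ltnS -wc -wu -[X in (X < _)%N]addn0.
  by rewrite ltn_add2l lt0n wt_eq0.
- split=> [x v w vw|c v w vw] /=; rewrite /top /=.
    by rewrite (wt_perm _ vw); case: ifP => // _; apply: sp.1.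
  by rewrite (perm_size vw); case: ifP => // _; apply: sp.2.
- by move=> c x cx; case: ifP => // _; apply: pp.
- move=> c x nb; case: ifP => // tk; apply: bp; apply: contra nb.
  case/orP => [->//|/andP[sx Mw]]; rewrite sx /= [(M.+1 < _)%N]ltn_neqAle Mw andbT orbC.
  by move: tk; rewrite /top /= sx /= eq_sym => ->.
Qed.
End Step.

Theorem cocycle_cobounds z : cocycle z -> exists y, cobounds y z.
Proof.
suff P n M z' : cocycle z' -> bounded n M z' -> exists y, cobounds y z'.
  move=> cz; pose n := (\max_(k <- msupp z) size k.2)%N.
  pose M := (\max_(k <- msupp z) wt k.1)%N.
  apply: (P n M) => // V phi _ _ bp; apply: lext_zero => k kz; apply: bp.
  rewrite negb_or negb_and -!leqNgt.
  rewrite (leq_bigmax_seq (F := fun k : F * F => size k.2) k) //=.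
  by rewrite (leq_bigmax_seq (F := fun k : F * F => wt k.1) k) // orbT.
elim: n M z' => [|n IHn] M z'.
  move=> _ bz; exists 0 => V phi sp pp; rewrite linear0; apply/esym/bz => //.
  by move=> p [|t r] // _; apply: pp; right.
elim: M z' => [|M IHM] z' cz bz.
  (* A left factor of weight 0 is empty, hence invisible to [phi]: no component with n + 1 trees on
     the right is left. The new weight bound is read off the support. *)
  apply: (IHn (\max_(k <- msupp z') wt k.1)%N) => // V phi sp pp bp.
  rewrite -[RHS](bz _ (fun c x => if (n < size x)%N then phi c x else 0)).
  - apply: eq_lext_supp => k kz /=; case: ltnP => // le_n; apply: bp.
    rewrite negb_or -leqNgt le_n /= negb_and -leqNgt.
    by rewrite (leq_bigmax_seq (F := fun k : F * F => wt k.1) k) // orbT.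
  - split=> [x v w vw|c v w vw] /=; last rewrite (perm_size vw).
      by case: ifP => // _; apply: sp.1.
    by case: ifP => // _; apply: sp.2.
  - by move=> c x cx; case: ifP => // _; apply: pp.
  - move=> c x nb; case: ltnP => // lt_n; apply: pp; left; apply/eqP.
    by rewrite -(wt_eq0 deg_gt0); move: nb; lia.
have [//|y [cz' bz']] := cobar_step _ cz bz.
have [y' cy'] := IHM _ cz' bz'; exists (y' + y) => V phi sp pp.
by rewrite linearD /= cy' // linearB /= lext_comul_elt subrK.
Qed.

End Cobar.

(** * Primitive elements *)

(** For each tree, the empty and the total cut give back one tree; any other cut creates additional
    trees, and [phi] vanishes on the result. So each tree contributes a factor 2; [e] holds the
    trees already treated in the induction. *)
Lemma sum_cuts_pow2 (D : choiceType) (V : nmodType) (phi : forest D -> V)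
    (w e : forest D) : sym phi ->
  (forall v, (size w + size e < size v)%N -> phi v = 0) ->
  \sum_(q <- cuts w) phi (q.1 ++ q.2 ++ e) = phi (w ++ e) *+ 2 ^ size w.
Proof.
move=> sp; elim: w e => [|[d h] w IH] e p0; first by rewrite big_seq1.
rewrite (sum_cuts_cons _ _ (fun p r => phi (p ++ r ++ e))).
transitivity (\sum_(a <- cutT (Node d h)) phi (w ++ (a.1 ++ a.2 ++ e)) *+ 2 ^ size w).
  apply: eq_big_seq => a at_; rewrite -IH => [|v sv].
    apply: eq_bigr => b _; apply: sp; apply/permP => f.
    by rewrite !count_cat; lia.
  apply: p0; apply: leq_ltn_trans sv; rewrite !size_cat /=.
  move: at_ => /=; rewrite inE => /predU1P[-> /=|/mapP[q _ -> /=]]; lia.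
rewrite sumrMnl (sum_cutT d h (fun p r => phi (w ++ p ++ r ++ e))).
rewrite (sum_cuts_left (fun p r => phi (w ++ p ++ [:: Node d r] ++ e))) /=.
rewrite [X in _ + (_ + X)]big1 => [|q _]; last first.
  case: eqP => // /eqP q0; apply: p0; rewrite !size_cat /=.
  by move: q0; rewrite -size_eq0 -lt0n; move: (size _) => k; lia.
rewrite addr0 expnS mulnC mulrnA -mulr2n.
have P : perm_eq (w ++ Node d h :: e) ((Node d h :: w) ++ e).
  exact/permPl/(perm_catCA w [:: Node d h] e).
by rewrite -!mulrnA mulnC (sp _ _ P).
Qed.

Lemma mulrn_inj0 (K : fieldType) (charK : [pchar K] =i pred0) (V : lmodType K)
  (x : V) n : (0 < n)%N -> x *+ n = 0 -> x = 0.
Proof.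
case: n => // n _; rewrite -scaler_nat => /eqP; rewrite scaler_eq0.
by rewrite (negPf (natK_neq0 charK n)) => /eqP.
Qed.

Section Primitive.
Variables (K : fieldType) (charK : [pchar K] =i pred0) (D : choiceType).
Variables (deg : D -> nat) (deg_gt0 : forall d, (0 < deg d)%N).
Local Notation T := (ptree D).
Local Notation F := (forest D).
Local Notation wt := (wt deg).
Local Notation wtT := (wtT deg).
Implicit Types (p x y : {malg K[F]}) (t u : T).

(** The class of [x] in C is zero; likewise [prim] says that the reduced coproduct of this class
    vanishes. *)
Definition null x := forall (V : lmodType K) (phi : F -> V), sym phi -> lext phi x = 0.

Definition prim x := forall (V : lmodType K) (phi : F -> F -> V),
  sym2 phi -> pos2 phi -> lext (fun w => \sum_(q <- cuts w) phi q.1 q.2) x = 0.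

Definition homog m x := forall w, w \in msupp x -> wt w = m.

Definition et t (w : F) : K^o := (w == [:: t])%:R.

Lemma et_sym t : sym (et t).
Proof.
suff H (v w : F) : perm_eq v w -> v = [:: t] -> w = [:: t].
  move=> v w vw; rewrite /et; congr (nat_of_bool _)%:R.
  by apply/eqP/eqP; apply: H => //; rewrite perm_sym.
by move=> vw E; apply: perm_small_eq; rewrite ?E // perm_sym -E.
Qed.

Lemma lext_et t x : lext (et t) x = x@_([:: t] : F).
Proof. exact: lext_coef. Qed.

Lemma homog_coef m x t : homog m x -> wtT t != m -> lext (et t) x = 0.
Proof.
move=> hx; rewrite lext_et -(wt1 deg) => ne; apply: mcoeff_outdom.
by apply: contra ne => /hx ->.
Qed.

(* Psi^2 = mult \o Delta doubles a primitive element, and acts as 2^k on its *)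
(* component of maximal number k of trees. *)
Lemma prim_null m p : (0 < m)%N -> homog m p -> prim p ->
  (forall t, lext (et t) p = 0) -> null p.
Proof.
move=> m0 hp pp p0 V phi sp.
have [k] : exists k, forall w, w \in msupp p -> (k < size w)%N -> phi w = 0.
  exists (\max_(w <- msupp p) size w)%N => w wp.
  by rewrite ltnNge (leq_bigmax_seq (F := fun w : F => size w) w).
move=> bk; pose psi (w : F) := if (k < size w)%N then 0 else phi w.
rewrite (eq_lext_supp (g := psi)) => [|w wp]; last by rewrite /psi; case: ifP => // /bk ->.
have: sym psi by move=> v w vw; rewrite /psi (perm_size vw); case: ifP => // _; apply: sp.
have: forall w, (k < size w)%N -> psi w = 0 by move=> w; rewrite /psi => ->.
move: psi; clear phi sp bk; elim: k => [|k IH] phi bk sp.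
  apply: lext_zero => -[|t w] wp; last exact: bk.
  by move: m0; rewrite -(hp _ wp).
have [k0|k0] := posnP k.
  apply: lext_zero => -[|t [|u w]] wp; last by apply: bk; rewrite k0.
    by move: m0; rewrite -(hp _ wp).
  by move: (p0 t) wp; rewrite lext_et -mcoeff_neq0 => ->; rewrite eqxx.
pose X := lext phi p; pose S w := \sum_(q <- cuts w) phi (q.1 ++ q.2).
have S2 : sym2 (fun v w : F => phi (v ++ w)).
  by split=> [w|v] x y xy; apply: sp; rewrite ?perm_cat2l ?perm_cat2r.
have E1 : lext S p = X + X.
  pose phi0 (v w : F) := if (v == [::]) || (w == [::]) then 0 else phi (v ++ w).
  have e0 (v w : F) : perm_eq v w -> (v == [::]) = (w == [::]).
    by move=> vw; rewrite -!size_eq0 (perm_size vw).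
  transitivity (lext (fun w => phi w + phi w + \sum_(q <- cuts w) phi0 q.1 q.2) p).
    apply: eq_lext_supp => w wp; rewrite /S.
    have w0 : w != [::] by rewrite -(wt_eq0 deg_gt0) (hp _ wp) -lt0n.
    by rewrite (sum_cuts_ends (fun v w : F => phi (v ++ w))) // cats0.
  rewrite !lext_add pp ?addr0 //.
    split=> [w|v] x y xy; rewrite /phi0 (e0 _ _ xy).
      by case: ifP => // _; apply: S2.1.
    by case: ifP => // _; apply: S2.2.
  by move=> v w [->|->]; rewrite /phi0 ?eqxx ?orbT.
(* The top eigenvalue cancels, so this function vanishes beyond k trees and the induction applies.
   Together with [E1] this gives (2^(k+1) - 2) X = 0, with k > 0. *)
have : lext (fun w => S w - phi w *+ 2 ^ k.+1) p = 0.
  apply: IH => [w kw|v w vw].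
    have := @sum_cuts_pow2 D V phi w [::] sp; rewrite cats0 addn0.
    under eq_bigr => q _ do rewrite cats0.
    rewrite -/(S w) => -> => [|v wv]; last by apply: bk; apply: leq_ltn_trans wv.
    have [->|ne] := eqVneq k.+1 (size w); first by rewrite subrr.
    by rewrite bk ?mul0rn ?subr0 // ltn_neqAle ne.
  rewrite (sp _ _ vw); congr (_ - _).
  exact: (sym_cuts S2).
rewrite lext_sub E1 lextMn -mulr2n -/X => /eqP; rewrite subr_eq0.
have -> : (2 ^ k.+1 = 2 + (2 ^ k.+1 - 2))%N.
  by rewrite subnKC // -[X in (X <= _)%N]expn1 leq_exp2l.
rewrite mulrnDr -[Y in Y == _]addr0 (inj_eq (addrI _)) eq_sym => /eqP.
apply: (mulrn_inj0 charK); rewrite subn_gt0 -[X in (X < _)%N]expn1 ltn_exp2l //.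
Qed.


Lemma homogZ m a x : homog m x -> homog m (a *: x).
Proof. by move=> hx w /(fsubsetP (msuppZ_le _ _))/hx. Qed.

Lemma homogB m x y : homog m x -> homog m y -> homog m (x - y).
Proof. by move=> hx hy w /(fsubsetP (msuppB_le _ _)); rewrite inE => /orP[/hx|/hy]. Qed.

Lemma homog_sum m I (r : seq I) (f : I -> {malg K[F]}) :
  (forall i, homog m (f i)) -> homog m (\sum_(i <- r) f i).
Proof.
move=> hf; apply: big_ind => // [w|x y hx hy w]; first by rewrite msupp0.
by move=> /(fsubsetP (msuppD_le _ _)); rewrite inE => /orP[/hx|/hy].
Qed.

Lemma primZ a x : prim x -> prim (a *: x).
Proof. by move=> px V phi sp pp; rewrite linearZ_LR /= px // scaler0. Qed.

(** * Finiteness in each weight and dual families of trees *)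

Section Finiteness.
Hypothesis fin_deg : forall n, exists s : seq D, forall d, deg d = n -> d \in s.

(** A tree of weight at most m + 1 has a root of positive degree over a forest of weight at most m,
    and a forest of weight at most m + 1 has at most m + 1 trees. *)
Lemma finite_weight m : exists s : seq F, forall w, wt w = m -> w \in s.
Proof.
suff [s sP] : exists s : seq F, forall w, (wt w <= m)%N -> w \in s.
  by exists s => w wm; apply: sP; rewrite wm.
elim: m => [|m [s sP]].
  by exists [:: [::]] => w; rewrite leqn0 wt_eq0 // inE.
have [d dP] : exists d : seq D, forall x : D, (deg x <= m.+1)%N -> x \in d.
  elim: m.+1 => [|k [d dP]].
    by have [d dP] := fin_deg 0; exists d => x; rewrite leqn0 => /eqP/dP.
  have [d' dP'] := fin_deg k.+1; exists (d ++ d') => x.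
  by rewrite leq_eqVlt mem_cat => /predU1P[/dP' ->|/dP ->]; rewrite ?orbT.
pose tr := [seq Node a w | a <- d, w <- s].
have trP (t : T) : (wtT t <= m.+1)%N -> t \in tr.
  case: t => x w; rewrite wt_node => le_m; apply/allpairsP; exists (x, w); split=> //=.
    by apply: dP; lia.
  by apply: sP; have := deg_gt0 x; lia.
pose nxt (s' : seq F) : seq F := [::] :: [seq t :: w | t <- tr, w <- s'].
exists (iter m.+2 nxt [::]) => w wm.
have: (size w < m.+2)%N by apply: leq_ltn_trans (leq_size_wt deg_gt0 w) _.
elim: m.+2 w wm => // k IH [|t w]; rewrite ?inE // wt_cons => wm sw /=.
apply/allpairsP; exists (t, w); split=> //=.
  by apply: trP; lia.
by apply: IH; [lia|exact: sw].
Qed.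

Definition separates m (s : seq T) := forall p, homog m p -> prim p ->
  (forall t, t \in s -> lext (et t) p = 0) -> null p.

(* A minimal set of trees whose coefficients separate the primitive elements *)
(* of weight m has a dual family of primitive elements. *)
Lemma dual_trees m : (0 < m)%N -> exists s : seq T,
  [/\ forall t, t \in s -> wtT t = m, separates m s &
   forall t, t \in s -> exists p, [/\ homog m p, prim p &
     forall u, u \in s -> lext (et u) p = (u == t)%:R]].
Proof.
move=> m0; have [s0 s0P] := finite_weight m.
pose ok (s : seq T) := [/\ forall t, t \in s -> wtT t = m, separates m s & uniq s].
have [s] : exists s, ok s.
  exists (undup [seq t <- flatten s0 | wtT t == m]); split; last exact: undup_uniq.
    by move=> t; rewrite mem_undup mem_filter => /andP[/eqP].
  move=> p hp pp p0; apply: (prim_null m0) => // t.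
  have [tm|tm] := eqVneq (wtT t) m; last exact: homog_coef hp tm.
  apply: p0; rewrite mem_undup mem_filter tm eqxx /=.
  by apply/flattenP; exists [:: t]; rewrite ?inE ?eqxx // s0P // wt1.
have [n] := ubnP (size s); elim: n s => // n IH s sn oks.
have [[t [ts okt]]|H] := pselect (exists t, t \in s /\ ok (rem t s)).
  by apply: IH okt; rewrite size_rem //; case: (s) ts sn => //= ? ? _; lia.
have [swt sep us] := oks; exists s; split=> // t ts.
(* By minimality the other trees no longer separate: some primitive [p] that is not null has zero
   coefficients on them, so its coefficient on [t] is nonzero and can be normalised to 1. *)
have nsep : ~ separates m (rem t s).
  move=> sep'; apply: H; exists t; split=> //; split=> //; last exact: rem_uniq.
  by move=> u /mem_rem; apply: swt.
have [p [hp pp p0 np]] : exists p, [/\ homog m p, prim p,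
    forall u, u \in rem t s -> lext (et u) p = 0 & ~ null p].
  apply: contrapT => Hn; apply: nsep => p hp pp p0; apply: contrapT => np.
  by apply: Hn; exists p.
have c0 : lext (et t) p != 0 :> K.
  apply/eqP => c0; apply: np; apply: sep => // u us'.
  have [->//|ut] := eqVneq u t; apply: p0.
  by rewrite mem_rem_uniq // inE ut.
exists ((lext (et t) p : K)^-1 *: p); split; [exact: homogZ|exact: primZ|].
move=> u us'; rewrite linearZ_LR /=.
have [->|ut] := eqVneq u t; first exact: mulVf.
have ur : u \in rem t s by rewrite mem_rem_uniq // inE ut.
by rewrite (p0 _ ur) scaler0.
Qed.

End Finiteness.
End Primitive.

(** * The basis indexed by words *)

Section Splits.
Variable D : choiceType.
Local Notation F := (forest D).

(** Deconcatenations, the forest being read as a word whose letters are trees. *)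
Fixpoint splits (u : F) : seq (F * F) :=
  ([::], u) :: if u is x :: v then [seq (x :: q.1, q.2) | q <- splits v] else [::].

Lemma splits_cat u (q : F * F) : q \in splits u -> u = q.1 ++ q.2.
Proof.
elim: u q => [|x u IH] q /=; rewrite inE; first by move=> /eqP ->.
case/predU1P => [->//|].
by move=> /mapP[r /IH {1}-> ->].
Qed.

Section Sums.
Variable V : nmodType.
Implicit Type f : F -> F -> V.

Lemma sum_splits0 f : \sum_(q <- splits [::]) f q.1 q.2 = f [::] [::].
Proof. by rewrite big_seq1. Qed.

Lemma sum_splits_cons x u f : \sum_(q <- splits (x :: u)) f q.1 q.2 =
  f [::] (x :: u) + \sum_(q <- splits u) f (x :: q.1) q.2.
Proof. by rewrite big_cons big_map. Qed.

Lemma sum_splits_left0 u (g : F -> V) :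
  \sum_(q <- splits u) (if q.1 == [::] then g q.2 else 0) = g u.
Proof.
case: u => [|x u]; first by rewrite big_seq1.
by rewrite big_cons big_map big1 ?addr0.
Qed.

Lemma sum_splits_right0 u (g : F -> V) :
  \sum_(q <- splits u) (if q.2 == [::] then g q.1 else 0) = g u.
Proof.
elim: u g => [|x u IH] g; first by rewrite big_seq1.
by rewrite big_cons big_map add0r (IH (fun v => g (x :: v))).
Qed.

Lemma splits_coassoc u (phi : F -> F -> F -> V) :
  \sum_(q <- splits u) \sum_(r <- splits q.1) phi r.1 r.2 q.2 =
  \sum_(q <- splits u) \sum_(r <- splits q.2) phi q.1 r.1 r.2.
Proof.
elim: u phi => [|x u IH] phi; first by rewrite !big_seq1.
rewrite (sum_splits_cons _ _ (fun p r => \sum_(r' <- splits p) phi r'.1 r'.2 r)).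
rewrite (sum_splits_cons _ _ (fun p r => \sum_(r' <- splits r) phi p r'.1 r'.2)).
rewrite (sum_splits0 (fun p r => phi p r (x :: u))) (sum_splits_cons _ _ (phi [::])) -addrA; congr (_ + _).
rewrite -(IH (fun p => phi (x :: p))) -big_split; apply: eq_bigr => q _ /=.
by rewrite (sum_splits_cons _ _ (fun p r => phi p r q.2)).
Qed.

Lemma sum_splits_ends u f : u != [::] ->
  \sum_(q <- splits u) f q.1 q.2 = f [::] u + f u [::] +
  \sum_(q <- splits u | (q.1 != [::]) && (q.2 != [::])) f q.1 q.2.
Proof.
move=> u0; rewrite -(sum_splits_left0 u (f [::])) -(sum_splits_right0 u (f^~ [::])).
rewrite [X in _ + X]big_mkcond /= -!big_split.
rewrite big_seq [RHS]big_seq; apply: eq_bigr => -[p r] /splits_cat /= E.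
have [p0|p0] := eqVneq p [::]; have [r0|r0] := eqVneq r [::] => /=.
- by move: u0; rewrite E p0 r0.
- by rewrite p0 !addr0.
- by rewrite r0 add0r addr0.
- by rewrite !add0r.
Qed.

End Sums.
End Splits.

Section Family.
Variables (K : fieldType) (charK : [pchar K] =i pred0) (D : choiceType).
Variables (deg : D -> nat) (deg_gt0 : forall d, (0 < deg d)%N).
Hypothesis fin_deg : forall n, exists s : seq D, forall d, deg d = n -> d \in s.
Local Notation T := (ptree D).
Local Notation F := (forest D).
Local Notation H := {malg K[F]}.
Local Notation wt := (wt deg).
Local Notation wtT := (wtT deg).
Variables (inI : pred T) (pp : T -> H).
Hypothesis pp_homog : forall t, inI t -> homog deg (wtT t) (pp t).
Hypothesis pp_prim : forall t, inI t -> prim (pp t).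
Hypothesis pp_dual : forall t u, inI t -> inI u -> lext (et K u) (pp t) = (u == t)%:R.
Hypothesis inI_sep : forall m (x : H), (0 < m)%N -> homog deg m x -> prim x ->
  (forall t, inI t -> lext (et K t) x = 0) -> null x.

Lemma lext_scalel (X : choiceType) (V : lmodType K) (f : X -> K^o) (v : V) x :
  lext (fun k => (f k : K) *: v) x = (lext f x : K) *: v.
Proof.
rewrite !lext.unlock scaler_suml.
by apply: eq_bigr => k _; rewrite scalerA.
Qed.

Definition ev2 (V : lmodType K) (phi : F -> F -> V) (x y : H) : V :=
  lext (fun a => lext (phi a) y) x.

(* y completes c into a family of elements on which the coproduct is the *)
(* deconcatenation of words, normalised by its coefficients on the letters. *)
Definition spec (c : F -> H) (u : F) (y : H) : Prop :=
  [/\ homog deg (wt u) y,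
      forall (V : lmodType K) (phi : F -> F -> V), sym2 phi -> pos2 phi ->
        lext (fun w => \sum_(q <- cuts w) phi q.1 q.2) y =
        \sum_(q <- splits u | (q.1 != [::]) && (q.2 != [::])) ev2 phi (c q.1) (c q.2)
    & forall t, inI t -> lext (et K t) y = (u == [:: t])%:R].

Lemma size_splits u (q : F * F) : q \in splits u -> (size q.1 + size q.2)%N = size u.
Proof. by move=> /splits_cat ->; rewrite size_cat. Qed.

Lemma splits_proper u (q : F * F) :
  q \in splits u -> (q.1 != [::]) && (q.2 != [::]) ->
  (size q.1 < size u)%N && (size q.2 < size u)%N.
Proof.
move=> /size_splits <-; rewrite -!size_eq0.
by move: (size q.1) (size q.2) => a b; lia.
Qed.

Lemma spec_eq c c' u y :
  (forall v : F, (size v < size u)%N -> c v = c' v) -> spec c u y -> spec c' u y.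
Proof.
move=> E [h s e]; split; [exact: h| |exact: e] => V phi sp pp'.
rewrite (s _ _ sp pp') big_seq_cond [RHS]big_seq_cond.
apply: eq_bigr => q /andP[qu /(splits_proper qu)/andP[s1 s2]].
by rewrite (E _ s1) (E _ s2).
Qed.

Lemma splits_word u (q : F * F) : q \in splits u -> all inI u -> all inI q.1 /\ all inI q.2.
Proof. by move=> /splits_cat ->; rewrite all_cat => /andP. Qed.

Lemma spec_letter c t : inI t -> spec c [:: t] (pp t).
Proof.
move=> It; split=> [|V phi sp pp'|u Iu]; first by rewrite wt1; apply: pp_homog.
  rewrite big_mkcond /= !big_cons big_nil /= !addr0.
  exact: pp_prim.
by rewrite pp_dual // [in RHS]eqseq_cons andbT eq_sym.
Qed.

Section Extend.
Variables (c : F -> H) (u : F).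
Hypotheses (wu : all inI u) (su : (1 < size u)%N).
Hypothesis cP : forall v, v != [::] -> (size v < size u)%N -> all inI v -> spec c v (c v).

Let z : {malg K[(F * F)%type]} :=
  \sum_(q <- splits u | (q.1 != [::]) && (q.2 != [::]))
     ev2 (fun a b => << (a, b) >>) (c q.1) (c q.2).

Let lext_z (V : lmodType K) (phi : F -> F -> V) :
  lext (fun k => phi k.1 k.2) z =
  \sum_(q <- splits u | (q.1 != [::]) && (q.2 != [::])) ev2 phi (c q.1) (c q.2).
Proof.
rewrite raddf_sum; apply: eq_bigr => q _ /=; rewrite /ev2 lext_lext.
apply: eq_lext => a; rewrite lext_lext; apply: eq_lext => b; exact: lextU.
Qed.

(** Applying the reduced coproduct to either factor gives the sum of c_a (x) c_b (x) c_d over the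
    factorisations u = abd into nonempty words. *)
Let cocycle_z : cocycle z.
Proof.
move=> V phi [s1 s2 s3] pos.
pose E (a b d : F) := if [|| a == [::], b == [::] | d == [::]] then 0 else
  lext (fun x => lext (fun y => lext (phi x y) (c d)) (c b)) (c a).
transitivity (\sum_(q <- splits u) \sum_(r <- splits q.1) E r.1 r.2 q.2).
  rewrite (lext_z (fun x y => \sum_(q <- cuts x) phi q.1 q.2 y)) big_mkcond /=.
  rewrite big_seq [RHS]big_seq; apply: eq_bigr => q qu.
  case: ifPn => [q0|]; last first.
    rewrite negb_and !negbK => /orP[/eqP ->|/eqP ->].
      by rewrite big_seq1 /E eqxx.
    by rewrite big1 // => r _; rewrite /E eqxx !orbT.
  have /andP[z1 z2] := splits_proper qu q0; case/andP: q0 => q10 q20.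
  have [w1 w2] := splits_word qu wu; have [_ D1 _] := cP q10 z1 w1.
  rewrite /ev2 lext_exch.
  under eq_lext => y.
    rewrite (D1 V (fun a b => phi a b y)); first over.
    - by split=> [r|p]; [apply: s1|apply: s2].
    - by move=> p r [->|->]; apply: pos; constructor.
  rewrite lext_sum big_mkcond; apply: eq_bigr => r _.
  rewrite /E (negPf q20) orbF -negb_or; case: (_ || _) => //=.
  rewrite /ev2 [LHS]lext_exch; apply: eq_lext => x.
  exact: lext_exch.
transitivity (\sum_(q <- splits u) \sum_(r <- splits q.2) E q.1 r.1 r.2).
  exact: splits_coassoc.
rewrite (lext_z (fun x y => \sum_(q <- cuts y) phi x q.1 q.2)) [RHS]big_mkcond /=.
rewrite big_seq [RHS]big_seq; apply: eq_bigr => q qu; apply/esym.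
case: ifPn => [q0|]; last first.
  rewrite negb_and !negbK => /orP[/eqP ->|/eqP ->].
    by rewrite big1 // => r _; rewrite /E eqxx.
  by rewrite big_seq1 /E !eqxx /= orbT.
have /andP[z1 z2] := splits_proper qu q0; case/andP: q0 => q10 q20.
have [w1 w2] := splits_word qu wu; have [_ D2 _] := cP q20 z2 w2.
rewrite /ev2; under eq_lext => x.
  rewrite (D2 V (phi x)); first over.
  - by split=> [r|p]; [apply: s2|apply: s3].
  - by move=> p r [->|->]; apply: pos; constructor.
rewrite lext_sum big_mkcond; apply: eq_bigr => r _.
by rewrite /E (negPf q10) -negb_or; case: (_ || _).
Qed.

Lemma spec_extend : exists y, spec c u y.
Proof.
have [y0 y0P] := cocycle_cobounds charK deg_gt0 cocycle_z.
(* Since [z] is homogeneous of weight m, keeping only the part of [y0] of weight m preserves its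
   reduced coproduct. *)
pose m := wt u; pose y1 : H := lext (fun w => if wt w == m then << w >> else 0) y0.
have y1h : homog deg m y1.
  rewrite /y1 lext.unlock; apply: homog_sum => w; apply: homogZ.
  case: ifP => [/eqP wm|_] v; last by rewrite msupp0.
  by move=> /(fsubsetP msuppU_le); rewrite inE => /eqP ->.
have lext_y1 (V : lmodType K) (f : F -> V) :
    lext f y1 = lext (fun w => if wt w == m then f w else 0) y0.
  rewrite lext_lext; apply: eq_lext => w; case: ifP => _; [exact: lextU|exact: linear0].
have y1D (V : lmodType K) (phi : F -> F -> V) : sym2 phi -> pos2 phi ->
    lext (fun w => \sum_(q <- cuts w) phi q.1 q.2) y1 =
    \sum_(q <- splits u | (q.1 != [::]) && (q.2 != [::])) ev2 phi (c q.1) (c q.2).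
  move=> sp pos; pose phi' p r := if (wt p + wt r == m)%N then phi p r else 0.
  rewrite lext_y1 (eq_lext (g := fun w => \sum_(q <- cuts w) phi' q.1 q.2)); last first.
    move=> w; rewrite big_seq [in RHS]big_seq /phi'; case: (eqVneq (wt w) m) => [wm|wm].
      by apply: eq_bigr => q /(wt_cuts deg) ->; rewrite wm eqxx.
    by rewrite big1 // => q /(wt_cuts deg) ->; rewrite (negPf wm).
  rewrite y0P; first 1 last.
  - split=> [r v w vw|p v w vw]; rewrite /phi' (wt_perm _ vw); case: ifP => // _.
      exact: sp.1.
    exact: sp.2.
  - by move=> p r pr; rewrite /phi'; case: ifP => // _; apply: pos.
  rewrite lext_z big_seq_cond [RHS]big_seq_cond; apply: eq_bigr => q /andP[qu q0].
  have /andP[z1 z2] := splits_proper qu q0; case/andP: q0 => q10 q20.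
  have [w1 w2] := splits_word qu wu.
  have [h1 _ _] := cP q10 z1 w1; have [h2 _ _] := cP q20 z2 w2.
  apply: eq_lext_supp => a /h1 wa; apply: eq_lext_supp => b /h2 wb.
  by rewrite /phi' wa wb -wt_cat -(splits_cat qu) eqxx.
have [s0 s0P] := finite_weight deg_gt0 fin_deg m.
pose s := undup [seq t <- flatten s0 | inI t && (wtT t == m)].
have sP t : (t \in s) = inI t && (wtT t == m).
  rewrite mem_undup mem_filter andbC; case: (inI t) => //=; rewrite ?andbF //.
  case: eqP => [tm|_]; rewrite ?andbF // andbT.
  by apply/flattenP; exists [:: t]; rewrite ?inE // s0P // wt1.
(* The [pp t] are primitive and dual to the letters: the correction clears the coefficients on
   letters without changing the reduced coproduct. *)
exists (y1 - \sum_(t <- s) (lext (et K t) y1 : K) *: pp t).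
have adj (V : lmodType K) (f : F -> V) :
    lext f (y1 - \sum_(t <- s) (lext (et K t) y1 : K) *: pp t) =
    lext f y1 - \sum_(t <- s) (lext (et K t) y1 : K) *: lext f (pp t).
  rewrite linearB raddf_sum; congr (_ - _); apply: eq_bigr => t _.
  exact: linearZ_LR.
split=> [|V phi sp pos|t It].
- apply: homogB => //; rewrite big_seq; elim/big_ind: _ => [|x y hx hy|t].
  + by move=> w; rewrite msupp0.
  + by move=> w /(fsubsetP (msuppD_le _ _)); rewrite inE => /orP[/hx|/hy].
  + by rewrite sP => /andP[It /eqP tm]; apply: homogZ; rewrite -/m -tm; apply: pp_homog.
- rewrite adj y1D // [X in _ - X]big1_seq ?subr0 // => t /andP[_].
  rewrite sP => /andP[It _].
  by rewrite pp_prim // scaler0.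
have -> : (u == [:: t]) = false by apply/eqP => E; move: su; rewrite E.
rewrite adj; have [tm|tm] := eqVneq (wtT t) m; last first.
  rewrite (homog_coef y1h tm) sub0r big_seq big1 ?oppr0 // => t'.
  rewrite sP => /andP[It' /eqP tm']; rewrite pp_dual //.
  by case: eqP => [E|]; [move: tm; rewrite E tm' eqxx|rewrite scaler0].
rewrite (bigD1_seq t) ?undup_uniq ?sP ?It ?tm //= pp_dual // eqxx.
rewrite big_seq_cond big1 => [|t' /andP[]]; last first.
  rewrite sP => /andP[It' _] ne; rewrite pp_dual // eq_sym (negPf ne); exact: scaler0.
by rewrite addr0 [_ *: _]mulr1 subrr.
Qed.

End Extend.
End Family.

(** * Functionals dual to words *)

Section Xi.
Variables (K : fieldType) (D : choiceType) (deg : D -> nat).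
Local Notation F := (forest D).
Local Notation wt := (wt deg).

(** The convolution product of the coefficient functionals [et t] along the letters of [v], starting
    from the counit. *)
Fixpoint xi (v w : F) : K^o :=
  if v is t :: v' then \sum_(q <- cuts w) (et K t q.1 * xi v' q.2 : K) else (w == [::])%:R.

Lemma xi_sym v : sym (xi v).
Proof.
elim: v => [|t v IH] w w' ww' /=.
  by rewrite -!size_eq0 (perm_size ww').
apply: (sym_cuts (phi := fun p r => (et K t p * xi v r : K)) _ ww').
by split=> [r p p' pp'|p r r' rr']; congr (_ * _); [apply: et_sym|apply: IH].
Qed.

Lemma xi_wt v w : wt w != wt v -> xi v w = 0.
Proof.
elim: v w => [|t v IH] w /=; first by case: w.
move=> ne; rewrite big_seq big1 // => q /(wt_cuts deg) wq; rewrite /et.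
case: eqP => [E|_]; last by rewrite mul0r.
rewrite IH ?mulr0 //; apply: contra ne => /eqP wv.
by rewrite -wq E wt1 wv wt_cons.
Qed.

Lemma xi_cat u v w : xi (u ++ v) w = \sum_(q <- cuts w) (xi u q.1 * xi v q.2 : K).
Proof.
elim: u w => [|t u IH] w /=.
  rewrite -[LHS](sum_cuts_left0 (xi v)); apply: eq_bigr => q _.
  by case: eqP => _; rewrite ?mul1r ?mul0r.
transitivity (\sum_(q <- cuts w) \sum_(r <- cuts q.2) (et K t q.1 * (xi u r.1 * xi v r.2) : K)).
  by apply: eq_bigr => q _; rewrite IH mulr_sumr.
rewrite -(cuts_coassoc w (fun a b c => (et K t a * (xi u b * xi v c) : K))).
apply: eq_bigr => q _; rewrite mulr_suml; apply: eq_bigr => r _; exact: mulrA.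
Qed.

Lemma xi1 t w : xi [:: t] w = et K t w.
Proof.
rewrite /= -[RHS](sum_cuts_right0 (et K t)); apply: eq_bigr => q _.
by case: eqP => _; rewrite ?mulr1 ?mulr0.
Qed.

End Xi.

(** * The family (c_u) and its expansion property *)

Section WordFamily.
Variables (K : fieldType) (charK : [pchar K] =i pred0) (D : choiceType).
Variables (deg : D -> nat) (deg_gt0 : forall d, (0 < deg d)%N).
Hypothesis fin_deg : forall n, exists s : seq D, forall d, deg d = n -> d \in s.
Local Notation T := (ptree D).
Local Notation F := (forest D).
Local Notation H := {malg K[F]}.
Local Notation wt := (wt deg).
Local Notation wtT := (wtT deg).
Variables (inI : pred T) (pp : T -> H).
Hypothesis pp_homog : forall t, inI t -> homog deg (wtT t) (pp t).
Hypothesis pp_prim : forall t, inI t -> prim (pp t).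
Hypothesis pp_dual : forall t u, inI t -> inI u -> lext (et K u) (pp t) = (u == t)%:R.
Hypothesis inI_sep : forall m (x : H), (0 < m)%N -> homog deg m x -> prim x ->
  (forall t, inI t -> lext (et K t) x = 0) -> null x.
Local Notation spec := (spec deg inI).

(** Built length by length: stage m + 1 keeps the words of length at most m and chooses a completion
    on those of length m + 1. The default 0 is taken when no completion exists. *)
Fixpoint cfam n (u : F) : H :=
  if n is m.+1 then
    if (size u <= m)%N then cfam m u else xget 0 [set y | spec (cfam m) u y]
  else << [::] >>.

Definition cw (u : F) : H := cfam (size u) u.

Lemma cfam_cw n u : (size u <= n)%N -> cfam n u = cw u.
Proof.
elim: n u => [|n IH] u; first by rewrite leqn0 size_eq0 => /eqP ->.
rewrite leq_eqVlt => /predU1P[E|lt_n]; first by rewrite /cw E.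
by rewrite /= -ltnS lt_n IH.
Qed.

Lemma cw0 : cw [::] = << [::] >>. Proof. by []. Qed.

Lemma cw_spec u : u != [::] -> all inI u -> spec cw u (cw u).
Proof.
have [n] := ubnP (size u); elim: n u => // n IH u le_n u0 wu.
have su : size u = (size u).-1.+1 by rewrite prednK // lt0n size_eq0.
have famE v : (size v < size u)%N -> cfam (size u).-1 v = cw v.
  by move=> sv; rewrite cfam_cw // -ltnS -su.
apply: (spec_eq famE).
have -> : cw u = xget 0 [set y | spec (cfam (size u).-1) u y].
  by rewrite /cw {1}su /= ifN // -ltnNge [X in (_ < X)%N]su.
suff [y yP] : exists y, spec (cfam (size u).-1) u y.
  exact: (@xgetPex _ 0 [set y | spec (cfam (size u).-1) u y] (ex_intro _ y yP)).
case: (ltngtP (size u) 1%N) => [||u1].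
- by rewrite ltnS leqn0 size_eq0 (negPf u0).
- move=> u1; apply: (spec_extend charK deg_gt0 fin_deg pp_homog) => // v v0 vu wv.
  rewrite famE //; apply: (@spec_eq _ _ _ _ cw) => [v' sv'|].
    by rewrite famE //; apply: ltn_trans vu.
  by apply: IH => //; apply: leq_trans vu _.
case: (u) u1 wu => [|t [|? ?]] //= _; rewrite andbT => It.
by exists (pp t); apply: spec_letter.
Qed.

Lemma cw_homog u : all inI u -> homog deg (wt u) (cw u).
Proof.
have [->|u0] := eqVneq u [::]; last by move=> wu; case: (cw_spec u0 wu).
by move=> _ w /(fsubsetP msuppU_le); rewrite inE => /eqP ->.
Qed.

Lemma cw_et u t : all inI u -> inI t -> lext (et K t) (cw u) = (u == [:: t])%:R.
Proof.
have [->|u0] := eqVneq u [::]; last by move=> wu; case: (cw_spec u0 wu) => _ _; apply.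
by move=> _ _; rewrite lextU.
Qed.

Lemma cw_cuts (V : lmodType K) (phi : F -> F -> V) u : sym2 phi -> all inI u ->
  lext (fun w => \sum_(q <- cuts w) phi q.1 q.2) (cw u) =
  \sum_(q <- splits u) ev2 phi (cw q.1) (cw q.2).
Proof.
move=> sp wu; have [->|u0] := eqVneq u [::].
  by rewrite cw0 lextU !big_seq1 /ev2 cw0 !lextU.
pose phi0 (v w : F) := if (v == [::]) || (w == [::]) then 0 else phi v w.
have e0 (v w : F) : perm_eq v w -> (v == [::]) = (w == [::]).
  by move=> vw; rewrite -!size_eq0 (perm_size vw).
have n0 (v w : F) : all inI v -> v != [::] -> w \in msupp (cw v) -> w != [::].
  move=> wv v0 /(cw_homog wv) E; rewrite -(wt_eq0 deg_gt0) E.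
  by rewrite (wt_eq0 deg_gt0).
rewrite (sum_splits_ends (fun p r => ev2 phi (cw p) (cw r)) u0).
have [_ sD _] := cw_spec u0 wu.
transitivity (lext (fun w => phi [::] w + phi w [::] + \sum_(q <- cuts w) phi0 q.1 q.2) (cw u)).
  by apply: eq_lext_supp => w /(n0 _ _ wu u0) w0; rewrite sum_cuts_ends.
rewrite !lext_add sD; first last.
- by move=> v w [->|->]; rewrite /phi0 ?eqxx ?orbT.
- split=> [r v w vw|p v w vw]; rewrite /phi0 (e0 _ _ vw); case: ifP => // _.
    exact: sp.1.
  exact: sp.2.
congr (_ + _ + _).
- by rewrite cw0 /ev2 lextU.
- by rewrite cw0 /ev2; apply: eq_lext => w; rewrite lextU.
rewrite big_seq_cond [RHS]big_seq_cond; apply: eq_bigr => q /andP[qu /andP[q1 q2]].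
have [w1 w2] := splits_word qu wu.
apply: eq_lext_supp => a /(n0 _ _ w1 q1) a0; apply: eq_lext_supp => b /(n0 _ _ w2 q2) b0.
by rewrite /phi0 (negPf a0) (negPf b0).
Qed.

Lemma ev2_mul (f g : F -> K^o) x y :
  ev2 (fun p r => (f p * g r : K^o)) x y = (lext f x * lext g y : K).
Proof.
rewrite /ev2 -[RHS](lext_scalel f (lext g y)); apply: eq_lext => a.
exact: lext_scale.
Qed.

(** The coproduct of c_u is deconcatenation and [et t] sees only the word with single letter [t], so
    evaluating [xi] strips equal first letters one by one. *)
Lemma xi_cw u v : all inI u -> all inI v -> lext (xi K v) (cw u) = (u == v)%:R.
Proof.
elim: v u => [|t v IH] u wu /= => [_|/andP[It wv]].
  have [->|u0] := eqVneq u [::]; first by rewrite cw0 lextU eqxx.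
  apply: lext_zero => w /(cw_homog wu) E /=.
  by rewrite -(wt_eq0 deg_gt0) E (wt_eq0 deg_gt0) (negPf u0).
rewrite (cw_cuts (phi := fun p r => (et K t p * xi K v r : K^o))) //; last first.
  by split=> [r p p' pp'|p r r' rr']; congr (_ * _); [apply: et_sym|apply: xi_sym].
transitivity (\sum_(q <- splits u) ((q.1 == [:: t])%:R * (q.2 == v)%:R : K)).
  rewrite big_seq [RHS]big_seq; apply: eq_bigr => q qu.
  by have [w1 w2] := splits_word qu wu; rewrite ev2_mul cw_et // IH.
case: u {wu} => [|x u].
  by rewrite big_seq1 mul0r.
rewrite (sum_splits_cons x u (fun p r => ((p == [:: t])%:R * (r == v)%:R : K))) mul0r add0r.
rewrite eqseq_cons -mulnb natrM.
rewrite -[RHS](sum_splits_left0 u (fun r => (x == t)%:R * (r == v)%:R)).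
apply: eq_bigr => q _; rewrite eqseq_cons; case: (q.1 == [::]) => /=.
  by rewrite andbT.
by rewrite andbF mul0r.
Qed.

Definition words m : seq F :=
  undup [seq w <- xget [::] [set s | forall w, wt w = m -> w \in s]
        | all inI w & wt w == m].

Lemma mem_words m w : (w \in words m) = all inI w && (wt w == m).
Proof.
have [s sP] := finite_weight deg_gt0 fin_deg m.
have := @xgetPex _ [::] [set s : seq F | forall w, wt w = m -> w \in s] (ex_intro _ s sP).
rewrite /= => xP; rewrite mem_undup mem_filter andbC.
by case: eqP => [E|_]; rewrite ?andbF // !andbT xP.
Qed.

Lemma words_uniq m : uniq (words m). Proof. exact: undup_uniq. Qed.

Let sep m := forall x, homog deg m x ->
  (forall u, all inI u -> wt u = m -> lext (xi K u) x = 0) -> null x.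

(** The difference between [w] and its expansion is homogeneous and killed by all the [xi], so [sep]
    makes it null. *)
Let expand_of_sep (V : lmodType K) (phi : F -> V) w : sep (wt w) -> sym phi ->
  phi w = \sum_(u <- words (wt w)) (xi K u w : K) *: lext phi (cw u).
Proof.
move=> s sp; pose x : H := << w >> - \sum_(u <- words (wt w)) (xi K u w : K) *: cw u.
have lext_x (W : lmodType K) (f : F -> W) :
    lext f x = f w - \sum_(u <- words (wt w)) (xi K u w : K) *: lext f (cw u).
  rewrite linearB /= lextU raddf_sum; congr (_ - _); apply: eq_bigr => u _.
  exact: linearZ_LR.
apply/eqP; rewrite -subr_eq0 -lext_x; apply/eqP; apply: s sp => [|v wv wtv].
  apply: homogB => [v /(fsubsetP msuppU_le)|]; first by rewrite inE => /eqP ->.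
  rewrite big_seq; elim/big_ind: _ => [v|y z hy hz v|u].
  - by rewrite msupp0.
  - by move=> /(fsubsetP (msuppD_le _ _)); rewrite inE => /orP[/hy|/hz].
  - by rewrite mem_words => /andP[wu /eqP <-]; apply/homogZ/cw_homog.
rewrite lext_x (bigD1_seq v) ?words_uniq ?mem_words ?wv ?wtv ?eqxx //= xi_cw // eqxx.
rewrite big_seq_cond big1 => [|u /andP[]]; last first.
  by rewrite mem_words => /andP[wu _] ne; rewrite xi_cw // (negPf ne); exact: scaler0.
by rewrite addr0 [_ *: _]mulr1 subrr.
Qed.

(** Since [xi] on one letter is [et], it suffices that [x] be primitive. The factors of its reduced
    coproduct have smaller weight, hence expand in (c_u) by induction, and the coefficient at c_u
    (x) c_v is [xi] of the word uv at [x], which is zero. *)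
Lemma xi_separates m x : homog deg m x ->
  (forall u, all inI u -> wt u = m -> lext (xi K u) x = 0) -> null x.
Proof.
have [n] := ubnP m; elim: n m x => // n IH m x lt_m hx x0.
have [m0|m0] := posnP m.
  move=> V phi sp; rewrite (eq_lext_supp (g := fun w => (xi K [::] w : K) *: phi [::])).
    by rewrite lext_scalel x0 ?scale0r // m0.
  move=> w /hx; rewrite m0 => /eqP; rewrite (wt_eq0 deg_gt0) => /eqP ->.
  by rewrite /= scale1r.
apply: (inI_sep m0 hx) => [|t It]; last first.
  have [tm|tm] := eqVneq (wtT t) m; last exact: homog_coef hx tm.
  rewrite (eq_lext (g := xi K [:: t])) => [|w]; last by rewrite xi1.
  by apply: x0; rewrite ?wt1 //= It.
move=> V phi sp pos.
pose E u v := ev2 phi (cw u) (cw v).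
have phiE (q : F * F) : (wt q.1 + wt q.2 = m)%N -> phi q.1 q.2 =
    \sum_(j < m.+1) \sum_(u <- words j) \sum_(v <- words (m - j)%N)
      (xi K u q.1 * xi K v q.2 : K) *: E u v.
  move=> wq; have [q1|q1] := eqVneq q.1 [::].
    rewrite (pos _ _ (or_introl q1)) big1 // => j _; rewrite big1 // => u _.
    rewrite big1 // => v _; rewrite q1.
    have [->|u0] := eqVneq u [::]; last first.
      by rewrite (@xi_wt _ _ deg) ?mul0r ?scale0r // eq_sym (wt_eq0 deg_gt0).
    rewrite /E /ev2 cw0 lextU (eq_lext (g := fun=> 0)) => [|w]; last by rewrite pos //; left.
    by rewrite lext_zero ?scaler0.
  have [q2|q2] := eqVneq q.2 [::].
    rewrite (pos _ _ (or_intror q2)) big1 // => j _; rewrite big1 // => u _.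
    rewrite big1 // => v _; rewrite q2.
    have [->|v0] := eqVneq v [::]; last first.
      by rewrite [xi K v _](@xi_wt _ _ deg) ?mulr0 ?scale0r // eq_sym (wt_eq0 deg_gt0).
    rewrite /E /ev2 cw0 lext_zero ?scaler0 // => w _.
    by rewrite lextU pos //; right.
  have w1 : (0 < wt q.1)%N by rewrite lt0n (wt_eq0 deg_gt0).
  have w2 : (0 < wt q.2)%N by rewrite lt0n (wt_eq0 deg_gt0).
  have lt1 : (wt q.1 < m.+1)%N by lia.
  have E2 : (m - Ordinal lt1 = wt q.2)%N by rewrite /= -wq addKn.
  rewrite (bigD1 (Ordinal lt1)) // E2 /= [X in _ + X]big1 ?addr0; last first.
    move=> j; rewrite -val_eqE /= => jm; rewrite big_seq big1 // => u.
    rewrite mem_words => /andP[_ /eqP wu]; rewrite big1 // => v _.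
    by rewrite (@xi_wt _ _ deg) ?mul0r ?scale0r // wu eq_sym.
  rewrite (expand_of_sep (phi := phi^~ q.2) (w := q.1)); last exact: sp.1.
    apply: eq_bigr => u _; rewrite /E /ev2 -lext_scale.
    transitivity (lext (fun a => \sum_(v <- words (wt q.2))
        (xi K v q.2 : K) *: ((xi K u q.1 : K) *: lext (phi a) (cw v))) (cw u)).
      apply: eq_lext => a; rewrite (expand_of_sep (phi := phi a) (w := q.2)).
      - by rewrite scaler_sumr; apply: eq_bigr => v _; rewrite !scalerA mulrC.
      - by move=> y; apply: IH; lia.
      - exact: sp.2.
    rewrite lext_sum; apply: eq_bigr => v _.
    by rewrite -lext_scale; apply: eq_lext => a; rewrite scalerA mulrC.
  by move=> y; apply: IH; lia.
transitivity (lext (fun w => \sum_(j < m.+1) \sum_(u <- words j) \sum_(v <- words (m - j)%N)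
    (xi K (u ++ v) w : K) *: E u v) x).
  apply: eq_lext_supp => w /hx wm.
  rewrite big_seq (eq_bigr (fun q : F * F => \sum_(j < m.+1) \sum_(u <- words j)
     \sum_(v <- words (m - j)%N) (xi K u q.1 * xi K v q.2 : K) *: E u v)); last first.
    by move=> q /(wt_cuts deg) wq; apply: phiE; rewrite wq.
  rewrite -big_seq exchange_big; apply: eq_bigr => j _ /=.
  rewrite exchange_big; apply: eq_bigr => u _ /=.
  rewrite exchange_big; apply: eq_bigr => v _ /=.
  by rewrite -scaler_suml xi_cat.
rewrite lext_sum big1 // => j _; rewrite lext_sum big_seq big1 // => u.
rewrite mem_words => /andP[wu /eqP wtu]; rewrite lext_sum big_seq big1 // => v.
rewrite mem_words => /andP[wv /eqP wtv]; rewrite lext_scalel x0 ?scale0r //.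
  by rewrite all_cat wu.
by rewrite wt_cat wtu wtv subnKC // -ltnS.
Qed.

Theorem expand (V : lmodType K) (phi : F -> V) w : sym phi ->
  phi w = \sum_(u <- words (wt w)) (xi K u w : K) *: lext phi (cw u).
Proof. by apply: expand_of_sep => x; apply: xi_separates. Qed.

End WordFamily.

(** * Cofreeness of the abelianised Hopf algebra *)

(* Words in the letters are encoded as forests, all of whose trees are *)
(* letters; welt u is the basis element of the abelianised Hopf algebra *)
(* corresponding to the word u, and xi K u its dual functional. *)
Record word_basis (K : fieldType) (D : choiceType) (deg : D -> nat) := WordBasis {
  letter : pred (ptree D);
  welt : forest D -> {malg K[forest D]};
  wlist : nat -> seq (forest D);
  welt0 : welt [::] = << [::] >>;
  welt_homog : forall u, all letter u -> homog deg (wt deg u) (welt u);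
  welt_cuts : forall (V : lmodType K) (phi : forest D -> forest D -> V) u,
    sym2 phi -> all letter u ->
    lext (fun w => \sum_(q <- cuts w) phi q.1 q.2) (welt u) =
    \sum_(q <- splits u) ev2 phi (welt q.1) (welt q.2);
  xi_welt : forall u v, all letter u -> all letter v ->
    lext (xi K v) (welt u) = (u == v)%:R;
  mem_wlist : forall m w, (w \in wlist m) = all letter w && (wt deg w == m);
  wlist_uniq : forall m, uniq (wlist m);
  welt_expand : forall (V : lmodType K) (phi : forest D -> V) w, sym phi ->
    phi w = \sum_(u <- wlist (wt deg w)) (xi K u w : K) *: lext phi (welt u)
}.

Lemma word_basis_exists (K : fieldType) (D : choiceType) (deg : D -> nat) :
  [pchar K] =i pred0 -> (forall d, (0 < deg d)%N) ->
  (forall n, exists s : seq D, forall d, deg d = n -> d \in s) ->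
  inhabited (word_basis K deg).
Proof.
move=> charK deg_gt0 fin_deg.
pose dual (m : nat) (s : seq (ptree D)) := (0 < m)%N ->
  [/\ forall t, t \in s -> wtT deg t = m, separates K deg m s &
   forall t, t \in s -> exists p : {malg K[forest D]}, [/\ homog deg m p, prim p &
     forall u, u \in s -> lext (et K u) p = (u == t)%:R]].
have [s sP] : {s : nat -> seq (ptree D) & forall m, dual m (s m)}.
  apply: choice => m; have [->|m0] := posnP m; first by exists [::].
  have [s H] := dual_trees charK deg_gt0 fin_deg m0.
  by exists s.
pose inI : pred (ptree D) := fun t => t \in s (wtT deg t).
have [pp ppP] : {pp : ptree D -> {malg K[forest D]} & forall t, inI t ->
    [/\ homog deg (wtT deg t) (pp t), prim (pp t) &
      forall u, u \in s (wtT deg t) -> lext (et K u) (pp t) = (u == t)%:R]}.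
  apply: (@choice _ _ (fun t p => inI t -> [/\ homog deg (wtT deg t) p, prim p & forall u,
     u \in s (wtT deg t) -> lext (et K u) p = (u == t)%:R])) => t.
  have [It|nI] := boolP (inI t); last by exists 0.
  by have [_ _ H] := sP _ (wtT_gt0 deg_gt0 t); have [p pP] := H t It; exists p.
have h1 t : inI t -> homog deg (wtT deg t) (pp t) by move=> /ppP[].
have h2 t : inI t -> prim (pp t) by move=> /ppP[].
have h3 t u : inI t -> inI u -> lext (et K u) (pp t) = (u == t)%:R.
  move=> It Iu; have [_ _ H] := ppP t It.
  have [E|ne] := eqVneq (wtT deg u) (wtT deg t); first by apply: H; rewrite -E.
  rewrite (homog_coef (h1 t It) ne); case: eqP => // E.
  by move: ne; rewrite E eqxx.
have h4 m (x : {malg K[forest D]}) : (0 < m)%N -> homog deg m x -> prim x ->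
    (forall t, inI t -> lext (et K t) x = 0) -> null x.
  move=> m0 hx px x0; have [wts sep _] := sP m m0.
  by apply: sep => // t ts; apply: x0; rewrite /inI (wts t ts).
refine (inhabits (@WordBasis K D deg inI (@cw K D deg inI) (words deg inI) _ _ _ _ _ _ _)).
- exact: cw0.
- exact: (cw_homog charK deg_gt0 fin_deg h1 h2 h3).
- exact: (cw_cuts charK deg_gt0 fin_deg h1 h2 h3).
- exact: (xi_cw charK deg_gt0 fin_deg h1 h2 h3).
- exact: (mem_words deg_gt0 fin_deg).
- exact: words_uniq.
- exact: (expand charK deg_gt0 fin_deg h1 h2 h3 h4).
Qed.

Lemma splits_take_drop (D : choiceType) (V : nmodType) (f : forest D -> forest D -> V)
  (u : forest D) : \sum_(q <- splits u) f q.1 q.2 =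
  \sum_(i < (size u).+1) f (take i u) (drop i u).
Proof.
elim: u f => [|x u IH] f; first by rewrite big_seq1 big_ord_recl big_ord0 addr0.
by rewrite sum_splits_cons big_ord_recl /= (IH (fun p => f (x :: p))).
Qed.

Lemma span_comm (K : fieldType) (A : algType K) (W : lmodType K) (f : {linear A -> W})
    (S : A -> Prop) :
  (forall Q : A -> Prop, Q 0 -> (forall x y, Q x -> Q y -> Q (x + y)) ->
     (forall a x, Q x -> Q (a *: x)) -> (forall x, S x -> Q x) -> forall x, Q x) ->
  (forall a x y b, S a -> S x -> S y -> S b -> f (a * x * y * b) = f (a * y * x * b)) ->
  forall a x y b, f (a * x * y * b) = f (a * y * x * b).
Proof.
move=> ind fS a x y b.
elim/ind: a => [|u v IHu IHv|c u IH|a fa]; first by rewrite !mul0r.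
- by rewrite !mulrDl !linearD /= IHu IHv.
- by rewrite -!scalerAl !linearZ_LR /= IH.
elim/ind: x => [|u v IHu IHv|c u IH|x fx]; first by rewrite mulr0 !mul0r mulr0 mul0r.
- by rewrite !(mulrDr, mulrDl) !linearD /= IHu IHv.
- by rewrite -!(scalerAr, scalerAl) !linearZ_LR /= IH.
elim/ind: y => [|u v IHu IHv|c u IH|y fy]; first by rewrite !mulr0 !mul0r.
- by rewrite !(mulrDr, mulrDl) !linearD /= IHu IHv.
- by rewrite -!(scalerAr, scalerAl) !linearZ_LR /= IH.
elim/ind: b => [|u v IHu IHv|c u IH|b fb]; first by rewrite !mulr0.
- by rewrite !mulrDr !linearD /= IHu IHv.
- by rewrite -!scalerAr !linearZ_LR /= IH.
exact: fS.
Qed.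

Section Abelian.
Variables (K : fieldType) (D : choiceType).
Local Notation F := (forest D).
Local Notation A := (HPR K D).

(** This is the universal reordering-invariant function: every other one factors linearly through
    it, by [ablift]. *)
Lemma abpi_sym : sym (fun w : F => abpi (<< w >> : A)).
Proof.
apply: symP => s1 s2 s3.
have E (x y z : F) : (<< (x ++ y ++ z : F) >> : A) = 1 * << x >> * << y >> * << z >>.
  by rewrite mul1r !HPR_mulU; congr << _ >>; apply: catA.
by rewrite !E; apply: abpi_comm.
Qed.

Lemma lext_abpi (x : A) : lext (fun w : F => abpi (<< w >> : A)) x = abpi x.
Proof. by apply: (malg_linear_eq (f := lext _) (g := @abpi K A)) => w; rewrite /= lextU. Qed.

Section SymLift.
Variables (W : lmodType K) (psi : F -> W).
Hypothesis sp : sym psi.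

Definition symext : A -> W := lext psi.
HB.instance Definition _ := GRing.Linear.on symext.

Lemma symext_comm (a x y b : A) : symext (a * x * y * b) = symext (a * y * x * b).
Proof.
apply: (span_comm (f := symext) (S := fun x => exists w : F, x = << w >>)).
  by move=> Q Q0 QD QZ QU; apply: HPR_ind => // w; apply: QU; exists w.
move=> _ _ _ _ [s ->] [s1 ->] [s2 ->] [s3 ->].
rewrite !HPR_mulU; apply: etrans (lextU _ _) (etrans _ (esym (lextU _ _))); apply: sp.
by apply/permP => f; rewrite !count_cat; lia.
Qed.

Fact symext_rel (x : A) : comm_rel x -> symext x = 0.
Proof.
case=> a u v b; rewrite mulrBr mulrBl !mulrA.
have -> (x' y' : A) : symext (x' - y') = symext x' - symext y' by exact: linearB.
by apply/eqP; rewrite subr_eq0; apply/eqP; apply: symext_comm.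
Qed.

Definition ablift : HPRab K D -> W := qlift symext_rel.
HB.instance Definition _ := GRing.Linear.on ablift.

Lemma abliftE (x : A) : ablift (abpi x) = lext psi x.
Proof. exact: qliftE. Qed.
End SymLift.

Lemma comulPR_cuts (w : F) :
  comulPR (<< w >> : A) = \sum_(q <- cuts w) tens (<< q.1 >> : A) (<< q.2 >> : A).
Proof.
rewrite comulPR_forest.
elim/forest_ind: w => [|d h w IHh IHw]; first by rewrite big_seq1.
have mulE (a b : F * F) : tmul (tens (<< a.1 >> : A) (<< a.2 >> : A)) (tens (<< b.1 >> : A) << b.2 >>) =
    tens (<< (a.1 ++ b.1 : F) >> : A) << (a.2 ++ b.2 : F) >>.
  by rewrite tmulE !HPR_mulU.
have sumL (s : seq (F * F)) (f : F * F -> tensor A A) y :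
    tmul (\sum_(a <- s) f a) y = \sum_(a <- s) tmul (f a) y.
  by apply: (big_morph (fun x => tmul x y)) => [u v|]; rewrite ?tmulDl ?tmul0l.
have sumR (s : seq (F * F)) (f : F * F -> tensor A A) y :
    tmul y (\sum_(a <- s) f a) = \sum_(a <- s) tmul y (f a).
  by apply: (big_morph (fun x => tmul y x)) => [u v|]; rewrite ?tmulDr ?tmul0r.
rewrite (sum_cuts_cons _ _ (fun p r => tens (<< p >> : A) (<< r >> : A))).
have -> : comul_forest K (Node d h :: w) = tmul (comul_tree K (Node d h)) (comul_forest K w) by [].
rewrite IHw; have -> : comul_tree K (Node d h) =
    \sum_(a <- cutT (Node d h)) tens (<< a.1 >> : A) (<< a.2 >> : A).
  rewrite (sum_cutT d h (fun p r => tens (<< p >> : A) (<< r >> : A))) /=.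
  congr (_ + _); rewrite -/(comul_forest K h) IHh.
  set G := tmap _ _.
  have GD x y : G (x + y) = G x + G y by exact: linearD.
  have G0 : G 0 = 0 by apply: (addrI (G 0)); rewrite -GD !addr0.
  rewrite (big_morph G GD G0); apply: eq_bigr => q _.
  by rewrite /G tmapE /= /Bplus lextU.
rewrite sumL; apply: eq_bigr => a _; rewrite sumR; apply: eq_bigr => b _.
exact: mulE.
Qed.

End Abelian.

Lemma malg_ind (K : fieldType) (X : choiceType) (Q : {malg K[X]} -> Prop) :
  Q 0 -> (forall x y, Q x -> Q y -> Q (x + y)) ->
  (forall a x, Q x -> Q (a *: x)) -> (forall k, Q << k >>) -> forall x, Q x.
Proof.
move=> Q0 QD QZ QU x; rewrite [x]monalgE; elim/big_ind: _ => // k _.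
suff -> : << x@_k *g k >> = x@_k *: << k >> by apply: QZ.
by apply/malgP => j; rewrite mcoeffZ !mcoeffU mulr_natr.
Qed.

Lemma lext_tens (K : fieldType) (X Y : choiceType) (U W : lmodType K)
    (f : X -> U) (h : Y -> W) x y :
  tens (lext f x) (lext h y) = lext (fun k => lext (fun l => tens (f k) (h l)) y) x.
Proof.
have E (U' : lmodType K) (Z : choiceType) (f' : Z -> U') z :
  lext f' z = \sum_(k <- msupp z) z@_k *: f' k by rewrite lext.unlock.
rewrite (E _ _ f) [RHS]E.
rewrite (big_morph (fun u => tens u (lext h y)) (tensDl (lext h y)) (tens0l U (lext h y))).
apply: eq_bigr => k _; rewrite tensZl; congr (_ *: _).
exact: (lext_comp (tens (f k))).
Qed.

Section TensorBasis.
Variables (K : fieldType) (X : choiceType).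
Local Notation V := {malg K[X]}.

Lemma wordT_zero (W : lmodType K) (s t : seq W) : wordT (s ++ 0 :: t) = 0.
Proof.
have := wordT_linear s t 1 0 0; rewrite !scale1r addr0 => /eqP.
by rewrite -subr_eq0 opprD addrA subrr sub0r oppr_eq0 => /eqP.
Qed.

Lemma tensorT_span (Q : tensorT V -> Prop) :
  Q 0 -> (forall x y, Q x -> Q y -> Q (x + y)) -> (forall a x, Q x -> Q (a *: x)) ->
  (forall u : seq X, Q (wordT [seq << k >> | k <- u])) -> forall x, Q x.
Proof.
move=> Q0 QD QZ QU x; have [y ->] := qpi_ex x.
elim/malg_ind: y => [|y z Qy Qz|a y Qy|s].
- by rewrite linear0.
- by rewrite linearD; apply: QD.
- by rewrite linearZ_LR; apply: QZ.
rewrite -/(wordT s).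
(* [u] collects, on the left, the entries already expanded into basis vectors. *)
suff H (u : seq X) : Q (wordT ([seq << k >> | k <- u] ++ s)) by exact: (H [::]).
elim: s u => [|v s IH] u; first by rewrite cats0.
elim/malg_ind: v => [|v w Qv Qw|a v Qv|k].
- by rewrite wordT_zero.
- by rewrite -[v]scale1r wordT_linear scale1r; apply: QD.
- by rewrite -[a *: v]addr0 wordT_linear wordT_zero addr0; apply: QZ.
- by have := IH (rcons u k); rewrite map_rcons cat_rcons.
Qed.

Lemma tensorT_linear_eq (W : lmodType K) (h1 h2 : {linear tensorT V -> W}) :
  (forall u : seq X, h1 (wordT [seq << k >> | k <- u]) = h2 (wordT [seq << k >> | k <- u])) ->
  h1 =1 h2.
Proof.
move=> E; apply: tensorT_span => [|x y Ex Ey|a x Ex|//]; first by rewrite !linear0.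
  by rewrite !linearD /= Ex Ey.
by rewrite !linearZ_LR /= Ex.
Qed.

End TensorBasis.

Section Cofree.
Variables (K : fieldType) (D : choiceType) (deg : D -> nat).
Variable B : word_basis K deg.
Local Notation T := (ptree D).
Local Notation F := (forest D).
Local Notation A := (HPR K D).
Local Notation I := {t : T | letter B t}.
Local Notation V := {malg K[I]}.
Local Notation wt := (wt deg).

(** Words are lists of trees, whereas V has the subtype of letters as basis; the value 0 off the
    letters is a convention. *)
Definition vec (t : T) : V := if insub t is Some i then << (i : I) >> else 0.
Definition vword (u : F) : tensorT V := wordT (map vec u).

Let psi (w : F) : tensorT V :=
  \sum_(u <- wlist B (wt w)) (xi K u w : K) *: vword u.

Let psi_sym : sym psi.
Proof.
move=> v w vw; rewrite /psi (wt_perm _ vw); apply: eq_bigr => u _.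
by congr (_ *: _); apply: xi_sym.
Qed.

Let f := ablift psi_sym.

Let lext_psi u : all (letter B) u -> lext psi (welt B u) = vword u.
Proof.
move=> wu; rewrite (eq_lext_supp (g := fun w =>
   \sum_(v <- wlist B (wt u)) (xi K v w : K) *: vword v)); last first.
  by move=> w /(welt_homog wu) E; rewrite /psi E.
rewrite lext_sum (bigD1_seq u) ?wlist_uniq ?mem_wlist ?wu ?eqxx //=.
rewrite lext_scalel xi_welt // eqxx scale1r big_seq_cond big1 ?addr0 // => v /andP[].
rewrite mem_wlist => /andP[wv _] ne.
by rewrite lext_scalel xi_welt // eq_sym (negPf ne) scale0r.
Qed.

Definition cls (w : F) : HPRab K D := abpi (<< w >> : A).
Definition wcls (u : F) : HPRab K D := abpi (welt B u : A).

Let lext_cls (x : A) : lext cls x = abpi x.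
Proof. exact: lext_abpi. Qed.

Let cls_expand w : cls w = \sum_(u <- wlist B (wt w)) (xi K u w : K) *: wcls u.
Proof.
apply: etrans (welt_expand B w (@abpi_sym K D)) _.
apply: eq_bigr => u _; congr (_ *: _).
exact: lext_cls.
Qed.

Lemma HPRab_span (Q : HPRab K D -> Prop) :
  Q 0 -> (forall x y, Q x -> Q y -> Q (x + y)) -> (forall a x, Q x -> Q (a *: x)) ->
  (forall u, all (letter B) u -> Q (wcls u)) -> forall x, Q x.
Proof.
move=> Q0 QD QZ QU x; have [y ->] := qpi_ex x.
have -> : qpi (comm_rel (A := A)) y = lext cls y by rewrite lext_cls.
rewrite lext.unlock; elim/big_ind: _ => // w _; apply: (QZ).
rewrite cls_expand big_seq; elim/big_ind: _ => // u; rewrite mem_wlist => /andP[wu _].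
exact/QZ/QU.
Qed.

Lemma HPRab_linear_eq (W : lmodType K) (h1 h2 : {linear HPRab K D -> W}) :
  (forall u, all (letter B) u -> h1 (wcls u) = h2 (wcls u)) -> h1 =1 h2.
Proof.
move=> E; apply: HPRab_span => [|x y Ex Ey|a x Ex|//]; first by rewrite !linear0.
  by rewrite !linearD /= Ex Ey.
by rewrite !linearZ_LR /= Ex.
Qed.

Let f_wcls u : all (letter B) u -> f (wcls u) = vword u.
Proof. by move=> wu; rewrite /f /wcls abliftE lext_psi. Qed.

Let emb : V -> {malg K[F]} := lext (fun i : I => << ([:: val i] : F) >>).
HB.instance Definition _ := GRing.Linear.on emb.
Let P (s : seq V) : {malg K[F]} := \prod_(v <- s) emb v.

(** The inverse map is obtained by multiplying the entries of a tensor in the free algebra on trees: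
    multilinearity is that of the product, and a word in the letters becomes one monomial, to which
    [wcls] applies. *)
Let g0 : {malg K[seq V]} -> HPRab K D := lext (fun s => lext wcls (P s)).
HB.instance Definition _ := GRing.Linear.on g0.

Fact g0_rel x : multilin_rel x -> g0 x = 0.
Proof.
case=> s t a u v; rewrite linearB linearP /= /g0 !lextU; apply/eqP; rewrite subr_eq0.
rewrite -linearP /=; apply/eqP; congr (lext _ _).
rewrite /P !big_cat !big_cons linearP /= mulrDl mulrDr; congr (_ + _).
by rewrite -scalerAl -malg_scaleAr.
Qed.

Let g : tensorT V -> HPRab K D := qlift g0_rel.
HB.instance Definition _ := GRing.Linear.on g.

Let P_letters (u : seq I) : P [seq << i >> | i <- u] = << (map val u : F) >>.
Proof.
elim: u => [|i u IH]; first by rewrite /P big_nil.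
by rewrite /P /= big_cons -/(P _) IH /emb lextU malgM_def fgmulUU mulr1.
Qed.

Let vec_val (u : seq I) : [seq vec t | t <- map val u] = [seq << i >> | i <- u].
Proof. by elim: u => //= i u ->; rewrite /vec valK. Qed.

Let vwordE (u : seq I) : vword (map val u) = wordT [seq << i >> | i <- u].
Proof. by rewrite /vword vec_val. Qed.

Let letters_val (u : seq I) : all (letter B) (map val u).
Proof. by apply/allP => _ /mapP[i _ ->]; exact: valP. Qed.

Let lift_letters (u : F) : all (letter B) u -> exists u' : seq I, u = map val u'.
Proof.
elim: u => [|t u IH] /=; first by exists [::].
by move=> /andP[lt /IH[u' ->]]; exists (exist _ t lt :: u').
Qed.

Let g_vword u : all (letter B) u -> g (vword u) = wcls u.
Proof.
move=> /lift_letters[u' ->]; rewrite vwordE.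
apply: etrans (qliftE g0_rel _) _; apply: etrans (lextU _ _) _.
by rewrite P_letters; exact: lextU.
Qed.

Lemma ablift_bij : bijective f.
Proof.
exists g => x.
  apply: (HPRab_linear_eq (h1 := g \o f) (h2 := idfun)) => u wu /=.
  by apply: etrans (g_vword wu); congr g; apply: f_wcls.
apply: (tensorT_linear_eq (h1 := f \o g) (h2 := idfun)) => u /=.
rewrite -vwordE; apply: etrans (f_wcls (letters_val u)).
by congr f; apply: g_vword.
Qed.

Let comul_wcls u : all (letter B) u ->
  comulPRab (wcls u) = \sum_(q <- splits u) tens (wcls q.1) (wcls q.2).
Proof.
move=> wu.
pose phi (p r : F) := tens (cls p) (cls r).
have tD x y : tmap (@abpi K A) (@abpi K A) (x + y) =
  tmap (@abpi K A) (@abpi K A) x + tmap (@abpi K A) (@abpi K A) y by exact: linearD.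
have t0 : tmap (@abpi K A) (@abpi K A) 0 = 0.
  by apply: (addrI (tmap (@abpi K A) (@abpi K A) 0)); rewrite -tD !addr0.
have phi_cuts (w : F) : tmap (@abpi K A) (@abpi K A) (comulPR (<< w >> : A)) =
    \sum_(q <- cuts w) phi q.1 q.2.
  rewrite comulPR_cuts (big_morph _ tD t0); apply: eq_bigr => q _.
  exact: tmapE.
have E (x : A) : comulPRab (abpi x) = lext (fun w => \sum_(q <- cuts w) phi q.1 q.2) x.
  rewrite comulPRabE.
  apply: (malg_linear_eq (f := tmap (@abpi K A) (@abpi K A) \o @comulPR K D)
     (g := lext _)) => w; rewrite /= lextU.
  exact: phi_cuts.
have sc2 : sym2 phi.
  split=> [r p p' pp'|p r r' rr']; rewrite /phi; congr (tens _ _); exact: abpi_sym.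
rewrite /wcls E (welt_cuts sc2 wu); apply: eq_bigr => q _.
by rewrite /ev2 -!lext_cls lext_tens.
Qed.

Lemma ablift_deconc x : deconc (f x) = tmap f f (comulPRab x).
Proof.
have tD y z : tmap f f (y + z) = tmap f f y + tmap f f z by exact: linearD.
have t0 : tmap f f 0 = 0 by apply: (addrI (tmap f f 0)); rewrite -tD !addr0.
apply: (HPRab_linear_eq (h1 := @deconc K V \o f) (h2 := tmap f f \o @comulPRab K D)) => u wu /=.
transitivity (deconc (vword u)); first by congr deconc; apply: f_wcls.
transitivity (tmap f f (\sum_(q <- splits u) tens (wcls q.1) (wcls q.2))); last first.
  by congr (tmap f f); rewrite comul_wcls.
rewrite /vword deconcE /deconc_word size_map (big_morph _ tD t0).
transitivity (\sum_(q <- splits u) tens (vword q.1) (vword q.2)).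
  rewrite (splits_take_drop (fun p r => tens (vword p) (vword r))).
  by apply: eq_bigr => i _; rewrite /vword -!map_take -!map_drop.
rewrite big_seq [RHS]big_seq; apply: eq_bigr => q qu.
have [w1 w2] := splits_word qu wu.
by apply: etrans (esym (tmapE _ _ _ _)); congr (tens _ _); apply/esym/f_wcls.
Qed.

Lemma ablift_counit x : counitT (f x) = counitPRab x.
Proof.
apply: (HPRab_linear_eq (h1 := @counitT K V \o f) (h2 := @counitPRab K D)) => u wu /=.
transitivity (counitT (vword u)); first by congr counitT; apply: f_wcls.
rewrite /vword counitTE /wcls counitPRabE.
rewrite /counitPR (eq_lext (g := xi K [::])) => [|w]; last by rewrite /= -size_eq0.
by rewrite (xi_welt wu) // /nilp size_map size_eq0.
Qed.

Theorem cofree_HPRab : cofree_coalgebra (@comulPRab K D) (@counitPRab K D).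
Proof.
exists V, f; split; [exact: ablift_bij|exact: ablift_deconc|exact: ablift_counit].
Qed.

End Cofree.

(** * The bracket as a commutator of functionals *)

Lemma lext_mull (K : fieldType) (X : choiceType) (f : X -> K^o) (c : K) x :
  lext (fun k => (c * f k : K^o)) x = c * lext f x.
Proof. exact: lext_scale. Qed.

Section BraceCuts.
Variables (K : fieldType) (D : choiceType).
Local Notation T := (ptree D).
Local Notation F := (forest D).

(** The brace extended to forests in such a way that the brace of [t] with B_d(ts) is B_d of the
    result, see [brace_tree_forest]. *)
Fixpoint brace_forest (t : T) (ts : F) : {malg K[F]} :=
  if ts is s :: ts' then
    << (t :: s :: ts' : F) >> + lext (fun w => << (s :: w : F) >>) (brace_forest t ts')
    + lext (fun y => << (y :: ts' : F) >>) (brace_tree K t s)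
  else << ([:: t] : F) >>.

Lemma sum_insert (W : nmodType) (a : F -> F -> W) s ts :
  \sum_(i < (size (s :: ts)).+1) a (take i (s :: ts)) (drop i (s :: ts)) =
  a [::] (s :: ts) + \sum_(i < (size ts).+1) a (s :: take i ts) (drop i ts).
Proof. by rewrite big_ord_recl. Qed.

Lemma sum_replace (W : nmodType) (a : F -> T -> F -> W) t0 s ts :
  \sum_(i < size (s :: ts))
    a (take i (s :: ts)) (nth t0 (s :: ts) i) (drop i.+1 (s :: ts)) =
  a [::] s ts + \sum_(i < size ts) a (s :: take i ts) (nth t0 ts i) (drop i.+1 ts).
Proof. by rewrite big_ord_recl /= drop0. Qed.

Lemma lext_brace_forest (W : lmodType K) (phi : F -> W) t ts :
  lext phi (brace_forest t ts) =
  \sum_(i < (size ts).+1) phi (take i ts ++ t :: drop i ts) +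
  \sum_(i < size ts)
    lext (fun y => phi (take i ts ++ y :: drop i.+1 ts)) (brace_tree K t (nth t ts i)).
Proof.
elim: ts phi => [|s ts IH] phi.
  by rewrite lextU big_ord_recl !big_ord0 !addr0.
rewrite (sum_insert (fun p r => phi (p ++ t :: r))).
rewrite (sum_replace (fun p x r => lext (fun y => phi (p ++ y :: r)) (brace_tree K t x))).
have E1 : lext phi (lext (fun w => << (s :: w : F) >>) (brace_forest t ts)) =
    lext (fun w => phi (s :: w)) (brace_forest t ts).
  by rewrite lext_lext; apply: eq_lext => w; exact: lextU.
have E2 : lext phi (lext (fun y => << (y :: ts : F) >>) (brace_tree K t s)) =
    lext (fun y => phi (y :: ts)) (brace_tree K t s).
  by rewrite lext_lext; apply: eq_lext => w; exact: lextU.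
rewrite [brace_forest _ _]/= !linearD /= E1 E2 lextU (IH (fun w => phi (s :: w))).
by rewrite -!addrA; congr (_ + _); rewrite [RHS]addrCA [RHS]addrC -!addrA.
Qed.

Lemma brace_tree_forest t d ts : brace_tree K t (Node d ts) =
  lext (fun w => << Node d w >>) (brace_forest t ts).
Proof.
rewrite lext_brace_forest /=; congr (_ + _); apply: eq_bigr => i _.
by rewrite (nth_map t).
Qed.

Lemma lext_cons_coef (X : choiceType) (f : X -> F) (x : {malg K[X]}) h :
  (lext (fun k => << f k >>) x)@_h = lext (fun k => (f k == h)%:R : K^o) x.
Proof.
by rewrite -lext_coef lext_lext; apply: (@eq_lext K X K^o) => k; exact: lextU.
Qed.

Lemma brace_tree_coef_of t d hs :
  (forall h, (brace_forest t hs)@_h =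
    \sum_(q <- cuts h) ((q.1 == [:: t])%:R * (q.2 == hs)%:R : K)) ->
  forall x, (brace_tree K t (Node d hs))@_x =
    \sum_(a <- cutT x) ((a.1 == [:: t])%:R * (a.2 == [:: Node d hs])%:R : K).
Proof.
move=> IH x.
rewrite brace_tree_forest; case: x => d' h'.
rewrite (sum_cutT d' h' (fun p r => ((p == [:: t])%:R * (r == [:: Node d hs])%:R : K))).
rewrite mulr0 add0r.
have nodeE (w w' : F) : (Node d w == Node d' w') = (d == d') && (w == w').
  apply/eqP/andP => [[-> ->]|[/eqP -> /eqP ->] //]; by rewrite !eqxx.
transitivity (lext (fun w => (d == d')%:R * (w == h')%:R : K^o) (brace_forest t hs)).
  rewrite -lext_coef lext_lext; apply: (@eq_lext K F K^o) => w.
  apply: etrans (lextU _ _) _; by rewrite nodeE -mulnb natrM.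
rewrite lext_mull lext_coef IH; apply: etrans (mulr_sumr _ _ _ _) _.
apply: eq_bigr => q _; rewrite mulrCA; congr (_ * _).
by rewrite eqseq_cons andbT [Node d' _ == _]eq_sym nodeE -natrM mulnb [hs == _]eq_sym.
Qed.

(** The three ways of inserting [t] correspond to the cuts of [h] according to its first tree: it is
    [t] and pruned whole, it is uncut, or [t] is cut off from it. *)
Lemma brace_forest_coef t ts (h : F) : (brace_forest t ts)@_h =
  \sum_(q <- cuts h) ((q.1 == [:: t])%:R * (q.2 == ts)%:R : K).
Proof.
elim/forest_ind: ts h => [|d hs ts IHs IHts] h.
  rewrite /= mcoeffU -[LHS](sum_cuts_right0 (fun p : F => (1 *+ ([:: t] == p) : K))).
  apply: eq_bigr => q _; case: (q.2 == [::]) => /=; last by rewrite mulr0.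
  by rewrite mulr1 eq_sym.
have tree_coef := brace_tree_coef_of d IHs.
set s := Node d hs in tree_coef *.
have consE x (v w : F) : (x :: v == w) = if w is y :: w' then (x == y) && (v == w') else false.
  by case: w.
have -> : (brace_forest t (s :: ts))@_h = (t :: s :: ts == h)%:R +
    (lext (fun w => (s :: w == h)%:R : K^o) (brace_forest t ts) +
     lext (fun y => (y :: ts == h)%:R : K^o) (brace_tree K t s) : K).
  by rewrite [brace_forest _ _]/= !mcoeffD mcoeffU !lext_cons_coef addrA.
case: h => [|x h].
  rewrite big_seq1 mulr0 add0r.
  by rewrite (@lext_zero _ _ K^o) ?(@lext_zero _ _ K^o) ?addr0.
transitivity ((x == t)%:R * (h == s :: ts)%:R + ((x == s)%:R * (brace_forest t ts)@_h +
    (brace_tree K t s)@_x * (h == ts)%:R)).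
  congr (_ + (_ + _)).
  - by rewrite eqseq_cons -natrM mulnb eq_sym [s :: ts == h]eq_sym.
  - rewrite -lext_coef -lext_mull; apply: (@eq_lext K F K^o) => w.
    by rewrite eqseq_cons -mulnb natrM eq_sym.
  - rewrite -lext_coef mulrC -lext_mull; apply: (@eq_lext K T K^o) => y.
    by rewrite eqseq_cons -mulnb natrM mulrC [ts == h]eq_sym.
rewrite tree_coef IHts; case: x => d' h'.
rewrite (sum_cuts_cons _ _ (fun p r => ((p == [:: t])%:R * (r == s :: ts)%:R : K))).
rewrite (sum_cutT d' h' (fun p r => \sum_(b <- cuts h)
  ((p ++ b.1 == [:: t])%:R * (r ++ b.2 == s :: ts)%:R : K))).
congr (_ + _).
  rewrite -(sum_cuts_left0 (fun r : F => (Node d' h' == t)%:R * (r == s :: ts)%:R : K)).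
  apply: eq_bigr => b _; rewrite eqseq_cons.
  by case: (b.1 == [::]); rewrite ?andbT ?andbF ?mul0r.
rewrite (sum_cutT d' h' (fun p r => ((p == [:: t])%:R * (r == [:: s])%:R : K))).
rewrite mulr0 add0r -(sum_cuts_left0 (fun r : F => (Node d' r == s)%:R : K) h').
rewrite !mulr_suml -big_split; apply: eq_bigr => a _ /=; symmetry.
transitivity (\sum_(b <- cuts h) ((Node d' a.2 == s)%:R * ((a.1 == [::])%:R *
   ((b.1 == [:: t])%:R * (b.2 == ts)%:R) + (a.1 == [:: t])%:R *
   (if b.1 == [::] then (b.2 == ts)%:R else 0)) : K)).
  apply: eq_bigr => b _; rewrite eqseq_cons -mulnb natrM mulrCA; congr (_ * _).
  case: a.1 => [|y [|y' p]]; rewrite /= ?mul1r ?mul0r ?addr0 ?add0r //.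
    rewrite !eqseq_cons andbT; case: (b.1 == [::]); rewrite ?andbT ?andbF ?mul0r ?mulr0 //.
  by rewrite !eqseq_cons !andbF !mul0r.
rewrite -mulr_sumr big_split -!mulr_sumr (sum_cuts_left0 (fun r : F => (r == ts)%:R : K)).
rewrite mulrDr eqseq_cons andbT; congr (_ + _).
  by case: (a.1 == [::]); rewrite ?mul1r ?mulr1 ?mul0r ?mulr0.
by rewrite mulrA [(_ == s)%:R * _]mulrC.
Qed.

Lemma brace_tree_coef (t s x : T) : (brace_tree K t s)@_x =
  \sum_(a <- cutT x) ((a.1 == [:: t])%:R * (a.2 == [:: s])%:R : K).
Proof. by case: s => d hs; apply: brace_tree_coef_of => h; apply: brace_forest_coef. Qed.

End BraceCuts.

(** * Convolution of functionals and the Lie bracket *)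

Section Convolution.
Variables (K : fieldType) (D : choiceType).
Local Notation T := (ptree D).
Local Notation F := (forest D).
Local Notation L := {malg K[T]}.
Implicit Types (al be ga : F -> K) (l m : L).

Definition conv al be (w : F) : K := \sum_(q <- cuts w) al q.1 * be q.2.
Definition eps (w : F) : K := (w == [::])%:R.
(** [l] as a functional concentrated on single trees, that is, an infinitesimal character
    ([Zf_cat]). *)
Definition Zf l (w : F) : K := if w is [:: t] then l@_t else 0.

Lemma conv1l al : conv eps al = al.
Proof.
apply/funext => w; rewrite -[RHS](sum_cuts_left0 al); apply: eq_bigr => q _.
by rewrite /eps; case: eqP => _; rewrite ?mul1r ?mul0r.
Qed.

Lemma conv1r al : conv al eps = al.
Proof.
apply/funext => w; rewrite -[RHS](sum_cuts_right0 al); apply: eq_bigr => q _.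
by rewrite /eps; case: eqP => _; rewrite ?mulr1 ?mulr0.
Qed.

Lemma convA al be ga : conv (conv al be) ga = conv al (conv be ga).
Proof.
apply/funext => w; rewrite /conv.
transitivity (\sum_(q <- cuts w) \sum_(r <- cuts q.1) al r.1 * be r.2 * ga q.2).
  by apply: eq_bigr => q _; rewrite mulr_suml.
rewrite (cuts_coassoc w (fun x y z => al x * be y * ga z)).
by apply: eq_bigr => q _; rewrite mulr_sumr; apply: eq_bigr => r _; rewrite mulrA.
Qed.

Lemma convDl al be ga : conv (fun w => al w + be w) ga = fun w => conv al ga w + conv be ga w.
Proof.
by apply/funext => w; rewrite /conv -big_split; apply: eq_bigr => q _; rewrite mulrDl.
Qed.

Lemma convDr al be ga : conv al (fun w => be w + ga w) = fun w => conv al be w + conv al ga w.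
Proof.
by apply/funext => w; rewrite /conv -big_split; apply: eq_bigr => q _; rewrite mulrDr.
Qed.

Lemma convZr al be c : conv al (fun w => c * be w) = fun w => c * conv al be w.
Proof.
by apply/funext => w; rewrite /conv mulr_sumr; apply: eq_bigr => q _; rewrite mulrCA.
Qed.

Lemma convBr al be ga : conv al (fun w => be w - ga w) = fun w => conv al be w - conv al ga w.
Proof.
by apply/funext => w; rewrite /conv -sumrB; apply: eq_bigr => q _; rewrite mulrBr.
Qed.

Lemma convZl al be c : conv (fun w => c * al w) be = fun w => c * conv al be w.
Proof.
by apply/funext => w; rewrite /conv mulr_sumr; apply: eq_bigr => q _; rewrite mulrA.
Qed.

Lemma Zf_cat l p r : Zf l (p ++ r) = Zf l p * eps r + eps p * Zf l r.
Proof.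
rewrite /eps; case: p => [|x p]; first by rewrite mul0r add0r mul1r.
rewrite mul0r addr0; case: r => [|y r]; first by rewrite cats0 mulr1.
by rewrite mulr0; case: p.
Qed.

Definition Zprod (ls : seq L) : F -> K := foldr (fun l al => conv (Zf l) al) eps ls.

Fixpoint unsh (ls : seq L) : seq (seq L * seq L) :=
  if ls is l :: ls' then
    [seq (l :: q.1, q.2) | q <- unsh ls'] ++ [seq (q.1, l :: q.2) | q <- unsh ls']
  else [:: ([::], [::])].

(** Each [Zf l] is primitive for the coproduct dual to concatenation, and convolution is
    multiplicative for that coproduct; so every factor goes to one of the two sides, whence a sum
    over deshuffles. *)
Lemma Zprod_cat ls v w :
  Zprod ls (v ++ w) = \sum_(q <- unsh ls) Zprod q.1 v * Zprod q.2 w.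
Proof.
elim: ls v w => [|l ls IH] v w.
  by rewrite big_seq1 /= /eps -natrM mulnb; case: v.
rewrite [unsh _]/= big_cat !big_map /= -big_split /=.
rewrite /conv (sum_cuts_cat v w (fun p r => Zf l p * Zprod ls r)).
transitivity (\sum_(q <- unsh ls) \sum_(a <- cuts v) \sum_(b <- cuts w)
  ((Zf l a.1 * Zprod q.1 a.2) * (eps b.1 * Zprod q.2 b.2) +
   (eps a.1 * Zprod q.1 a.2) * (Zf l b.1 * Zprod q.2 b.2))).
  rewrite [RHS]exchange_big; apply: eq_bigr => a _ /=.
  rewrite [RHS]exchange_big; apply: eq_bigr => b _ /=.
  rewrite IH mulr_sumr; apply: eq_bigr => q _.
  by rewrite Zf_cat mulrDl mulrACA [X in _ + X = _]mulrACA.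
apply: eq_bigr => q _.
have E a b c d : \sum_(x <- cuts v) \sum_(y <- cuts w)
    (a x.1 * b x.2) * (c y.1 * d y.2) = conv a b v * conv c d w.
  by rewrite /conv mulr_suml; apply: eq_bigr => x _; rewrite mulr_sumr.
under eq_bigr => a _ do rewrite big_split.
rewrite big_split /= (E (Zf l) (Zprod q.1) eps (Zprod q.2)).
by rewrite (E eps (Zprod q.1) (Zf l) (Zprod q.2)) !conv1l.
Qed.

Lemma Zf_lext l (w : F) : Zf l w = lext (fun t => (w == [:: t])%:R : K^o) l.
Proof.
case: w => [|t [|u w]] /=; first by rewrite lext_zero.
  rewrite -lext_coef; apply: (@eq_lext K T K^o) => s.
  by rewrite eqseq_cons andbT eq_sym.
by rewrite lext_zero // => s _; rewrite eqseq_cons andbF.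
Qed.

Lemma mcoeff_lext (X Y : choiceType) (f : X -> {malg K[Y]}) x y :
  (lext f x)@_y = lext (fun k => ((f k)@_y : K^o)) x.
Proof. by rewrite -lext_coef lext_lext; apply: (@eq_lext K X K^o) => k; rewrite lext_coef. Qed.

Lemma conv_brace l m v : conv (Zf l) (Zf m) [:: v] = (brace l m)@_v.
Proof.
rewrite /conv (sum_cuts1 v (fun p r => Zf l p * Zf m r)) /brace mcoeff_lext.
transitivity (lext (fun t => lext (fun s => \sum_(a <- cutT v)
    ((a.1 == [:: t])%:R * (a.2 == [:: s])%:R : K^o)) m) l); last first.
  apply: (@eq_lext K T K^o) => t; rewrite mcoeff_lext; apply: (@eq_lext K T K^o) => s.
  by rewrite brace_tree_coef.
under eq_lext => t do rewrite lext_sum.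
rewrite lext_sum; apply: eq_bigr => a _; rewrite !Zf_lext mulrC -lext_mull.
apply: (@eq_lext K T K^o) => t; rewrite mulrC -lext_mull.
by apply: (@eq_lext K T K^o) => s.
Qed.

(** On single trees this is [conv_brace]. On longer forests, splitting off the first tree with
    [Zprod_cat] gives an expression symmetric in [l] and [m], so the commutator vanishes there. *)
Lemma Zf_lie l m w :
  Zf (lie_Br l m) w = conv (Zf l) (Zf m) w - conv (Zf m) (Zf l) w.
Proof.
case: w => [|v [|u w]].
- by rewrite /conv !big_seq1 !mul0r subrr.
- by rewrite !conv_brace /= mcoeffB.
rewrite -[conv (Zf l) _](_ : Zprod [:: l; m] = _); last by rewrite /= conv1r.
rewrite -[conv (Zf m) _](_ : Zprod [:: m; l] = _); last by rewrite /= conv1r.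
rewrite -[v :: u :: w]/([:: v] ++ (u :: w)) !Zprod_cat /= !big_cons !big_nil /=.
rewrite !conv1r [eps (u :: w)](_ : _ = 0) // [eps [:: v]](_ : _ = 0) //.
by rewrite !(mulr0, mul0r, addr0, add0r) [X in _ - X]addrC subrr.
Qed.

Lemma Zf_inj l m : Zf l =1 Zf m -> l = m.
Proof. by move=> E; apply/malgP => t; exact: (E [:: t]). Qed.

Lemma Zf_lieE l m :
  Zf (lie_Br l m) = fun w => conv (Zf l) (Zf m) w + - 1 * conv (Zf m) (Zf l) w.
Proof. by apply/funext => w; rewrite Zf_lie mulN1r. Qed.

(** Through the injection [Zf] the bracket is a commutator for the associative product [conv], so
    the twelve terms of the Jacobi sum cancel in pairs. *)
Lemma lie_Br_is_lie : is_lie (@lie_Br K D).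
Proof.
have bl (y : L) : linear (fun x : L => brace x y) by move=> a u v; rewrite /brace linearP.
have br (x : L) : linear (brace x).
  by move=> a u v; rewrite /brace -lext_scale -lext_add; apply: eq_lext => t; rewrite linearP.
split=> [y a u v|x a u v|x|x y z].
- by rewrite /lie_Br bl br scalerBr opprD addrACA.
- by rewrite /lie_Br br bl scalerBr opprD addrACA.
- exact: subrr.
apply/malgP => t; rewrite mcoeff0.
have E (l m n : L) : (l + m + n)@_t = Zf l [:: t] + Zf m [:: t] + Zf n [:: t].
  by rewrite 2!mcoeffD.
apply: etrans (E _ _ _) _; rewrite !Zf_lieE !(convDr, convDl, convZr, convZl) !convA /=.
set X := Zf x; set Y := Zf y; set Z := Zf z.
move: (conv X (conv Y Z) _) (conv X (conv Z Y) _) (conv Y (conv X Z) _).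
move: (conv Y (conv Z X) _) (conv Z (conv X Y) _) (conv Z (conv Y X) _).
move=> a b c d e f; rewrite !mulN1r !opprD !opprK !addrA.
rewrite [LHS](ACl ((1*11)*(2*8)*(3*5)*(4*10)*(6*12)*(7*9)))%AC /=.
by rewrite !(subrr, addNr, addr0).
Qed.

End Convolution.

(** * Lie generators *)

Section Generation.
Variables (K : fieldType) (charK : [pchar K] =i pred0) (D : choiceType).
Local Notation T := (ptree D).
Local Notation F := (forest D).
Local Notation L := (Br K D).
Implicit Types (al be : F -> K) (l m : L) (ls : seq L).

Section Filtration.
Variable S : L -> Prop.
Hypothesis S_lie : forall l m, S l -> S m -> S (lie_Br l m).

Definition allS ls := forall l, l \in ls -> S l.

(** Analogue of the filtration of an enveloping algebra by the number of factors, the bound [k]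
    being strict. *)
Inductive below k : (F -> K) -> Prop :=
| Below0 : below k (fun=> 0)
| BelowD c ls al : (size ls < k)%N -> allS ls -> below k al ->
    below k (fun w => c * Zprod ls w + al w).

Lemma below_prod k ls : (size ls < k)%N -> allS ls -> below k (Zprod ls).
Proof.
move=> sk Sl; have -> : Zprod ls = fun w => 1 * Zprod ls w + 0.
  by apply/funext => w; rewrite mul1r addr0.
by apply: BelowD => //; apply: Below0.
Qed.

Lemma below_add k al be : below k al -> below k be -> below k (fun w => al w + be w).
Proof.
move=> ba bb; elim: ba => [|c ls ga sk Sl _ IH].
  by have -> : (fun w => 0 + be w) = be by apply/funext => w; rewrite add0r.
have -> : (fun w => c * Zprod ls w + ga w + be w) = fun w => c * Zprod ls w + (ga w + be w).
  by apply/funext => w; rewrite addrA.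
exact: BelowD.
Qed.

Lemma below_scale k c al : below k al -> below k (fun w => c * al w).
Proof.
elim=> [|d ls ga sk Sl _ IH].
  by have -> : (fun w : F => c * 0) = (fun=> 0 : K); [apply/funext => w; rewrite mulr0|apply: Below0].
have -> : (fun w => c * (d * Zprod ls w + ga w)) =
    fun w => (c * d) * Zprod ls w + c * ga w.
  by apply/funext => w; rewrite mulrDr mulrA.
exact: BelowD.
Qed.

Lemma below_sub k al be : below k al -> below k be -> below k (fun w => al w - be w).
Proof.
move=> ba /(below_scale (-1)) bb; have := below_add ba bb.
by congr below; apply/funext => w; rewrite mulN1r.
Qed.

Lemma below_sum k (I : eqType) (r : seq I) (f : I -> F -> K) :
  (forall i, i \in r -> below k (f i)) -> below k (fun w => \sum_(i <- r) f i w).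
Proof.
elim: r => [|i r IH] Pr.
  have -> : (fun w => \sum_(i <- [::]) f i w) = fun=> 0; last exact: Below0.
  by apply/funext => w; rewrite big_nil.
have -> : (fun w => \sum_(j <- i :: r) f j w) = fun w => f i w + \sum_(j <- r) f j w.
  by apply/funext => w; rewrite big_cons.
apply: below_add; first by apply: Pr; rewrite inE eqxx.
by apply: IH => j jr; apply: Pr; rewrite inE jr orbT.
Qed.

Lemma below_conv k l al : S l -> below k al -> below k.+1 (conv (Zf l) al).
Proof.
move=> Sl; elim=> [|c ls ga sk Sls _ IH].
  have -> : conv (Zf l) (fun=> 0) = fun=> 0; last exact: Below0.
  by apply/funext => w; rewrite /conv big1 // => q _; rewrite mulr0.
rewrite convDr convZr -[conv (Zf l) (Zprod ls)]/(Zprod (l :: ls)).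
by apply: BelowD => // x; rewrite inE => /predU1P[->|/Sls].
Qed.

Lemma allS_cons l ls : allS (l :: ls) <-> S l /\ allS ls.
Proof.
split=> [H|[Sl Sls] x]; last by rewrite inE => /predU1P[->|/Sls].
by split=> [|x xs]; apply: H; rewrite inE ?eqxx // xs orbT.
Qed.

(** Moving [l] past [x] costs the bracket of [x] and [l], which is again in [S], so each error term
    has one factor less. *)
Lemma Zprod_move l a b : S l -> allS a -> allS b ->
  below (size a + size b).+1 (fun w => Zprod (a ++ l :: b) w - Zprod (l :: a ++ b) w).
Proof.
move=> Sl Sa Sb; elim: a Sa => [_|x a IH /allS_cons[Sx Sa]].
  have -> : (fun w => Zprod ([::] ++ l :: b) w - Zprod (l :: [::] ++ b) w) = fun=> 0.
    by apply/funext => w; rewrite subrr.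
  exact: Below0.
have -> : (fun w => Zprod ((x :: a) ++ l :: b) w - Zprod (l :: (x :: a) ++ b) w) =
    fun w => conv (Zf x) (fun w => Zprod (a ++ l :: b) w - Zprod (l :: a ++ b) w) w +
      Zprod (lie_Br x l :: a ++ b) w.
  apply/funext => w; rewrite /= Zf_lieE !(convDl, convZl) !convA.
  by rewrite convBr mulN1r addrA subrK.
apply: below_add.
  by apply: below_conv => //; apply: IH.
apply: below_prod; first by rewrite /= size_cat.
apply/allS_cons; split; first exact: S_lie.
by move=> y; rewrite mem_cat => /orP[/Sa|/Sb].
Qed.

Lemma unsh_below ls (p : seq L * seq L) : allS ls -> p \in unsh ls ->
  [/\ size (p.1 ++ p.2) = size ls, allS p.1, allS p.2 &
      below (size ls) (fun w => Zprod (p.1 ++ p.2) w - Zprod ls w)].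
Proof.
elim: ls p => [|l ls IH] p.
  rewrite inE => _ /eqP ->; split=> //.
  rewrite [X in below _ X](_ : _ = fun=> 0); first exact: Below0.
  by apply/funext => w; rewrite subrr.
rewrite /= mem_cat => /allS_cons[Sl Sls] /orP[] /mapP[q /(IH _ Sls) + ->].
  move=> [sq S1 S2 bq]; split=> //=; [by rewrite sq|by apply/allS_cons|].
  have -> : (fun w => conv (Zf l) (Zprod (q.1 ++ q.2)) w - conv (Zf l) (Zprod ls) w) =
      conv (Zf l) (fun w => Zprod (q.1 ++ q.2) w - Zprod ls w).
    by rewrite convBr.
  exact: below_conv.
move=> [sq S1 S2 bq]; split=> //=.
- by rewrite size_cat /= addnS -size_cat sq.
- by apply/allS_cons.
have -> : (fun w => Zprod (q.1 ++ l :: q.2) w - conv (Zf l) (Zprod ls) w) =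
   fun w => (Zprod (q.1 ++ l :: q.2) w - Zprod (l :: q.1 ++ q.2) w) +
     conv (Zf l) (fun w => Zprod (q.1 ++ q.2) w - Zprod ls w) w.
  apply/funext => w.
  by rewrite convBr /= addrA subrK.
apply: below_add; last exact: below_conv.
by rewrite -sq size_cat; apply: Zprod_move.
Qed.

Lemma size_unsh ls : size (unsh ls) = (2 ^ size ls)%N.
Proof.
by elim: ls => //= l ls IH; rewrite size_cat !size_map IH expnS mul2n addnn.
Qed.

(** The transpose of Psi^2. *)
Definition psi2 al (w : F) : K := \sum_(q <- cuts w) al (q.1 ++ q.2).

Lemma psi2_prod ls : psi2 (Zprod ls) = fun w => \sum_(p <- unsh ls) Zprod (p.1 ++ p.2) w.
Proof.
apply/funext => w; rewrite /psi2.
transitivity (\sum_(q <- cuts w) \sum_(p <- unsh ls) Zprod p.1 q.1 * Zprod p.2 q.2).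
  by apply: eq_bigr => q _; rewrite Zprod_cat.
rewrite exchange_big; apply: eq_bigr => p _ /=.
rewrite -/(conv (Zprod p.1) (Zprod p.2) w); congr (_ w).
by elim: p.1 => [|l s IH] /=; rewrite ?conv1l // convA IH.
Qed.

(** There are 2^k deshuffles of k factors, and each multiplies back to the original product up to
    shorter products ([unsh_below]). *)
Lemma psi2_below k al : below k.+1 al ->
  below k (fun w => psi2 al w - (2 ^ k)%:R * al w).
Proof.
elim=> [|c ls ga sk Sls _ IH].
  have -> : (fun w => psi2 (fun=> 0) w - (2 ^ k)%:R * 0) = fun=> 0; last exact: Below0.
  by apply/funext => w; rewrite /psi2 big1 // mulr0 subrr.
have -> : (fun w => psi2 (fun w => c * Zprod ls w + ga w) w -
    (2 ^ k)%:R * (c * Zprod ls w + ga w)) =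
  fun w => c * (psi2 (Zprod ls) w - (2 ^ k)%:R * Zprod ls w) +
    (psi2 ga w - (2 ^ k)%:R * ga w).
  apply/funext => w; rewrite {1}/psi2 big_split -mulr_sumr -!/(psi2 _ w).
  by rewrite mulrBr mulrDr opprD addrACA mulrCA.
apply: below_add => //; apply: below_scale.
rewrite psi2_prod; move: sk; rewrite ltnS leq_eqVlt => /predU1P[sk|lt_k].
  have -> : (fun w => \sum_(p <- unsh ls) Zprod (p.1 ++ p.2) w - (2 ^ k)%:R * Zprod ls w) =
      fun w => \sum_(p <- unsh ls) (Zprod (p.1 ++ p.2) w - Zprod ls w).
    apply/funext => w; rewrite sumrB; congr (_ - _).
    by rewrite -sk -size_unsh big_const_seq count_predT iter_addr_0 mulr_natl.
  apply: below_sum => p /(unsh_below Sls)[_ _ _].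
  by rewrite sk.
apply: below_sub; last by apply/below_scale/below_prod.
apply: below_sum => p /(unsh_below Sls)[sp S1 S2 _].
apply: below_prod; first by rewrite sp.
by move=> x; rewrite mem_cat => /orP[/S1|/S2].
Qed.

(* psi2 acts as 2 ^ k modulo products of fewer than k factors, so a *)
(* functional it doubles reduces to products of at most one factor. *)
Lemma below_eigen k al : below k.+2 al -> (forall w, psi2 al w = al w + al w) ->
  below 2 al.
Proof.
elim: k => // k IH /psi2_below b E; apply: IH => //.
pose n := (2 ^ k.+2 - 2)%N.
have n0 : n%:R != 0 :> K.
  have : (0 < n)%N by rewrite subn_gt0 -[X in (X < _)%N]expn1 ltn_exp2l.
  by case: n => // n' _; apply: natK_neq0.
have nE : (2 ^ k.+2 = 2 + n)%N by rewrite subnKC // -[X in (X <= _)%N]expn1 leq_exp2l.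
have := below_scale (- n%:R^-1) b; congr below; apply/funext => w.
rewrite E nE natrD mulrDl opprD addrA mulr_natl mulr2n subrr add0r mulrN mulNr opprK.
by rewrite mulrA mulVf // mul1r.
Qed.

End Filtration.

Lemma below2 (S : L -> Prop) al : (forall a l, S l -> S (a *: l)) ->
  (forall l m, S l -> S m -> S (l + m)) -> S 0 -> below S 2 al ->
  exists c l, S l /\ al = fun w => c * eps K w + Zf l w.
Proof.
move=> SZ SD S0; elim=> [|c ls ga sk Sls _ [c' [l [Sl ->]]]].
  exists 0, 0; split=> //; apply/funext => w.
  by rewrite mul0r add0r; case: w => [|t [|u w]] //=; rewrite mcoeff0.
have ZD a m n (w : F) : Zf (a *: m + n) w = a * Zf m w + Zf n w.
  by case: w => [|t [|u w]] /=; rewrite ?mulr0 ?addr0 // mcoeffD mcoeffZ.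
case: ls sk Sls => [|m [|//]] _ Sls.
  exists (c + c'), l; split=> //; apply/funext => w /=.
  by rewrite mulrDl addrA.
exists c', (c *: m + l); split.
  by apply: SD => //; apply: SZ; apply: Sls; rewrite inE.
by apply/funext => w; rewrite /= conv1r ZD addrCA.
Qed.

End Generation.

(** * Universal property of the Lie algebra *)

Section LieFacts.
Variables (K : fieldType) (L : lmodType K) (br : L -> L -> L) (lie : is_lie br).

Lemma lieDl x y z : br (x + y) z = br x z + br y z.
Proof. by have := lie_linearl lie z 1 x y; rewrite !scale1r. Qed.
Lemma lieDr x y z : br z (x + y) = br z x + br z y.
Proof. by have := lie_linearr lie z 1 x y; rewrite !scale1r. Qed.
Lemma lie0l z : br 0 z = 0.
Proof. by apply: (addrI (br 0 z)); rewrite -lieDl !addr0. Qed.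
Lemma lie0r z : br z 0 = 0.
Proof. by apply: (addrI (br z 0)); rewrite -lieDr !addr0. Qed.
Lemma lieZl a x z : br (a *: x) z = a *: br x z.
Proof. by have := lie_linearl lie z a x 0; rewrite !addr0 lie0l addr0. Qed.
Lemma lieZr a x z : br z (a *: x) = a *: br z x.
Proof. by have := lie_linearr lie z a x 0; rewrite !addr0 lie0r addr0. Qed.
Lemma lie_sumr (I : Type) (r : seq I) (f : I -> L) z :
  br z (\sum_(i <- r) f i) = \sum_(i <- r) br z (f i).
Proof. exact: (big_morph (br z) (fun x y => lieDr x y z) (lie0r z)). Qed.
Lemma lie_anti x y : br x y = - br y x.
Proof.
apply/eqP; rewrite -addr_eq0; have := lie_alternating lie (x + y).
by rewrite lieDl !lieDr !(lie_alternating lie) add0r addr0 => ->.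
Qed.
Lemma lie_ad x y z : br (br x y) z = br x (br y z) - br y (br x z).
Proof.
have := lie_jacobi lie x y z; rewrite (lie_anti z x) (lie_anti z (br x y)).
by rewrite -scaleN1r lieZr scaleN1r => /eqP; rewrite subr_eq0 => /eqP.
Qed.
End LieFacts.

Section Free.
Variables (K : fieldType) (charK : [pchar K] =i pred0) (D : choiceType).
Variables (deg : D -> nat) (deg_gt0 : forall d, (0 < deg d)%N).
Variable B : word_basis K deg.
Local Notation T := (ptree D).
Local Notation F := (forest D).
Local Notation L := (Br K D).
Local Notation wt := (wt deg).
Local Notation wtT := (wtT deg).

(** Lie monomials in the letters. The index records the weight, because the extension of a map on
    letters is normalised weight by weight. *)
Inductive lgen : nat -> L -> Prop :=
| LgenLetter t : letter B t -> lgen (wtT t) (tree_elt K t)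
| LgenLie m n a b : lgen m a -> lgen n b -> lgen (m + n) (lie_Br a b).

Definition generated := spans (fun a => exists m, lgen m a).

Let lieB := @lie_Br_is_lie K D.

Lemma generated_lie a b : generated a -> generated b -> generated (lie_Br a b).
Proof.
move=> ga gb; elim: ga => [|c x y [m mx] _ IH].
  by rewrite (lie0l lieB); apply: spans0.
rewrite (lieDl lieB) (lieZl lieB); apply: spansD IH; apply: spansZ.
elim: gb => [|d u v [n nu] _ IH']; first by rewrite (lie0r lieB); apply: spans0.
rewrite (lieDr lieB) (lieZr lieB); apply: spansD IH'; apply/spansZ/spans_sub.
by exists (m + n)%N; apply: LgenLie.
Qed.

Lemma Zf_tree t (w : F) : Zf (tree_elt K t) w = et K t w.
Proof.
rewrite /et; case: w => [|s [|u w]] //=; last by rewrite eqseq_cons andbF.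
by rewrite mcoeffU eqseq_cons andbT eq_sym.
Qed.

Lemma xi_Zprod u : xi K u = Zprod (map (@tree_elt K D) u).
Proof.
elim: u => //= t u ->; apply/funext => w; apply: eq_bigr => q _.
by rewrite Zf_tree.
Qed.

Lemma tree_generated t : generated (tree_elt K t).
Proof.
pose m := wtT t; pose al := Zf (tree_elt K t).
(* A word of weight m has at most m letters, so the expansion of [et t] uses products of at most m
   factors; m + 2 is the form that [below_eigen] takes. *)
have eg : below generated m.+2 al.
  have -> : al = fun w => \sum_(u <- wlist B m) (lext (et K t) (welt B u) : K) * xi K u w.
    apply/funext => w; rewrite /al Zf_tree; have [wm|wm] := eqVneq (wt w) m.
      rewrite (welt_expand B w (@et_sym K D t)) wm; apply: eq_bigr => u _.
      by rewrite [LHS]mulrC.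
    rewrite big_seq big1 => [|u]; last first.
      rewrite mem_wlist => /andP[_ /eqP wu].
      by rewrite (@xi_wt _ _ deg) ?mulr0 // wu.
    rewrite /et; case: eqP => // E.
    by move: wm; rewrite E wt1 eqxx.
  apply: below_sum => u; rewrite mem_wlist => /andP[lu /eqP wu]; apply: below_scale.
  rewrite xi_Zprod; apply: below_prod.
    by rewrite size_map ltnS; apply: leqW; rewrite -wu leq_size_wt.
  move=> x /mapP[s su ->]; apply: spans_sub; exists (wtT s).
  by apply: LgenLetter; apply: (allP lu).
have e2 (w : F) : psi2 al w = al w + al w.
  rewrite /psi2 /al; have [->|w0] := eqVneq w [::].
    by rewrite big_seq1 addr0.
  rewrite (sum_cuts_ends (fun p r => Zf (tree_elt K t) (p ++ r)) w0) cats0.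
  rewrite [X in _ + _ + X]big1 ?addr0 // => q _; case: ifP => // /negbT.
  rewrite negb_or => /andP[]; case: q.1 => // x p; case: q.2 => // y r _ _.
  by case: p.
have [c [l [gl E]]] := below2 (fun a l => @spansZ _ _ _ a l) (fun l m => @spansD _ _ _ l m)
  (spans0 _) (below_eigen charK generated_lie eg e2).
suff <- : l = tree_elt K t by [].
apply: Zf_inj => w; have := congr1 (fun f => f w) E.
(* At the empty forest [E] reads 0 = c, which removes the counit term. *)
have := congr1 (fun f => f [::]) E; rewrite /al /= /eps eqxx mulr1 addr0 => <-.
by rewrite mul0r add0r.
Qed.

Lemma all_generated x : generated x.
Proof.
elim/malg_ind: x => [|x y gx gy|a x gx|t]; [exact: spans0|exact: spansD|exact: spansZ|].
exact: tree_generated.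
Qed.

Definition whomog m (a : L) := forall t, t \in msupp a -> wtT t = m.

Lemma whomog_coef m (a : L) t : whomog m a -> wtT t != m -> a@_t = 0.
Proof. by move=> ha; apply: contraNeq; rewrite mcoeff_neq0 => /ha ->. Qed.

Lemma Zf_whomog m a (w : F) : whomog m a -> wt w != m -> Zf a w = 0.
Proof.
case: w => [|t [|u w]] //= ha; rewrite -[[:: t]]/([:: t] : F) wt1.
exact: whomog_coef.
Qed.

Lemma conv_whomog m n a b (w : F) : whomog m a -> whomog n b -> wt w != (m + n)%N ->
  conv (Zf a) (Zf b) w = 0.
Proof.
move=> ha hb ne; rewrite /conv big_seq big1 // => q /(wt_cuts deg) wq.
have [w1|w1] := eqVneq (wt q.1) m; last by rewrite (Zf_whomog ha w1) mul0r.
have [w2|w2] := eqVneq (wt q.2) n; last by rewrite (Zf_whomog hb w2) mulr0.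
by move: ne; rewrite -wq w1 w2 eqxx.
Qed.

Lemma lgen_whomog m a : lgen m a -> whomog m a.
Proof.
elim=> [t _ s|k n b c _ hb _ hc t].
  by move=> /(fsubsetP msuppU_le); rewrite inE => /eqP ->.
rewrite -mcoeff_neq0 -[X in X != 0]/(Zf (lie_Br b c) [:: t]) Zf_lie.
apply: contraNeq => ne; rewrite (conv_whomog hb hc) ?wt1 //.
by rewrite (conv_whomog hc hb) ?wt1 ?subrr // addnC.
Qed.

Lemma lgen_gt0 m a : lgen m a -> (0 < m)%N.
Proof. by elim=> [t _|k n b c _ k0 _ _]; [exact: wtT_gt0|rewrite addn_gt0 k0]. Qed.

(** The coefficient of the word [u] in the image of [a] in the free associative algebra on the
    letters; by [jcoef_lie] brackets become commutators there. *)
Definition jcoef (a : L) (u : F) : K := lext (fun w => Zf a w : K^o) (welt B u).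

Lemma Zf_sym a : sym (fun w : F => Zf a w : K^o).
Proof.
suff H (v w : F) : perm_eq v w -> (size v <= 1)%N -> v = w.
  move=> v w vw; have sE := perm_size vw.
  case: (leqP (size v) 1) => sv; first by rewrite (H v w).
  case: v w vw sE sv => [|x [|y v]] //; by move=> [|x' [|y' w]].
by move=> vw sv; apply: perm_small_eq; rewrite // -(perm_size vw).
Qed.

Lemma jcoef_wt m a u : whomog m a -> all (letter B) u -> wt u != m -> jcoef a u = 0.
Proof.
move=> ha lu ne; apply: (@lext_zero K F K^o) => w /(welt_homog lu) E.
by apply: (Zf_whomog ha); rewrite E.
Qed.

Lemma jcoef_conv a b u : all (letter B) u ->
  lext (fun w => conv (Zf a) (Zf b) w : K^o) (welt B u) =
  \sum_(q <- splits u) jcoef a q.1 * jcoef b q.2.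
Proof.
move=> lu.
rewrite (welt_cuts (phi := fun p r => (Zf a p * Zf b r : K^o))) //; last first.
  by split=> [r p p' pp'|p r r' rr']; congr (_ * _); apply: Zf_sym.
by apply: eq_bigr => q _; exact: ev2_mul.
Qed.

Lemma jcoef_lie a b u : all (letter B) u -> jcoef (lie_Br a b) u =
  \sum_(q <- splits u) jcoef a q.1 * jcoef b q.2 -
  \sum_(q <- splits u) jcoef b q.1 * jcoef a q.2.
Proof.
move=> lu; rewrite -!jcoef_conv // /jcoef.
have -> : Zf (lie_Br a b) = fun w => conv (Zf a) (Zf b) w - conv (Zf b) (Zf a) w.
  by apply/funext => w; rewrite Zf_lie.
exact: (@lext_sub K F K^o).
Qed.

Lemma sum_splits_pair (u v w : F) :
  \sum_(q <- splits u) ((q.1 == v) && (q.2 == w))%:R = (u == v ++ w)%:R :> K.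
Proof.
elim: u v w => [|x u IH] v w.
  by rewrite big_seq1 /=; case: v; case: w.
rewrite (sum_splits_cons x u (fun p r => ((p == v) && (r == w))%:R)).
case: v => [|y v].
  by rewrite /= big1 ?addr0.
rewrite /= add0r eqseq_cons -mulnb natrM -IH mulr_sumr; apply: eq_bigr => q _.
by rewrite eqseq_cons -andbA -mulnb natrM.
Qed.

(** Regroups a product of two homogeneous elements by the concatenated word; the hypothesis discards
    the splits whose parts have other weights. *)
Lemma sum_wlist_splits (W : lmodType K) (f : F -> F -> K) (G : F -> W) m n :
  (forall v w, all (letter B) v -> all (letter B) w ->
     (wt v != m) || (wt w != n) -> f v w = 0) ->
  \sum_(u <- wlist B (m + n)) (\sum_(q <- splits u) f q.1 q.2) *: G u =
  \sum_(v <- wlist B m) \sum_(w <- wlist B n) f v w *: G (v ++ w).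
Proof.
move=> f0.
have pickE k (x : F) (H : F -> W) : x \in wlist B k ->
    \sum_(v <- wlist B k) (v == x)%:R *: H v = H x.
  move=> xk; rewrite (bigD1_seq x) ?wlist_uniq //= eqxx scale1r big1 ?addr0 // => v.
  by move=> /negPf ->; rewrite scale0r.
transitivity (\sum_(u <- wlist B (m + n)) \sum_(v <- wlist B m) \sum_(w <- wlist B n)
   (u == v ++ w)%:R *: (f v w *: G u)); last first.
  rewrite exchange_big /= big_seq [RHS]big_seq; apply: eq_bigr => v.
  rewrite mem_wlist => /andP[lv /eqP wv]; rewrite exchange_big /= big_seq [RHS]big_seq.
  apply: eq_bigr => w; rewrite mem_wlist => /andP[lw /eqP ww].
  by rewrite (pickE _ _ (fun u => f v w *: G u)) // mem_wlist all_cat lv lw wt_cat wv ww /=.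
rewrite big_seq [RHS]big_seq; apply: eq_bigr => u; rewrite mem_wlist => /andP[lu /eqP wu].
transitivity (\sum_(q <- splits u) \sum_(v <- wlist B m) \sum_(w <- wlist B n)
    (((q.1 == v) && (q.2 == w))%:R * f v w) *: G u).
  rewrite scaler_suml big_seq [RHS]big_seq; apply: eq_bigr => q qu.
  have [l1 l2] := splits_word qu lu.
  have [/andP[/eqP w1 /eqP w2]|] := boolP ((wt q.1 == m) && (wt q.2 == n)); last first.
    rewrite negb_and => ne; rewrite f0 // scale0r big_seq big1 // => v.
    rewrite mem_wlist => /andP[_ /eqP wv]; rewrite big_seq big1 // => w.
    rewrite mem_wlist => /andP[_ /eqP ww].
    case: eqP => [E1|_]; last by rewrite mul0r scale0r.
    case: eqP => [E2|_]; last by rewrite mul0r scale0r.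
    by move: ne; rewrite E1 E2 wv ww !eqxx.
  transitivity (\sum_(v <- wlist B m) (v == q.1)%:R *: (\sum_(w <- wlist B n)
      (w == q.2)%:R *: (f v w *: G u))).
    rewrite (pickE _ _ (fun v => \sum_(w <- wlist B n) (w == q.2)%:R *: (f v w *: G u))).
      by rewrite (pickE _ _ (fun w => f q.1 w *: G u)) // mem_wlist l2 w2 eqxx.
    by rewrite mem_wlist l1 w1 eqxx.
  apply: eq_bigr => v _; rewrite scaler_sumr; apply: eq_bigr => w _.
  by rewrite !scalerA -mulnb natrM [v == _]eq_sym [w == _]eq_sym.
rewrite exchange_big; apply: eq_bigr => v _; rewrite exchange_big; apply: eq_bigr => w _ /=.
by rewrite -scaler_suml -mulr_suml sum_splits_pair scalerA.
Qed.

Lemma jcoef_letter t u : letter B t -> all (letter B) u ->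
  jcoef (tree_elt K t) u = (u == [:: t])%:R.
Proof.
move=> lt lu; have <- : lext (xi K [:: t]) (welt B u) = (u == [:: t])%:R.
  by apply: xi_welt => //=; rewrite lt.
by apply: (@eq_lext K F K^o) => w; rewrite xi1 Zf_tree.
Qed.

Lemma lext_jcoef a u : lext (fun t => jcoef (tree_elt K t) u : K^o) a = jcoef a u.
Proof.
rewrite /jcoef (@lext_exch _ _ _ K^o); apply: (@eq_lext K F K^o) => w.
by rewrite Zf_lext; apply: (@eq_lext K T K^o) => t; rewrite Zf_tree.
Qed.

(** * Extension of a map on the letters by Dynkin's bracketing *)

Section Universal.
Variables (L' : lmodType K) (br' : L' -> L' -> L') (lie' : is_lie br').
Variable f : {t : T | letter B t} -> L'.

Definition fT (t : T) : L' := if insub t is Some i then f i else 0.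

(** The action on L' of the free associative algebra on the letters, a letter acting by its
    bracket. *)
Fixpoint ad (u : F) (a : L') : L' := if u is t :: v then br' (fT t) (ad v a) else a.

(* The weighted right-normed bracketing: on Lie elements of weight m it is m *)
(* times the morphism extending f (Dynkin). *)
Fixpoint rnorm (u : F) : L' :=
  if u is t :: v then
    if v is [::] then (wtT t)%:R *: fT t else br' (fT t) (rnorm v)
  else 0.

Lemma rnorm_cat (u v : F) : v != [::] -> rnorm (u ++ v) = ad u (rnorm v).
Proof. by case: v => // s v _; elim: u => //= t u <-; case: u. Qed.

Lemma ad_cat u v a : ad (u ++ v) a = ad u (ad v a).
Proof. by elim: u => //= t u ->. Qed.

Lemma ad_sum u (I : Type) (r : seq I) (c : I -> K) (g : I -> L') :
  ad u (\sum_(i <- r) c i *: g i) = \sum_(i <- r) c i *: ad u (g i).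
Proof.
elim: u => //= t u ->; rewrite (lie_sumr lie'); apply: eq_bigr => i _.
exact: lieZr lie' _ _ _.
Qed.

Definition lie_ext_tree (t : T) : L' :=
  (wtT t)%:R^-1 *: \sum_(u <- wlist B (wtT t)) jcoef (tree_elt K t) u *: rnorm u.
Definition lie_ext : L -> L' := lext lie_ext_tree.
HB.instance Definition _ := GRing.Linear.on lie_ext.

Lemma lie_ext_whomog m a : (0 < m)%N -> whomog m a ->
  m%:R *: lie_ext a = \sum_(u <- wlist B m) jcoef a u *: rnorm u.
Proof.
move=> m0 ha; have mK : m%:R != 0 :> K by case: (m) m0 => // n _; apply: natK_neq0.
rewrite /lie_ext (eq_lext_supp (g := fun t => m%:R^-1 *:
   \sum_(u <- wlist B m) jcoef (tree_elt K t) u *: rnorm u)); last first.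
  by move=> t /ha wm; rewrite /lie_ext_tree wm.
rewrite lext_scale scalerA divff // scale1r lext_sum; apply: eq_bigr => u _.
by rewrite lext_scalel lext_jcoef.
Qed.

Lemma lie_ext_letter t : letter B t -> lie_ext (tree_elt K t) = fT t.
Proof.
move=> lt; rewrite /lie_ext /tree_elt lextU /lie_ext_tree.
have tw : [:: t] \in wlist B (wtT t) by rewrite mem_wlist /= lt wt1 eqxx.
have tK : (wtT t)%:R != 0 :> K.
  by have := wtT_gt0 deg_gt0 t; case: (wtT t) => // n _; apply: natK_neq0.
rewrite (bigD1_seq [:: t]) ?wlist_uniq //= big_seq_cond big1 => [|u].
  by rewrite addr0 jcoef_letter ?eqxx ?scale1r /= ?lt // scalerA mulVf // scale1r.
rewrite mem_wlist => /andP[/andP[lu _] ne].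
by rewrite jcoef_letter // (negPf ne) scale0r.
Qed.

Lemma sum_jcoef_lie m n a b (G : F -> L') : whomog m a -> whomog n b ->
  \sum_(u <- wlist B (m + n)) jcoef (lie_Br a b) u *: G u =
  \sum_(v <- wlist B m) \sum_(w <- wlist B n) (jcoef a v * jcoef b w) *: G (v ++ w) -
  \sum_(v <- wlist B n) \sum_(w <- wlist B m) (jcoef b v * jcoef a w) *: G (v ++ w).
Proof.
move=> ha hb.
rewrite -(sum_wlist_splits (f := fun v w => jcoef a v * jcoef b w)); last first.
  move=> v w lv lw /orP[ne|ne]; first by rewrite (jcoef_wt ha) ?mul0r.
  by rewrite (jcoef_wt hb) ?mulr0.
rewrite -(sum_wlist_splits (f := fun v w => jcoef b v * jcoef a w)); last first.
  move=> v w lv lw /orP[ne|ne]; first by rewrite (jcoef_wt hb) ?mul0r.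
  by rewrite (jcoef_wt ha) ?mulr0.
rewrite [(n + m)%N]addnC -sumrB big_seq [RHS]big_seq; apply: eq_bigr => u.
by rewrite mem_wlist => /andP[lu _]; rewrite jcoef_lie // scalerBl.
Qed.

(** The image of [a] in the free associative algebra acts on L' as the bracket with [lie_ext a]. *)
Definition ad_compatible m a :=
  forall x, \sum_(u <- wlist B m) jcoef a u *: ad u x = br' (lie_ext a) x.

Lemma ad_pair m n a b (G : F -> L') : ad_compatible m a ->
  \sum_(v <- wlist B m) \sum_(w <- wlist B n) (jcoef a v * jcoef b w) *: ad v (G w) =
  br' (lie_ext a) (\sum_(w <- wlist B n) jcoef b w *: G w).
Proof.
move=> ca; rewrite -ca; apply: eq_bigr => v _; rewrite ad_sum scaler_sumr.
by apply: eq_bigr => w _; rewrite scalerA.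
Qed.

(** Dynkin's argument: with brackets taken between the images, [rnorm] sends the commutator of a and
    b to n [a, b] - m [b, a] = (m + n) [a, b]. *)
Lemma lie_ext_lie_compatible m n a b : (0 < m)%N -> (0 < n)%N -> whomog m a -> whomog n b ->
  whomog (m + n) (lie_Br a b) -> ad_compatible m a -> ad_compatible n b ->
  lie_ext (lie_Br a b) = br' (lie_ext a) (lie_ext b).
Proof.
move=> m0 n0 ha hb hab ca cb.
have mnK : (m + n)%:R != 0 :> K by rewrite -(prednK m0) addSn; apply: natK_neq0.
apply: (scalerI mnK); rewrite lie_ext_whomog ?addn_gt0 ?m0 // (sum_jcoef_lie _ ha hb).
have nE k l c d : (0 < l)%N ->
    \sum_(v <- wlist B k) \sum_(w <- wlist B l) (jcoef c v * jcoef d w) *: rnorm (v ++ w) =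
    \sum_(v <- wlist B k) \sum_(w <- wlist B l) (jcoef c v * jcoef d w) *: ad v (rnorm w).
  move=> l0; apply: eq_bigr => v _; rewrite big_seq [RHS]big_seq; apply: eq_bigr => w.
  rewrite mem_wlist => /andP[_ /eqP ww]; rewrite rnorm_cat //.
  by rewrite -(wt_eq0 deg_gt0) ww -lt0n.
rewrite !nE // (ad_pair _ _ _ ca) (ad_pair _ _ _ cb) -!lie_ext_whomog //.
rewrite !(lieZr lie') (lie_anti lie' (lie_ext b)) scalerN opprK -scalerDl.
by rewrite natrD addrC.
Qed.

(** For a letter [t] both sides are the bracket with [fT t]; for a bracket, the commutator of two
    adjoint actions is the adjoint action of the bracket ([lie_ad]). *)
Lemma lgen_compatible m a : lgen m a -> ad_compatible m a.
Proof.
elim=> [t lt x|k n b c gb cb gc cc x].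
  have tw : [:: t] \in wlist B (wtT t) by rewrite mem_wlist /= lt wt1 eqxx.
  rewrite (bigD1_seq [:: t]) ?wlist_uniq //= big_seq_cond big1 => [|u].
    by rewrite addr0 jcoef_letter ?eqxx ?scale1r /= ?lt // lie_ext_letter.
  rewrite mem_wlist => /andP[/andP[lu _] ne].
  by rewrite jcoef_letter // (negPf ne) scale0r.
have hb := lgen_whomog gb; have hc := lgen_whomog gc.
rewrite (sum_jcoef_lie _ hb hc).
rewrite (lie_ext_lie_compatible (lgen_gt0 gb) (lgen_gt0 gc) hb hc _ cb cc); last first.
  exact: (lgen_whomog (LgenLie gb gc)).
have aE k' l' d e : \sum_(v <- wlist B k') \sum_(w <- wlist B l')
      (jcoef d v * jcoef e w) *: ad (v ++ w) x =
    \sum_(v <- wlist B k') \sum_(w <- wlist B l') (jcoef d v * jcoef e w) *: ad v (ad w x).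
  by apply: eq_bigr => v _; apply: eq_bigr => w _; rewrite ad_cat.
rewrite !aE (ad_pair _ _ (ad^~ x) cb) (ad_pair _ _ (ad^~ x) cc) cb cc.
by rewrite (lie_ad lie').
Qed.

Lemma lie_ext_lie : lie_morphism (@lie_Br K D) br' lie_ext.
Proof.
have extP c a b : lie_ext (c *: a + b) = c *: lie_ext a + lie_ext b by exact: linearP.
have ext0 : lie_ext 0 = 0 by exact: linear0.
move=> a b /=; change (lie_ext (lie_Br a b) = br' (lie_ext a) (lie_ext b)).
elim: (all_generated a) => [|c x y [m gx] _ IH].
  by rewrite (lie0l lieB) ext0 (lie0l lie').
rewrite (lieDl lieB) (lieZl lieB) extP IH [lie_ext (c *: x + y)]extP (lieDl lie') (lieZl lie').
congr (_ *: _ + _).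
elim: (all_generated b) => [|d u v [n gu] _ IH'].
  by rewrite (lie0r lieB) ext0 (lie0r lie').
rewrite (lieDr lieB) (lieZr lieB) extP IH' [lie_ext (d *: u + v)]extP (lieDr lie') (lieZr lie').
congr (_ *: _ + _).
apply: (lie_ext_lie_compatible (lgen_gt0 gx) (lgen_gt0 gu)); try exact: lgen_whomog.
- exact: (lgen_whomog (LgenLie gx gu)).
- exact: lgen_compatible.
- exact: lgen_compatible.
Qed.

Lemma lie_ext_unique (psi : {linear L -> L'}) : lie_morphism (@lie_Br K D) br' psi ->
  (forall i, psi (tree_elt K (val i)) = f i) -> psi =1 lie_ext.
Proof.
move=> mpsi psif x.
have extP c a b : lie_ext (c *: a + b) = c *: lie_ext a + lie_ext b by exact: linearP.
have ext0 : lie_ext 0 = 0 by exact: linear0.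
elim: (all_generated x) => [|c y z [m gy] _ IH]; first by rewrite linear0 ext0.
rewrite linearP extP IH; congr (_ *: _ + _).
elim: gy => [t lt|k n a b _ Ea _ Eb].
  by rewrite lie_ext_letter // /fT insubT -psif.
by rewrite mpsi Ea Eb; apply/esym/lie_ext_lie.
Qed.

End Universal.

Theorem free_lie_Br : free_lie (@lie_Br K D).
Proof.
split; first exact: lie_Br_is_lie.
exists {t : T | letter B t}, (fun i => tree_elt K (val i)) => L' br' lie' f.
exists (lie_ext br' f); split=> [|i|psi mpsi psif].
- exact: lie_ext_lie.
- have -> : (lie_ext br' f \o (fun i => tree_elt K (val i))) i = lie_ext br' f (tree_elt K (val i)) by [].
  rewrite lie_ext_letter; last exact: valP.
  by rewrite /fT valK.
- exact: lie_ext_unique.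
Qed.

End Free.

Theorem corollary13 (K : fieldType) (charK : [pchar K] =i pred0)
    (D : choiceType) (deg : D -> nat)
    (finD : forall n : nat, finite_set [set d : D | deg d = n])
    (D0 : [set d : D | deg d = 0%N] = set0) :
  cofree_coalgebra (@comulPRab K D) (@counitPRab K D) /\
  free_lie (@lie_Br K D).
Proof.
have deg_gt0 d : (0 < deg d)%N.
  rewrite lt0n; apply/eqP => d0.
  by have : [set d : D | deg d = 0%N] d by []; rewrite D0.
have fin_deg n : exists s : seq D, forall d, deg d = n -> d \in s.
  have /finite_seqP[s sE] := finD n; exists s => d dn.
  by have : [set d : D | deg d = n] d by []; rewrite sE.
have [B] := word_basis_exists charK deg_gt0 fin_deg.
by split; [apply: (cofree_HPRab B)|apply: (free_lie_Br charK deg_gt0 B)].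
Qed.
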